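(* Let $n=1$, $b>0$, $\Omega=(-b,b)$, $\chi>0$ and $0<\lambda<\frac{\chi(1+\chi|\Omega|)}{2|\Omega|}$. Then there exists a unique global solution $u\ge0$ of $(P_\lambda)$ in $\Omega\times(0,\infty)$ with $u_0=0$, and there exists a solution $v$ of $(S^N_\lambda)$ which satisfies $$\int_{-b}^b v_x^2\,dx\le\frac{2\lambda}{\chi(1+\chi|\Omega|)}.$$ Hence $\lambda_N^{\ast}\ge\frac{\chi(1+\chi|\Omega|)}{2|\Omega|}$.
   Context: $(S^N_\lambda)$ is the problem $-\Delta v=\frac{\lambda}{(1-v)^2\left(1+\chi\int_\Omega\frac{dx}{1-v}\right)^2}$ in $\Omega$, $v=0$ on $\partial\Omega$; a solution is a function $v\in C^2(\Omega)\cap C(\overline\Omega)$ with $0\le v<1$ in $\Omega$ satisfying it classically. $\lambda_N^{\ast}=\sup\{\lambda_0>0:(S^N_\lambda)\text{ has a solution for every }0\le\lambda\le\lambda_0\}$. For $0<T\le\infty$, $(P_\lambda)$ is the problem $$\frac{\partial u}{\partial t}=\Delta u+\frac{\lambda}{(1-u)^2\left(1+\chi\int_\Omega\frac{dy}{1-u(y,t)}\right)^2}\ \text{ in }\Omega\times(0,T),\quad u=0\ \text{ on }\partial\Omega\times(0,T),\quad u(x,0)=u_0\ \text{ in }\Omega.$$ A solution in $\Omega\times(0,T)$ is a function $u\in C^{2,1}(\Omega\times(0,T))\cap C(\overline\Omega\times(0,T))$, $0\le u<1$, satisfying the equation classically with $u=0$ on $\partial\Omega\times(0,T)$, such that $\sup_{\overline\Omega\times(0,T']}u<1$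 for all $0<T'<T$ and $\|u(\cdot,t)-u_0\|_{L^1(\Omega)}\to0$ as $t\to0$. A global solution is a solution in $\Omega\times(0,\infty)$. $|\Omega|=2b$. *)

(* Defs.v *)
From Stdlib Require Import Reals.
From Coquelicot Require Import Coquelicot.
Open Scope R_scope.

Definition Omega (b x : R) : Prop := - b < x < b.
Definition Omega_bar (b x : R) : Prop := - b <= x <= b.
Definition bd_Omega (b x : R) : Prop := x = - b \/ x = b.
Definition len_Omega (b : R) : R := 2 * b.

(* [T] ranges over [Rbar] so that [T = p_infty] is allowed. *)
Definition time (T : Rbar) (t : R) : Prop := 0 < t /\ Rbar_lt t T.

(* Functions are total on R (or R * R), but only their values on the closure
   of the domain matter.  [ex_derive_n f 2] alone does not entail [ex_derive f],
   hence the quantification over all orders [k <= 2]. *)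
Definition C2_on (D : R -> Prop) (v : R -> R) : Prop :=
  forall x, D x -> forall k, (k <= 2)%nat ->
    ex_derive_n v k x /\ continuous (Derive_n v k) x.

(* C^{2,1} on an open set [D]: [u], [u_x], [u_xx] and [u_t] exist and are jointly
   continuous in [D]; the first argument of [u] is space, the second time. *)
Definition C21_on (D : R * R -> Prop) (u : R -> R -> R) : Prop :=
  forall x t, D (x, t) ->
    (forall k, (k <= 2)%nat ->
       ex_derive_n (fun y => u y t) k x /\
       continuous (fun p : R * R => Derive_n (fun y => u y (snd p)) k (fst p)) (x, t)) /\
    ex_derive (fun s => u x s) t /\
    continuous (fun p : R * R => Derive (fun s => u (fst p) s) (snd p)) (x, t).

(* The reaction term at [x] for a spatial profile [w].  For the solutions below
   [w] is continuous on [-b, b] and [w < 1] there, so the integrand is continuous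
   and [RInt] is a genuine integral. *)
Definition reaction (b chi lam : R) (w : R -> R) (x : R) : R :=
  lam / ((1 - w x) ^ 2 * (1 + chi * RInt (fun y => 1 / (1 - w y)) (- b) b) ^ 2).

Definition stationary_solution (b chi lam : R) (v : R -> R) : Prop :=
  C2_on (Omega b) v /\
  continuous_on (Omega_bar b) v /\
  (forall x, Omega b x -> 0 <= v x < 1) /\
  (forall x, Omega b x -> - Derive_n v 2 x = reaction b chi lam v x) /\
  (forall x, bd_Omega b x -> v x = 0).

Definition lambda_N_star (b chi : R) : Rbar :=
  Lub_Rbar (fun lam0 => 0 < lam0 /\
    forall lam, 0 <= lam <= lam0 -> exists v, stationary_solution b chi lam v).

(* Convergence to [u0] in L^1(-b, b) as t -> 0+.  As [u(., t)] is continuous on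
   [-b, b], integrability of [u0] makes [RInt] a genuine integral. *)
Definition L1_initial_value (b : R) (u0 : R -> R) (u : R -> R -> R) : Prop :=
  ex_RInt u0 (- b) b /\
  filterlim (fun t => RInt (fun x => Rabs (u x t - u0 x)) (- b) b)
    (at_right 0) (locally 0).

Definition parabolic_solution (b chi lam : R) (u0 : R -> R) (T : Rbar)
    (u : R -> R -> R) : Prop :=
  C21_on (fun p => Omega b (fst p) /\ time T (snd p)) u /\
  continuous_on (fun p : R * R => Omega_bar b (fst p) /\ time T (snd p))
    (fun p : R * R => u (fst p) (snd p)) /\
  (forall x t, Omega b x -> time T t -> 0 <= u x t < 1) /\
  (forall x t, Omega b x -> time T t ->
     Derive (fun s => u x s) t =
       Derive_n (fun y => u y t) 2 x + reaction b chi lam (fun y => u y t) x) /\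
  (forall x t, bd_Omega b x -> time T t -> u x t = 0) /\
  (forall T', time T T' ->
     Rbar_lt
       (Lub_Rbar (fun z => exists x t, Omega_bar b x /\ 0 < t <= T' /\ z = u x t))
       1) /\
  L1_initial_value b u0 u.

Definition global_solution (b chi lam : R) (u0 : R -> R) (u : R -> R -> R) : Prop :=
  parabolic_solution b chi lam u0 p_infty u.

(* Main.v *)
Require Import Defs.
From Stdlib Require Import Reals Lra Lia ClassicalEpsilon.
From Coquelicot Require Import Coquelicot.
Open Scope R_scope.

(** Since [1 / (1 - u) >= 1], the source is at most [lam / (1 + chi |Omega|)^2 / (1 - u)^2], and
    under the hypothesis on [lam] the parabola [(1 - x^2/b^2)/4] is a supersolution.  So it is
    enough to solve the problem with [1 / (1 - u)] frozen beyond [u = 1/2]; its source is bounded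
    and Lipschitz, and the Picard iteration contracts in a norm weighted by [exp (- g t)].

    Each step solves a linear heat equation whose source [f] is Lipschitz in time, a property
    which the maximum principle propagates.  The sine coefficients [u_n] of the solution then
    satisfy [|u_n'| <= C / (n^2 t)], so [u] and [u_t] are given by absolutely convergent series;
    completeness of the sine modes yields [u = (- d^2/dx^2)^(-1) (f - u_t)], whence [u_xx].

    For uniqueness, the coefficients of the difference [d] of two solutions solve
    [p' = - mu_n p + r]; testing on the dilated profile [d (th x)], [th < 1], avoids any regularity
    at the boundary, and the [L^1] initial condition kills the initial term.  Summing over [n], a
    bound [N exp (g t)] on [d] improves to [N/2 exp (g t)] for large [g].

    The stationary equation [z'' = mu / z^2], [z = 1 - v], is solved explicitly by
    [z = cosh^2 s / cosh^2 S] with [x] proportional to [s + sinh s cosh s]. *)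

(** * Continuity, parametric integrals and dominated series *)

(** The nonlocal source is not order preserving: raising [u] raises [1 / (1 - u)^2] but also the
    integral in the denominator. Solutions of the nonlocal problem are therefore never ordered
    against one another; the maximum principle is applied only to linear equations whose source is
    already given. Regularity is obstructed at the corners of the cylinder. Zero data are
    incompatible with a source that is positive up to the boundary, so at [t = 0] the sine
    coefficients of [u_t] are those of a nonzero constant, of order [1/n] and not absolutely
    summable. This is why the coefficient bound carries the factor [1/t]. An arbitrary solution is
    known near [t = 0] only through its [L^1] norm and need not have derivatives at the boundary.
    Sine coefficients are integrals, hence controlled by that norm; this is why uniqueness goes
    through them and not through a pointwise comparison. In the stationary family the integral of
    [1 / (1 - v)] and the energy have closed forms, so the attained range of [lam] and the energy
    bound reduce to elementary inequalities in [S], [sinh S] and [cosh S]. *)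

Lemma ex_derive_continuousR (f : R -> R) (x : R) : ex_derive f x -> continuous f x.
Proof. apply (ex_derive_continuous (K := R_AbsRing) (V := R_NormedModule)). Qed.

Lemma continuous_plusR (f g : R -> R) (x : R) :
  continuous f x -> continuous g x -> continuous (fun y => f y + g y) x.
Proof. apply (continuous_plus (V := R_NormedModule)). Qed.

Lemma continuous_minusR (f g : R -> R) (x : R) :
  continuous f x -> continuous g x -> continuous (fun y => f y - g y) x.
Proof. apply (continuous_minus (V := R_NormedModule)). Qed.

Lemma continuous_multR (f g : R -> R) (x : R) :
  continuous f x -> continuous g x -> continuous (fun y => f y * g y) x.
Proof. apply (continuous_mult (K := R_AbsRing)). Qed.

Lemma is_derive_plusR (f g : R -> R) (x df dg : R) :
  is_derive f x df -> is_derive g x dg -> is_derive (fun y => f y + g y) x (df + dg).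
Proof. apply (is_derive_plus (K := R_AbsRing) (V := R_NormedModule)). Qed.

Lemma is_derive_minusR (f g : R -> R) (x df dg : R) :
  is_derive f x df -> is_derive g x dg -> is_derive (fun y => f y - g y) x (df - dg).
Proof. apply (is_derive_minus (K := R_AbsRing) (V := R_NormedModule)). Qed.

Lemma is_derive_multR (f g : R -> R) (x df dg : R) :
  is_derive f x df -> is_derive g x dg -> is_derive (fun y => f y * g y) x (df * g x + f x * dg).
Proof. intros Hf Hg; apply (is_derive_mult (K := R_AbsRing) f g); auto using Rmult_comm. Qed.

Lemma ex_RInt_cont (f : R -> R) (a b : R) :
  (forall x, continuous f x) -> ex_RInt f a b.
Proof.
intros Hf; apply (ex_RInt_continuous (V := R_CompleteNormedModule)).
intros x _; apply Hf.
Qed.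

Lemma continuous_lipschitz (f : R -> R) (L : R) :
  (forall x y, Rabs (f y - f x) <= L * Rabs (y - x)) ->
  forall x, continuous f x.
Proof.
intros HL x; apply continuity_pt_filterlim; intros eps Heps.
exists (eps / (Rabs L + 1)).
pose proof (Rabs_pos L) as HL0.
split; [apply Rdiv_lt_0_compat; lra|].
intros y [_ Hy]; simpl in *; unfold R_dist in *.
apply Rle_lt_trans with (1 := HL x y).
apply Rle_lt_trans with ((Rabs L) * Rabs (y - x)).
  apply Rmult_le_compat_r; [apply Rabs_pos | apply Rle_abs].
apply Rle_lt_trans with (Rabs L * (eps / (Rabs L + 1))).
  apply Rmult_le_compat_l; lra.
apply (Rmult_lt_reg_r (Rabs L + 1)); [lra|].
field_simplify; nra.
Qed.

(** Composing with [clamp (- b) b] in space and [Rmax 0] in time extends a function from the closed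
    half-strip to a continuous function on the whole plane. Continuity relative to a subset then
    never has to be carried through the estimates. *)
Definition clamp (a b x : R) : R := Rmax a (Rmin x b).

Lemma clamp_bounds (a b x : R) : a <= b -> a <= clamp a b x <= b.
Proof.
intros Hab; unfold clamp, Rmax, Rmin.
destruct (Rle_dec x b); destruct (Rle_dec a _); lra.
Qed.

Lemma clamp_id (a b x : R) : a <= x <= b -> clamp a b x = x.
Proof.
intros Hx; unfold clamp, Rmax, Rmin.
destruct (Rle_dec x b); destruct (Rle_dec a _); lra.
Qed.

Lemma clamp_lipschitz (a b x y : R) :
  Rabs (clamp a b y - clamp a b x) <= 1 * Rabs (y - x).
Proof.
unfold clamp, Rmax, Rmin.
destruct (Rle_dec x b); destruct (Rle_dec y b);
  repeat destruct (Rle_dec a _); split_Rabs; lra.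
Qed.

Lemma continuous_clamp (a b x : R) : continuous (clamp a b) x.
Proof. apply (continuous_lipschitz _ 1), clamp_lipschitz. Qed.

Lemma Rmax0_lipschitz (x y : R) : Rabs (Rmax 0 y - Rmax 0 x) <= 1 * Rabs (y - x).
Proof. unfold Rmax; repeat destruct (Rle_dec 0 _); split_Rabs; lra. Qed.

Lemma continuous_Rmax0 (x : R) : continuous (Rmax 0) x.
Proof. apply (continuous_lipschitz _ 1), Rmax0_lipschitz. Qed.

Definition cont2 (f : R -> R -> R) : Prop := forall x y, continuity_2d_pt f x y.

Lemma continuous_2d_comp (f : R -> R -> R) (g h : R -> R) (x : R) :
  continuity_2d_pt f (g x) (h x) -> continuous g x -> continuous h x ->
  continuous (fun y => f (g y) (h y)) x.
Proof.
intros Hf Hg Hh.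
apply continuity_2d_pt_filterlim in Hf.
apply (continuous_comp_2 g h f); assumption.
Qed.

Lemma cont2_fst (f : R -> R -> R) (t x : R) : cont2 f -> continuous (fun y => f y t) x.
Proof.
intros Hf; apply (continuous_2d_comp f (fun y => y) (fun _ => t));
  [apply Hf | apply continuous_id | apply continuous_const].
Qed.

Lemma continuity_2d_pt_comp (f : R -> R -> R) (g h : R -> R) (x y : R) :
  continuity_2d_pt f (g x) (h y) -> continuous g x -> continuous h y ->
  continuity_2d_pt (fun x y => f (g x) (h y)) x y.
Proof.
intros Hf Hg Hh; apply continuity_2d_pt_filterlim.
apply (continuous_comp_2 (fun z : R * R => g (fst z)) (fun z => h (snd z)) f).
- apply (continuous_comp fst g); [apply continuous_fst | apply Hg].
- apply (continuous_comp snd h); [apply continuous_snd | apply Hh].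
- apply continuity_2d_pt_filterlim, Hf.
Qed.

Lemma cont2_comp (f : R -> R -> R) (g h : R -> R) :
  cont2 f -> (forall x, continuous g x) -> (forall x, continuous h x) ->
  cont2 (fun x y => f (g x) (h y)).
Proof. intros Hf Hg Hh x y; apply continuity_2d_pt_comp; auto. Qed.

Lemma cont2_1d (g : R -> R) (f : R -> R -> R) :
  (forall x, continuous g x) -> cont2 f -> cont2 (fun x y => g (f x y)).
Proof.
intros Hg Hf x y; apply continuity_1d_2d_pt_comp; [|apply Hf].
apply continuity_pt_filterlim, Hg.
Qed.

Lemma cont2_fst_only (g : R -> R) : (forall x, continuous g x) -> cont2 (fun x _ => g x).
Proof. intros Hg; apply (cont2_1d g); [exact Hg | intros x y; apply continuity_2d_pt_id1]. Qed.

Lemma cont2_snd_only (g : R -> R) : (forall x, continuous g x) -> cont2 (fun _ y => g y).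
Proof. intros Hg; apply (cont2_1d g); [exact Hg | intros x y; apply continuity_2d_pt_id2]. Qed.

(** Heine's theorem on the compact segment [[a, b] * {t}]. *)
Lemma cont2_unif_snd (f : R -> R -> R) (a b t : R) (eps : posreal) :
  cont2 f -> exists delta : posreal, forall s, Rabs (s - t) < delta ->
    forall x, a <= x <= b -> Rabs (f x s - f x t) < eps.
Proof.
intros Hf.
destruct (uniform_continuity_2d_1d f a b t (fun x _ => Hf x t) eps) as [d Hd].
exists d; intros s Hs x Hx.
pose proof (cond_pos d).
apply Hd; try assumption; try (split_Rabs; lra).
Qed.

Lemma cont2_RInt (f : R -> R -> R) (a b : R) :
  a <= b -> cont2 f -> forall t, continuous (fun s => RInt (fun x => f x s) a b) t.
Proof.
intros Hab Hf t; apply filterlim_locally; intros eps.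
(* The [+ 1] keeps the quotient meaningful when [a = b]. *)
assert (He : 0 < eps / (2 * (b - a + 1))).
  apply Rdiv_lt_0_compat; [apply cond_pos | lra].
destruct (cont2_unif_snd f a b t (mkposreal _ He) Hf) as [d Hd].
exists d; intros s Hs.
change (Rabs (RInt (fun x => f x s) a b - RInt (fun x => f x t) a b) < eps).
assert (E : forall s, ex_RInt (fun x => f x s) a b).
  intros s'; apply ex_RInt_cont; intros x; now apply cont2_fst.
replace (RInt (fun x => f x s) a b - RInt (fun x => f x t) a b)
  with (RInt (fun x => f x s - f x t) a b).
2:{ apply is_RInt_unique.
    apply (is_RInt_minus (V := R_NormedModule)); now apply (RInt_correct (V := R_CompleteNormedModule)). }
apply Rle_lt_trans with ((b - a) * (eps / (2 * (b - a + 1)))).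
- apply abs_RInt_le_const; [exact Hab| |].
  + apply (ex_RInt_minus (V := R_NormedModule)); apply E.
  + intros x Hx; apply Rlt_le, (Hd s Hs x Hx).
- pose proof (cond_pos eps).
  apply (Rmult_lt_reg_r (2 * (b - a + 1))); [lra|].
  field_simplify; nra.
Qed.

(** Maximise in [x] first, then in [t]. The maximiser [xm t] picked by choice may jump, but the
    maximal value is continuous in [t] because [f] varies with [t] uniformly in [x]. [cont2_argmin]
    follows the same scheme. *)
Lemma cont2_bounded (f : R -> R -> R) (a b c d : R) :
  cont2 f -> exists M, 0 < M /\ forall x t, a <= x <= b -> c <= t <= d -> Rabs (f x t) <= M.
Proof.
intros Hf.
destruct (Rle_dec a b) as [Hab|Hab]; [|exists 1; split; intros; lra].
assert (Hx : forall t, exists x, a <= x <= b /\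
    forall y, a <= y <= b -> Rabs (f y t) <= Rabs (f x t)).
{ intros t.
  destruct (continuity_ab_maj (fun y => Rabs (f y t)) a b Hab) as [x [Hx1 Hx2]].
  - intros y _; apply continuity_pt_filterlim.
    apply (continuous_comp (fun y => f y t) Rabs); [now apply cont2_fst|apply continuous_Rabs].
  - now exists x. }
destruct (Rle_dec c d) as [Hcd|Hcd]; [|exists 1; split; intros; lra].
set (xm t := proj1_sig (constructive_indefinite_description _ (Hx t))).
assert (Hxm : forall t, a <= xm t <= b /\
    forall y, a <= y <= b -> Rabs (f y t) <= Rabs (f (xm t) t)).
{ intros t; unfold xm; now destruct (constructive_indefinite_description _ (Hx t)). }
destruct (continuity_ab_maj (fun t => Rabs (f (xm t) t)) c d Hcd) as [tm [Htm _]].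
- intros t _; apply continuity_pt_filterlim, filterlim_locally; intros eps.
  destruct (cont2_unif_snd f a b t eps Hf) as [del Hdel].
  exists del; intros s Hs.
  change (Rabs (Rabs (f (xm s) s) - Rabs (f (xm t) t)) < eps).
  destruct (Hxm t) as [H1 H2]; destruct (Hxm s) as [H3 H4].
  pose proof (Hdel s Hs (xm s) H3) as H5; pose proof (Hdel s Hs (xm t) H1) as H6.
  pose proof (H2 _ H3); pose proof (H4 _ H1).
  split_Rabs; lra.
- exists (Rabs (f (xm tm) tm) + 1); split; [pose proof (Rabs_pos (f (xm tm) tm)); lra|].
  intros x t Hx1 Ht.
  apply Rle_trans with (Rabs (f (xm t) t)); [now apply Hxm|].
  pose proof (Htm t Ht); lra.
Qed.

Lemma cont2_argmin (f : R -> R -> R) (a b c d : R) :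
  a <= b -> c <= d -> cont2 f ->
  exists x0 t0, a <= x0 <= b /\ c <= t0 <= d /\
    forall x t, a <= x <= b -> c <= t <= d -> f x0 t0 <= f x t.
Proof.
intros Hab Hcd Hf.
assert (Hx : forall t, exists x, a <= x <= b /\ forall y, a <= y <= b -> f x t <= f y t).
{ intros t.
  destruct (continuity_ab_min (fun y => f y t) a b Hab) as [x [Hx1 Hx2]].
  - intros y _; apply continuity_pt_filterlim; now apply (cont2_fst f t y).
  - now exists x. }
set (xm t := proj1_sig (constructive_indefinite_description _ (Hx t))).
assert (Hxm : forall t, a <= xm t <= b /\ forall y, a <= y <= b -> f (xm t) t <= f y t).
{ intros t; unfold xm; now destruct (constructive_indefinite_description _ (Hx t)). }
destruct (continuity_ab_min (fun t => f (xm t) t) c d Hcd) as [tm [Htm Htm']].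
- intros t _; apply continuity_pt_filterlim, filterlim_locally; intros eps.
  destruct (cont2_unif_snd f a b t eps Hf) as [del Hdel].
  exists del; intros s Hs.
  change (Rabs (f (xm s) s - f (xm t) t) < eps).
  destruct (Hxm t) as [H1 H2]; destruct (Hxm s) as [H3 H4].
  pose proof (Hdel s Hs (xm s) H3) as H5; pose proof (Hdel s Hs (xm t) H1) as H6.
  pose proof (H2 _ H3); pose proof (H4 _ H1).
  split_Rabs; lra.
- exists (xm tm), tm; repeat split; try apply Hxm; try assumption; try apply Htm'.
  intros x t Hx1 Ht.
  apply Rle_trans with (f (xm t) t); [now apply Htm | now apply Hxm].
Qed.

(** * Dominated series: limits, derivatives and integrals term by term *)

Lemma series_tail_le (q a : nat -> R) (N : nat) :
  ex_series a -> (forall n, Rabs (q n) <= a n) ->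
  Rabs (Series q - sum_n q N) <= Series a - sum_n a N.
Proof.
intros Ha Hq.
assert (Eq : ex_series q).
{ apply (ex_series_le (K := R_AbsRing) (V := R_CompleteNormedModule) q a); assumption. }
rewrite (Series_incr_n q (S N)) by (auto; lia).
rewrite (Series_incr_n a (S N)) by (auto; lia).
simpl pred; rewrite <- !sum_n_Reals.
replace (sum_n q N + _ - _) with (Series (fun k => q (S N + k)%nat)) by ring.
replace (sum_n a N + _ - _) with (Series (fun k => a (S N + k)%nat)) by ring.
assert (E : ex_series (fun k => a (S N + k)%nat)).
{ now apply (ex_series_incr_n (V := R_NormedModule)). }
eapply Rle_trans; [apply Series_Rabs|].
- apply (ex_series_le (K := R_AbsRing) (V := R_CompleteNormedModule) _ (fun k => a (S N + k)%nat)); [|exact E].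
  intros k; unfold norm; simpl; unfold abs; simpl; rewrite Rabs_Rabsolu; apply Hq.
- apply Series_le; [|exact E].
  intros k; split; [apply Rabs_pos|apply Hq].
Qed.

Lemma ex_series_dominated (q a : nat -> R) :
  ex_series a -> (forall n, Rabs (q n) <= a n) -> ex_series q.
Proof.
intros Ha Hq.
apply (ex_series_le (K := R_AbsRing) (V := R_CompleteNormedModule) q a); assumption.
Qed.

Lemma Series_abs_le (q a : nat -> R) :
  ex_series a -> (forall n, Rabs (q n) <= a n) -> Rabs (Series q) <= Series a.
Proof.
intros Ha Hq.
assert (E : ex_series (fun n => Rabs (q n))).
{ apply (ex_series_dominated _ a Ha); intros n; now rewrite Rabs_Rabsolu. }
eapply Rle_trans; [apply Series_Rabs, E|].
apply Series_le; [|exact Ha]; intros n; split; [apply Rabs_pos|apply Hq].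
Qed.

(** Tannery's theorem: the tail is uniformly small by domination, and a finite sum passes to the
    limit. It is stated for an arbitrary filter so that it serves continuity in one and two
    variables as well as difference quotients along [locally' 0]. *)
Lemma series_dominated {T : Type} (F : (T -> Prop) -> Prop) {FF : Filter F}
    (q : nat -> T -> R) (l a : nat -> R) :
  ex_series a -> F (fun h => forall n, Rabs (q n h) <= a n) ->
  (forall n, Rabs (l n) <= a n) ->
  (forall n, filterlim (q n) F (locally (l n))) ->
  filterlim (fun h => Series (fun n => q n h)) F (locally (Series l)).
Proof.
intros Ha Hq Hl Hlim; apply filterlim_locally; intros eps.
pose proof (cond_pos eps) as He.
assert (He3 : 0 < eps / 3) by lra.
pose proof (Series_correct a Ha) as HS.
destruct (proj1 (filterlim_locally _ _) HS (mkposreal _ He3)) as [N HN].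
specialize (HN N (le_n _)).
change (Rabs (sum_n a N - Series a) < eps / 3) in HN.
assert (Hfin : forall e : posreal, F (fun h => Rabs (sum_n (fun n => q n h) N - sum_n l N) < e)).
{ clear -Hlim FF; induction N as [|N IH]; intros e.
  - generalize (proj1 (filterlim_locally _ _) (Hlim 0%nat) e); apply filter_imp.
    intros h Hh; rewrite !sum_O; exact Hh.
  - pose proof (cond_pos e) as He.
    assert (He2 : 0 < e / 2) by lra.
    generalize (filter_and _ _ (IH (mkposreal _ He2))
      (proj1 (filterlim_locally _ _) (Hlim (S N)) (mkposreal _ He2))).
    apply filter_imp; intros h [H1 H2].
    rewrite !sum_Sn.
    change (Rabs (q (S N) h - l (S N)) < e / 2) in H2.
    unfold plus; simpl; simpl in H1.
    split_Rabs; lra. }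
generalize (filter_and _ _ Hq (Hfin (mkposreal _ He3))); apply filter_imp.
intros h [H1 H2]; simpl in H2.
change (Rabs (Series (fun n => q n h) - Series l) < eps).
pose proof (series_tail_le (fun n => q n h) a N Ha H1) as H3.
pose proof (series_tail_le l a N Ha Hl) as H4.
split_Rabs; lra.
Qed.

Lemma series_continuity_2d (f : nat -> R -> R -> R) (a : nat -> R) (x y : R) :
  ex_series a -> (forall n, continuity_2d_pt (f n) x y) ->
  locally_2d (fun u v => forall n, Rabs (f n u v) <= a n) x y ->
  continuity_2d_pt (fun u v => Series (fun n => f n u v)) x y.
Proof.
intros Ha Hf Hb; apply continuity_2d_pt_filterlim.
apply (series_dominated (locally (x, y)) (fun n z => f n (fst z) (snd z))
  (fun n => f n x y) a Ha).
- now apply (locally_2d_locally (fun u v => forall n, Rabs (f n u v) <= a n)).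
- apply (locally_2d_singleton _ _ _ Hb).
- intros n; apply (continuity_2d_pt_filterlim (f n)), Hf.
Qed.

(** By the mean value theorem each difference quotient is a value of [dg n] near [t], hence
    dominated by [a n], and [series_dominated] applies to the quotients. *)
Lemma series_derive (g dg : nat -> R -> R) (a : nat -> R) (t : R) :
  ex_series a -> (forall s, ex_series (fun n => g n s)) ->
  locally t (fun s => forall n, is_derive (g n) s (dg n s) /\ Rabs (dg n s) <= a n) ->
  is_derive (fun s => Series (fun n => g n s)) t (Series (fun n => dg n t)).
Proof.
intros Ha Hg [d Hd].
assert (Hlim : filterlim (fun h => Series (fun n => (g n (t + h) - g n t) / h))
  (locally' 0) (locally (Series (fun n => dg n t)))).
{ apply (series_dominated (locally' 0) (fun n h => (g n (t + h) - g n t) / h)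
    (fun n => dg n t) a Ha).
  - exists d; intros h Hh Hh0 n.
    change (Rabs (h - 0) < d) in Hh.
    destruct (MVT_gen (g n) t (t + h) (dg n)) as [c [Hc1 Hc2]].
    + intros x Hx; apply Hd; change (Rabs (x - t) < d).
      revert Hx; unfold Rmin, Rmax; destruct (Rle_dec t (t + h)); split_Rabs; lra.
    + intros x Hx; apply continuity_pt_filterlim.
      apply ex_derive_continuousR.
      exists (dg n x); apply Hd; change (Rabs (x - t) < d).
      revert Hx; unfold Rmin, Rmax; destruct (Rle_dec t (t + h)); split_Rabs; lra.
    + rewrite Hc2; replace (dg n c * (t + h - t) / h) with (dg n c) by (field; exact Hh0).
      apply Hd; change (Rabs (c - t) < d).
      revert Hc1; unfold Rmin, Rmax; destruct (Rle_dec t (t + h)); split_Rabs; lra.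
  - intros n; apply Hd, ball_center.
  - intros n; apply filterlim_locally; intros eps.
    destruct (Hd t (ball_center t d) n) as [H _].
    apply is_derive_Reals in H.
    destruct (H eps (cond_pos eps)) as [del Hdel].
    exists del; intros h Hh Hh0; apply (Hdel h Hh0).
    change (Rabs (h - 0) < del) in Hh; now rewrite Rminus_0_r in Hh. }
apply is_derive_Reals; intros eps Heps.
destruct (proj1 (filterlim_locally _ _) Hlim (mkposreal _ Heps)) as [del Hdel].
exists del; intros h Hh0 Hh.
replace ((Series (fun n => g n (t + h)) - Series (fun n => g n t)) / h)
  with (Series (fun n => (g n (t + h) - g n t) / h)).
- apply Hdel; [|exact Hh0].
  change (Rabs (h - 0) < del); now rewrite Rminus_0_r.
- rewrite <- Series_minus by apply Hg.
  unfold Rdiv; now rewrite <- Series_scal_r.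
Qed.

Lemma series_continuous (f : nat -> R -> R) (a : nat -> R) (x : R) :
  ex_series a -> (forall n, continuous (f n) x) -> (forall n y, Rabs (f n y) <= a n) ->
  continuous (fun y => Series (fun n => f n y)) x.
Proof.
intros Ha Hf Hb; apply (series_dominated (locally x) f (fun n => f n x) a Ha).
- apply filter_forall; intros y n; apply Hb.
- intros n; apply Hb.
- exact Hf.
Qed.

Lemma Series_single (a : nat -> R) (m : nat) :
  (forall n, n <> m -> a n = 0) -> Series a = a m.
Proof.
intros Ha; apply is_series_unique.
apply (filterlim_ext_loc (fun _ => a m)).
- exists m; intros n Hn.
  induction n as [|n IH].
  + rewrite sum_O; replace m with 0%nat by lia; reflexivity.
  + rewrite sum_Sn; destruct (Nat.eq_dec (S n) m) as [E|E].
    * subst m; clear IH Hn.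
      assert (H : forall k, (k <= n)%nat -> sum_n a k = 0).
      { induction k as [|k IHk]; intros Hk.
        - rewrite sum_O; apply Ha; lia.
        - rewrite sum_Sn, IHk, Ha by lia; apply (plus_zero_l (G := R_AbelianMonoid)). }
      change (a (S n) = sum_n a n + a (S n)); rewrite (H n (le_n n)); ring.
    * rewrite (Ha (S n) E), <- IH by lia; symmetry; apply (plus_zero_r (G := R_AbelianMonoid)).
- apply filterlim_const.
Qed.

(** The series of the integrals from [A] to [y] is differentiable in [y] term by term, so it is a
    primitive of the sum, and the fundamental theorem of calculus finishes. The integral from [A] to
    [y] is dominated by [|y - A| a n]. *)
Lemma RInt_Series (f : nat -> R -> R) (a : nat -> R) (A B : R) :
  ex_series a -> (forall n x, continuous (f n) x) -> (forall n x, Rabs (f n x) <= a n) ->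
  RInt (fun x => Series (fun n => f n x)) A B = Series (fun n => RInt (f n) A B).
Proof.
intros Ha Hf Hb.
assert (E : forall n y z, ex_RInt (f n) y z) by (intros; apply ex_RInt_cont, Hf).
assert (Hdom : forall y n, Rabs (RInt (f n) A y) <= Rabs (y - A) * a n).
{ intros y n; destruct (Rle_dec A y) as [H|H].
  - rewrite (Rabs_pos_eq (y - A)) by lra; apply abs_RInt_le_const; auto.
  - rewrite <- (opp_RInt_swap (V := R_CompleteNormedModule)) by apply E.
    unfold opp; simpl; rewrite Rabs_Ropp.
    rewrite (Rabs_left1 (y - A)) by lra.
    replace (- (y - A)) with (A - y) by ring.
    apply abs_RInt_le_const; auto; lra. }
assert (Hser : forall y, ex_series (fun n => RInt (f n) A y)).
{ intros y; apply (ex_series_dominated _ (fun n => Rabs (y - A) * a n)); [|apply Hdom].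
  apply (ex_series_scal (V := R_NormedModule)), Ha. }
assert (HD : is_RInt (fun x => Series (fun n => f n x)) A B
   (minus (Series (fun n => RInt (f n) A B)) (Series (fun n => RInt (f n) A A)))).
{ apply (is_RInt_derive (fun y => Series (fun n => RInt (f n) A y))).
  - intros y _; apply (series_derive (fun n y => RInt (f n) A y) f a y Ha Hser).
    apply filter_forall; intros s n; split; [|apply Hb].
    apply (is_derive_RInt (f n) _ A).
    + apply filter_forall; intros z; apply (RInt_correct (V := R_CompleteNormedModule)), E.
    + apply Hf.
  - intros y _; apply (series_continuous f a y Ha); auto. }
rewrite (is_RInt_unique _ _ _ _ HD).
rewrite (Series_single (fun n => RInt (f n) A A) 0).
- rewrite (RInt_point (V := R_CompleteNormedModule)).
  unfold minus, plus, opp, zero; simpl; ring.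
- intros n _; apply (RInt_point (V := R_CompleteNormedModule)).
Qed.

Lemma is_series_telescope (m : R) : 0 < m ->
  is_series (fun n => / (INR n + m) - / (INR n + m + 1)) (/ m).
Proof.
intros Hm.
change (is_lim_seq (sum_n (fun n => / (INR n + m) - / (INR n + m + 1))) (/ m)).
apply (is_lim_seq_ext (fun n => / m - / (INR n + m + 1))).
- intros n; induction n as [|n IH].
  + rewrite sum_O; simpl INR; rewrite Rplus_0_l; reflexivity.
  + rewrite sum_Sn, <- IH, S_INR; unfold plus; simpl.
    replace (INR n + 1 + m) with (INR n + m + 1) by ring; ring.
- assert (H : is_lim_seq (fun n => / (INR n + m + 1)) 0).
  { replace (Finite 0) with (Rbar_inv p_infty) by reflexivity.
    apply is_lim_seq_inv; [|easy].
    apply (is_lim_seq_ext (fun n => INR n + (m + 1))); [intros; ring|].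
    apply (is_lim_seq_plus _ _ p_infty (m + 1) p_infty);
      [apply is_lim_seq_INR|apply is_lim_seq_const|reflexivity]. }
  pose proof (is_lim_seq_minus' _ _ (/ m) 0 (is_lim_seq_const (/ m)) H) as HL.
  now rewrite Rminus_0_r in HL.
Qed.

(** From [2 ((n+1)^2 + m^2) >= (n+1+m)^2 >= (n+m) (n+m+1)]; the right-hand side telescopes. *)
Lemma inv_sq_shift_le (m : R) (n : nat) : 1 <= m ->
  / ((INR n + 1) ^ 2 + m ^ 2) <= 2 * (/ (INR n + m) - / (INR n + m + 1)).
Proof.
intros Hm; pose proof (pos_INR n) as Hn.
replace (2 * (/ (INR n + m) - / (INR n + m + 1)))
  with (/ ((INR n + m) * (INR n + m + 1) / 2)) by (field; lra).
pose proof (pow2_ge_0 (INR n + 1 - m)) as Hsq.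
apply Rinv_le_contravar; nra.
Qed.

Lemma inv_sq_le (n : nat) : / (INR n + 1) ^ 2 <= 4 * (/ (INR n + 1) - / (INR n + 1 + 1)).
Proof.
pose proof (pos_INR n) as Hn.
replace (4 * (/ (INR n + 1) - / (INR n + 1 + 1)))
  with (/ ((INR n + 1) * (INR n + 1 + 1) / 4)) by (field; lra).
apply Rinv_le_contravar; nra.
Qed.

Lemma ex_series_inv_sq : ex_series (fun n => / (INR n + 1) ^ 2).
Proof.
apply (ex_series_dominated _ (fun n => 4 * (/ (INR n + 1) - / (INR n + 1 + 1)))).
- apply (ex_series_scal (V := R_NormedModule)).
  exists (/ 1); apply is_series_telescope; lra.
- intros n; rewrite Rabs_pos_eq; [apply inv_sq_le|].
  apply Rlt_le, Rinv_0_lt_compat, pow_lt; pose proof (pos_INR n); lra.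
Qed.

(** The decay [2 / m] is the source of the contraction in the uniqueness proof: there [m] is the
    square root of the exponential weight, up to the factor [freq b]. *)
Lemma Series_inv_sq_shift (m : R) : 1 <= m ->
  ex_series (fun n => / ((INR n + 1) ^ 2 + m ^ 2)) /\
  Series (fun n => / ((INR n + 1) ^ 2 + m ^ 2)) <= 2 / m.
Proof.
intros Hm.
assert (Hpos : forall n, 0 <= / ((INR n + 1) ^ 2 + m ^ 2)).
{ intros n; apply Rlt_le, Rinv_0_lt_compat; pose proof (pos_INR n); nra. }
assert (HT := is_series_telescope m ltac:(lra)).
assert (E : ex_series (fun n => 2 * (/ (INR n + m) - / (INR n + m + 1)))).
{ apply (ex_series_scal (V := R_NormedModule)); now exists (/ m). }
split.
- apply (ex_series_dominated _ _ E); intros n.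
  rewrite Rabs_pos_eq by apply Hpos; now apply inv_sq_shift_le.
- apply Rle_trans with (Series (fun n => 2 * (/ (INR n + m) - / (INR n + m + 1)))).
  + apply Series_le; [|exact E]; intros n; split; [apply Hpos|now apply inv_sq_shift_le].
  + rewrite Series_scal_l, (is_series_unique _ _ HT); right; reflexivity.
Qed.

(** * The sine modes: by parts, orthogonality, completeness *)

(* [RInt] and [sum_n] produce equations in structure carriers, which [ring] rejects. *)
Ltac in_R := match goal with |- @eq _ ?a ?b => change (@eq R a b) end.

Definition freq (b : R) : R := PI / (2 * b).
(** The Dirichlet eigenfunctions of the interval, numbered from 0, so that [n] stands for [n + 1]
    half waves. Their squared [L^2] norm is [b], whence the division by [b] in [coef]. *)
Definition mode (b : R) (n : nat) (x : R) : R := sin ((INR n + 1) * (freq b * (x + b))).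
Definition dmode (b : R) (n : nat) (x : R) : R :=
  (INR n + 1) * freq b * cos ((INR n + 1) * (freq b * (x + b))).
Definition eig (b : R) (n : nat) : R := ((INR n + 1) * freq b) ^ 2.

Lemma freq_pos (b : R) : 0 < b -> 0 < freq b.
Proof. intros hb; apply Rdiv_lt_0_compat; [apply PI_RGT_0 | lra]. Qed.

Lemma eig_pos (b : R) (n : nat) : 0 < b -> 0 < eig b n.
Proof.
intros hb; apply pow_lt, Rmult_lt_0_compat; [pose proof (pos_INR n); lra|now apply freq_pos].
Qed.

Lemma mode_derive (b : R) (n : nat) (x : R) : is_derive (mode b n) x (dmode b n x).
Proof. unfold mode, dmode; auto_derive; [exact I | ring]. Qed.

Lemma dmode_derive (b : R) (n : nat) (x : R) :
  is_derive (dmode b n) x (- eig b n * mode b n x).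
Proof. unfold mode, dmode, eig; auto_derive; [exact I | ring]. Qed.

Lemma mode_continuous (b : R) (n : nat) (x : R) : continuous (mode b n) x.
Proof.
apply ex_derive_continuousR.
eexists; apply mode_derive.
Qed.

Lemma mode_abs_le (b : R) (n : nat) (x : R) : Rabs (mode b n x) <= 1.
Proof. unfold mode; apply Rabs_le, SIN_bound. Qed.

Lemma dmode_abs_le (b : R) (n : nat) (x : R) : 0 < b ->
  Rabs (dmode b n x) <= (INR n + 1) * freq b.
Proof.
intros hb; unfold dmode; pose proof (freq_pos b hb); pose proof (pos_INR n).
rewrite Rabs_mult, (Rabs_pos_eq ((INR n + 1) * freq b)) by nra.
assert (Rabs (cos ((INR n + 1) * (freq b * (x + b)))) <= 1) by apply Rabs_le, COS_bound.
assert (0 < (INR n + 1) * freq b) by nra.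
nra.
Qed.

Lemma sin_INR_PI (n : nat) : sin (INR n * PI) = 0.
Proof. apply sin_eq_0_1; exists (Z.of_nat n); now rewrite <- INR_IZR_INZ. Qed.

Lemma mode_left (b : R) (n : nat) : mode b n (- b) = 0.
Proof. unfold mode; replace (_ * _) with 0 by ring; apply sin_0. Qed.

Lemma mode_right (b : R) (n : nat) : 0 < b -> mode b n b = 0.
Proof.
intros hb; unfold mode, freq; rewrite <- S_INR.
replace (_ * _) with (INR (S n) * PI) by (field; lra); apply sin_INR_PI.
Qed.

Lemma RInt_eq (f g : R -> R) (a b : R) : (forall x, f x = g x) -> RInt f a b = RInt g a b.
Proof. intros H; apply RInt_ext; intros x _; apply H. Qed.

Lemma RInt_scalR (f : R -> R) (k a b : R) :
  ex_RInt f a b -> RInt (fun x => k * f x) a b = k * RInt f a b.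
Proof. apply (RInt_scal (V := R_CompleteNormedModule)). Qed.

Lemma RInt_lin (f g : R -> R) (al be a b : R) :
  ex_RInt f a b -> ex_RInt g a b ->
  RInt (fun x => al * f x + be * g x) a b = al * RInt f a b + be * RInt g a b.
Proof.
intros Hf Hg; apply is_RInt_unique.
apply (is_RInt_plus (V := R_NormedModule) (fun x => al * f x) (fun x => be * g x));
  apply (is_RInt_scal (V := R_NormedModule)); now apply (RInt_correct (V := R_CompleteNormedModule)).
Qed.

(** Two integrations by parts at once: [v1 * mode - v * dmode] is a primitive of
    [v2 * mode + eig * v * mode]. The boundary values of [v] are kept because the dilated profiles
    of the uniqueness proof do not vanish at the endpoints; those of [v1] disappear since the mode
    does vanish there. *)
Lemma mode_by_parts (b : R) (n : nat) (v v1 v2 : R -> R) : 0 < b ->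
  (forall x, - b <= x <= b -> is_derive v x (v1 x)) ->
  (forall x, - b <= x <= b -> is_derive v1 x (v2 x)) ->
  (forall x, - b <= x <= b -> continuous v2 x) ->
  RInt (fun x => v2 x * mode b n x) (- b) b =
  - (v b * dmode b n b - v (- b) * dmode b n (- b))
  - eig b n * RInt (fun x => v x * mode b n x) (- b) b.
Proof.
intros hb Hv Hv1 Hc2.
assert (Hr : Rmin (- b) b = - b /\ Rmax (- b) b = b).
{ rewrite Rmin_left, Rmax_right by lra; easy. }
destruct Hr as [Hr1 Hr2].
assert (Hcv : forall x, - b <= x <= b -> continuous v x).
{ intros x Hx; apply ex_derive_continuousR.
  eexists; now apply Hv. }
assert (E2 : ex_RInt (fun x => v2 x * mode b n x) (- b) b).
{ apply (ex_RInt_continuous (V := R_CompleteNormedModule)); rewrite Hr1, Hr2.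
  intros x Hx; apply continuous_multR; [now apply Hc2|apply mode_continuous]. }
assert (E0 : ex_RInt (fun x => v x * mode b n x) (- b) b).
{ apply (ex_RInt_continuous (V := R_CompleteNormedModule)); rewrite Hr1, Hr2.
  intros x Hx; apply continuous_multR; [now apply Hcv|apply mode_continuous]. }
assert (H : is_RInt (fun x => v2 x * mode b n x + eig b n * (v x * mode b n x)) (- b) b
  (minus (v1 b * mode b n b - v b * dmode b n b)
     (v1 (- b) * mode b n (- b) - v (- b) * dmode b n (- b)))).
{ apply (is_RInt_derive (fun x => v1 x * mode b n x - v x * dmode b n x)); rewrite Hr1, Hr2.
  - intros x Hx.
    replace (v2 x * mode b n x + eig b n * (v x * mode b n x)) with
      (v2 x * mode b n x + v1 x * dmode b n x
        - (v1 x * dmode b n x + v x * (- eig b n * mode b n x))) by ring.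
    apply is_derive_minusR.
    + apply is_derive_multR; [now apply Hv1|apply mode_derive].
    + apply is_derive_multR; [now apply Hv|apply dmode_derive].
  - intros x Hx.
    apply continuous_plusR.
    + apply continuous_multR; [now apply Hc2|apply mode_continuous].
    + apply continuous_multR; [apply continuous_const|].
      apply continuous_multR; [now apply Hcv|apply mode_continuous]. }
apply (is_RInt_unique (V := R_CompleteNormedModule)) in H.
rewrite (RInt_eq _ (fun x => 1 * (v2 x * mode b n x) + eig b n * (v x * mode b n x))) in H
  by (intros; ring).
rewrite (RInt_lin _ _ _ _ _ _ E2 E0) in H.
rewrite mode_left, mode_right in H by exact hb.
unfold minus, plus, opp in H; simpl in H.
set (I2 := RInt (fun x => v2 x * mode b n x) (- b) b) in *.
set (I0 := RInt (fun x => v x * mode b n x) (- b) b) in *.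
lra.
Qed.

(** Integration by parts against [mode b n] shows that the integral times [eig b n - eig b m] is
    zero, and the eigenvalues are distinct. *)
Lemma mode_orthogonal (b : R) (n m : nat) : 0 < b -> n <> m ->
  RInt (fun x => mode b n x * mode b m x) (- b) b = 0.
Proof.
intros hb Hnm.
assert (H := mode_by_parts b m (mode b n) (dmode b n) (fun x => - eig b n * mode b n x) hb
  (fun x _ => mode_derive b n x) (fun x _ => dmode_derive b n x)
  (fun x _ => continuous_multR (fun _ => - eig b n) (mode b n) x
     (continuous_const _ _) (mode_continuous b n x))).
rewrite mode_left, mode_right in H by exact hb.
rewrite (RInt_eq _ (fun x => - eig b n * (mode b n x * mode b m x))) in H by (intros; ring).
rewrite RInt_scalR in H.
2:{ apply ex_RInt_cont; intros x; apply continuous_multR; apply mode_continuous. }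
set (I0 := RInt (fun x => mode b n x * mode b m x) (- b) b) in *.
assert (Hd : eig b n - eig b m <> 0).
{ unfold eig; pose proof (freq_pos b hb) as Hf; pose proof (pos_INR n); pose proof (pos_INR m).
  replace (_ - _) with (freq b ^ 2 * (INR n - INR m) * (INR n + INR m + 2)) by ring.
  assert (INR n - INR m <> 0) by (intros E; apply Hnm, INR_eq; lra).
  apply Rmult_integral_contrapositive_currified; [|apply Rgt_not_eq; lra].
  apply Rmult_integral_contrapositive_currified; [apply pow_nonzero; lra|assumption]. }
apply (Rmult_eq_reg_l (eig b n - eig b m)); [lra|exact Hd].
Qed.

Lemma mode_norm (b : R) (n : nat) : 0 < b ->
  RInt (fun x => mode b n x * mode b n x) (- b) b = b.
Proof.
intros hb; pose proof (freq_pos b hb) as Hf; pose proof (pos_INR n) as Hn.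
assert (H : is_RInt (fun x => mode b n x * mode b n x) (- b) b
  (minus (b / 2 - mode b n b * dmode b n b / (2 * eig b n))
         (- b / 2 - mode b n (- b) * dmode b n (- b) / (2 * eig b n)))).
{ apply (is_RInt_derive (fun x => x / 2 - mode b n x * dmode b n x / (2 * eig b n))).
  - intros x _.
    unfold mode, dmode, eig; auto_derive; [exact I|].
    set (y := (INR n + 1) * (freq b * (x + b))).
    pose proof (sin2_cos2 y) as Hy; unfold Rsqr in Hy.
    transitivity (1 / 2 - (cos y * cos y - sin y * sin y) / 2); [field; lra|lra].
  - intros x _; apply continuous_multR; apply mode_continuous. }
rewrite (is_RInt_unique _ _ _ _ H), mode_left, mode_right by exact hb.
unfold minus, plus, opp; simpl; field; apply Rgt_not_eq, eig_pos, hb.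
Qed.

Lemma mode_series_coef (b : R) (c : nat -> R) (m : nat) : 0 < b ->
  ex_series (fun n => Rabs (c n)) ->
  RInt (fun x => Series (fun n => c n * mode b n x) * mode b m x) (- b) b = b * c m.
Proof.
intros hb Hc.
rewrite (RInt_eq _ (fun x => Series (fun n => c n * mode b n x * mode b m x)))
  by (intros; now rewrite <- Series_scal_r).
rewrite (RInt_Series (fun n x => c n * mode b n x * mode b m x) (fun n => Rabs (c n))); trivial.
- assert (E : forall n, RInt (fun x => c n * mode b n x * mode b m x) (- b) b =
      c n * RInt (fun x => mode b n x * mode b m x) (- b) b).
  { intros n; rewrite <- RInt_scalR.
    - apply RInt_eq; intros; ring.
    - apply ex_RInt_cont; intros x; apply continuous_multR; apply mode_continuous. }
  rewrite (Series_single _ m).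
  + rewrite E, mode_norm by exact hb; apply Rmult_comm.
  + intros n Hn; rewrite E, mode_orthogonal by assumption; ring.
- intros n x; apply (continuous_multR (fun x => c n * mode b n x)); [|apply mode_continuous].
  apply continuous_multR; [apply continuous_const|apply mode_continuous].
- intros n x; rewrite !Rabs_mult.
  pose proof (mode_abs_le b n x); pose proof (mode_abs_le b m x).
  pose proof (Rabs_pos (c n)); pose proof (Rabs_pos (mode b n x)); pose proof (Rabs_pos (mode b m x)).
  apply Rle_trans with (Rabs (c n) * 1 * 1); [|lra].
  repeat apply Rmult_le_compat; try assumption; try lra.
  apply Rmult_le_pos; assumption.
Qed.

Lemma mode_series_continuous (b : R) (c : nat -> R) (x : R) :
  ex_series (fun n => Rabs (c n)) -> continuous (fun y => Series (fun n => c n * mode b n y)) x.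
Proof.
intros Hc; apply (series_continuous _ (fun n => Rabs (c n))); [exact Hc| |].
- intros n; apply continuous_multR; [apply continuous_const|apply mode_continuous].
- intros n y; rewrite Rabs_mult; pose proof (mode_abs_le b n y); pose proof (Rabs_pos (c n)); nra.
Qed.

(** * Completeness of the sine modes *)

Definition orth_modes (b : R) (r : R -> R) : Prop :=
  forall n, RInt (fun x => r x * mode b n x) (- b) b = 0.

Lemma continuous_mult_mode (b : R) (r : R -> R) (n : nat) :
  (forall x, continuous r x) -> forall x, continuous (fun x => r x * mode b n x) x.
Proof.
intros Hr x; apply continuous_multR; [apply Hr|apply mode_continuous].
Qed.

Lemma orth_modes_lin (b : R) (r s : R -> R) (al be : R) :
  (forall x, continuous r x) -> (forall x, continuous s x) ->
  orth_modes b r -> orth_modes b s -> orth_modes b (fun x => al * r x + be * s x).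
Proof.
intros Hr Hs Or Os n.
rewrite (RInt_eq _ (fun x => al * (r x * mode b n x) + be * (s x * mode b n x)))
  by (intros; ring).
rewrite RInt_lin, (Or n), (Os n); [(in_R; ring)| |]; apply ex_RInt_cont; now apply continuous_mult_mode.
Qed.

Definition base_cos (b x : R) : R := cos (freq b * (x + b)).

Lemma base_cos_continuous (b x : R) : continuous (base_cos b) x.
Proof.
apply ex_derive_continuousR.
unfold base_cos; auto_derive; exact I.
Qed.

(* [sin ((n+1) y) cos y] is a combination of neighbouring modes. *)
Lemma orth_modes_base_cos (b : R) (r : R -> R) :
  (forall x, continuous r x) -> orth_modes b r -> orth_modes b (fun x => r x * base_cos b x).
Proof.
intros Hr Or n.
destruct n as [|n].
- rewrite (RInt_eq _ (fun x => / 2 * (r x * mode b 1 x) + 0 * (r x * mode b 0 x))).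
  + rewrite RInt_lin, (Or 1%nat), (Or 0%nat); [(in_R; ring)| |]; apply ex_RInt_cont; now apply continuous_mult_mode.
  + intros x; unfold mode, base_cos; simpl INR; set (y := freq b * (x + b)).
    replace ((1 + 1) * y) with (2 * y) by ring; rewrite sin_2a.
    replace ((0 + 1) * y) with y by ring; field.
- rewrite (RInt_eq _ (fun x => / 2 * (r x * mode b (S (S n)) x) + / 2 * (r x * mode b n x))).
  + rewrite RInt_lin, (Or (S (S n))), (Or n); [(in_R; ring)| |]; apply ex_RInt_cont; now apply continuous_mult_mode.
  + intros x; unfold mode, base_cos; rewrite !S_INR; set (y := freq b * (x + b)).
    replace ((INR n + 1 + 1 + 1) * y) with ((INR n + 1 + 1) * y + y) by ring.
    replace ((INR n + 1) * y) with ((INR n + 1 + 1) * y - y) by ring.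
    rewrite sin_plus, sin_minus; field.
Qed.

(** A quadratic polynomial in [base_cos], so multiplying by it preserves orthogonality to all modes.
    The [4] keeps it in [[0, 1]], since [base_cos] and [c] differ by at most 2; the value 1 is
    reached exactly where [base_cos = c]. *)
Definition peak (b c x : R) : R := 1 - (base_cos b x - c) ^ 2 / 4.

Lemma peak_continuous (b c x : R) : continuous (peak b c) x.
Proof.
apply ex_derive_continuousR.
unfold peak, base_cos; auto_derive; exact I.
Qed.

Lemma orth_modes_peak (b c : R) (r : R -> R) :
  (forall x, continuous r x) -> orth_modes b r -> orth_modes b (fun x => r x * peak b c x).
Proof.
intros Hr Or.
assert (C1 : forall x, continuous (fun x => r x * base_cos b x) x).
{ intros x; apply continuous_multR; [apply Hr|apply base_cos_continuous]. }
assert (C2 : forall x, continuous (fun x => r x * base_cos b x * base_cos b x) x).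
{ intros x; apply continuous_multR; [apply C1|apply base_cos_continuous]. }
pose proof (orth_modes_base_cos b r Hr Or) as O1.
pose proof (orth_modes_base_cos b _ C1 O1) as O2.
pose proof (orth_modes_lin b _ _ (c / 2) (- / 4) C1 C2 O1 O2) as O3.
assert (C3 : forall x, continuous (fun x => c / 2 * (r x * base_cos b x) + - / 4 * (r x * base_cos b x * base_cos b x)) x).
{ intros x; apply continuous_plusR;
    apply continuous_multR; [apply continuous_const|apply C1|apply continuous_const|apply C2]. }
pose proof (orth_modes_lin b _ _ (1 - c ^ 2 / 4) 1 Hr C3 Or O3) as O4.
intros n; rewrite <- (O4 n); apply RInt_eq; intros x; unfold peak; field.
Qed.

Lemma orth_modes_peak_pow (b c : R) (r : R -> R) (N : nat) :
  (forall x, continuous r x) -> orth_modes b r ->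
  (forall x, continuous (fun x => r x * peak b c x ^ N) x) /\
  orth_modes b (fun x => r x * peak b c x ^ N).
Proof.
intros Hr Or; induction N as [|N [IC IO]].
- split.
  + intros x; apply (continuous_ext r); [intros; simpl; ring|apply Hr].
  + intros n; rewrite <- (Or n); apply RInt_eq; intros; simpl; ring.
- split.
  + intros x; apply (continuous_ext (fun x => r x * peak b c x ^ N * peak b c x)); [intros; simpl; ring|].
    apply continuous_multR; [apply IC|apply peak_continuous].
  + intros n; rewrite <- (orth_modes_peak b c _ IC IO n).
    apply RInt_eq; intros; simpl; ring.
Qed.

Lemma RInt_sub_le (f : R -> R) (a b c d : R) : a <= c <= d -> d <= b ->
  (forall x, continuous f x) -> (forall x, a <= x <= b -> 0 <= f x) ->
  RInt f c d <= RInt f a b.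
Proof.
intros Hac Hd Hf Hp.
assert (E : forall y z, ex_RInt f y z) by (intros; now apply ex_RInt_cont).
rewrite <- (RInt_Chasles (V := R_CompleteNormedModule) f a c b) by apply E.
rewrite <- (RInt_Chasles (V := R_CompleteNormedModule) f c d b) by apply E.
assert (H1 : 0 <= RInt f a c) by (apply RInt_ge_0; [lra|apply E|intros; apply Hp; lra]).
assert (H2 : 0 <= RInt f d b) by (apply RInt_ge_0; [lra|apply E|intros; apply Hp; lra]).
unfold plus; simpl; lra.
Qed.

Lemma base_cos_lt (b x y : R) : 0 < b -> - b <= x -> x < y -> y <= b -> base_cos b y < base_cos b x.
Proof.
intros hb Hx Hxy Hy; unfold base_cos; pose proof (freq_pos b hb) as Hf.
assert (E : freq b * (2 * b) = PI) by (unfold freq; field; lra).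
apply cos_decreasing_1; nra.
Qed.

Lemma base_cos_lipschitz (b x y : R) : 0 < b -> Rabs (base_cos b y - base_cos b x) <= freq b * Rabs (y - x).
Proof.
intros hb; pose proof (freq_pos b hb) as Hf.
destruct (MVT_gen (base_cos b) x y (fun z => - freq b * sin (freq b * (z + b)))) as [z [_ Hz]].
- intros z _; unfold base_cos; auto_derive; [exact I|ring].
- intros z _; apply continuity_pt_filterlim, base_cos_continuous.
- rewrite Hz, Rabs_mult; apply Rmult_le_compat_r; [apply Rabs_pos|].
  rewrite Rabs_mult, Rabs_Ropp, Rabs_pos_eq by lra.
  assert (Rabs (sin (freq b * (z + b))) <= 1) by apply Rabs_le, SIN_bound.
  nra.
Qed.

Lemma peak_bounds (b c x : R) : -1 <= c <= 1 -> 0 <= peak b c x <= 1.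
Proof.
intros Hc; unfold peak; pose proof (COS_bound (freq b * (x + b))) as H.
fold (base_cos b x) in H.
assert (Hd : -2 <= base_cos b x - c <= 2) by lra.
set (d := base_cos b x - c) in *; clearbody d; split; nra.
Qed.

(* Hence the powers of [peak] concentrate at [x0]. *)
Lemma peak_concentrates (b x0 d : R) : 0 < b -> 0 < d -> - b <= x0 - d -> x0 + d <= b ->
  exists q1 q2 d', 0 <= q2 < q1 /\ q1 <= 1 /\ 0 < d' <= d /\
    (forall x, Rabs (x - x0) <= d' -> q1 <= peak b (base_cos b x0) x) /\
    (forall x, - b <= x <= b -> d <= Rabs (x - x0) -> peak b (base_cos b x0) x <= q2).
Proof.
intros hb Hd Hl Hr; pose proof (freq_pos b hb) as Hf.
set (c := base_cos b x0).
assert (H1 : c < base_cos b (x0 - d)) by (apply base_cos_lt; lra).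
assert (H2 : base_cos b (x0 + d) < c) by (apply base_cos_lt; lra).
set (ka := Rmin (base_cos b (x0 - d) - c) (c - base_cos b (x0 + d))).
assert (Hka : 0 < ka) by (apply Rmin_glb_lt; lra).
assert (Hka1 : ka <= base_cos b (x0 - d) - c) by apply Rmin_l.
assert (Hka2 : ka <= c - base_cos b (x0 + d)) by apply Rmin_r.
assert (Hc : -1 <= c <= 1) by apply COS_bound.
assert (Hk2 : ka <= 2) by (pose proof (COS_bound (freq b * (x0 - d + b))) as H;
  fold (base_cos b (x0 - d)) in H; lra).
(* Within [d'] of [x0], the Lipschitz constant [freq b] keeps [base_cos] within [ka / 2] of [c];
   beyond [d], monotonicity puts it at least [ka] away. The two values are those of [peak] at these
   deviations. *)
exists (1 - ka ^ 2 / 16), (1 - ka ^ 2 / 4), (Rmin d (ka / (2 * freq b))).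
assert (Hd' : 0 < ka / (2 * freq b)) by (apply Rdiv_lt_0_compat; lra).
split; [nra|split; [nra|split; [split; [now apply Rmin_glb_lt|apply Rmin_l]|split]]].
- intros x Hx; pose proof (base_cos_lipschitz b x0 x hb) as HL; fold c in HL.
  assert (Hx2 : Rabs (x - x0) <= ka / (2 * freq b)) by (eapply Rle_trans; [exact Hx|apply Rmin_r]).
  assert (HL2 : Rabs (base_cos b x - c) <= ka / 2).
  { eapply Rle_trans; [exact HL|].
    replace (ka / 2) with (freq b * (ka / (2 * freq b))) by (field; lra).
    apply Rmult_le_compat_l; lra. }
  unfold peak; apply Rabs_le_between in HL2; nra.
- intros x Hx Hxd; unfold peak.
  assert (HA : ka <= Rabs (base_cos b x - c)).
  { destruct (Rle_dec x x0) as [Hxx|Hxx].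
    - rewrite Rabs_left1 in Hxd by lra.
      assert (base_cos b (x0 - d) <= base_cos b x).
      { destruct (Req_dec x (x0 - d)) as [->|Hne]; [lra|].
        apply Rlt_le, base_cos_lt; lra. }
      rewrite Rabs_pos_eq; lra.
    - rewrite Rabs_pos_eq in Hxd by lra.
      assert (base_cos b x <= base_cos b (x0 + d)).
      { destruct (Req_dec x (x0 + d)) as [->|Hne]; [lra|].
        apply Rlt_le, base_cos_lt; lra. }
      rewrite Rabs_left1; lra. }
  rewrite <- (pow2_abs (base_cos b x - c)); nra.
Qed.

(** If [r x0 > 0], test [r] against [mode b 0], positive inside the interval, times a high power of
    a peak at [x0]. The integral is zero by orthogonality, while the part near [x0] is at least of
    order [q1 ^ N] and the rest is at least of order [- q2 ^ N]; as [q2 < q1], this fails for large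
    [N]. *)
Lemma modes_complete_le (b : R) (r : R -> R) : 0 < b ->
  (forall x, continuous r x) -> orth_modes b r -> forall x0, - b < x0 < b -> r x0 <= 0.
Proof.
intros hb Hr Or x0 Hx0; apply Rnot_lt_le; intros Hpos.
set (g x := r x * mode b 0 x).
assert (Hg : forall x, continuous g x) by now apply continuous_mult_mode.
assert (Hg0 : 0 < g x0).
{ apply Rmult_lt_0_compat; [exact Hpos|].
  unfold mode; simpl INR; rewrite Rplus_0_l, Rmult_1_l; pose proof (freq_pos b hb) as Hf.
  assert (E : freq b * (2 * b) = PI) by (unfold freq; field; lra).
  apply sin_gt_0; nra. }
assert (Hg02 : 0 < g x0 / 2) by lra.
destruct (proj1 (filterlim_locally _ _) (Hg x0) (mkposreal _ Hg02)) as [d0 Hd0].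
set (d := Rmin (d0 / 2) (Rmin (x0 + b) (b - x0))).
assert (Hd : 0 < d) by (pose proof (cond_pos d0); repeat apply Rmin_glb_lt; lra).
assert (Hda : d <= d0 / 2) by apply Rmin_l.
assert (Hdb : d <= x0 + b) by (eapply Rle_trans; [apply Rmin_r|apply Rmin_l]).
assert (Hdc : d <= b - x0) by (eapply Rle_trans; [apply Rmin_r|apply Rmin_r]).
assert (Hgd : forall x, Rabs (x - x0) <= d -> g x0 / 2 <= g x).
{ intros x Hx; assert (H : Rabs (g x - g x0) < g x0 / 2).
  { apply Hd0; change (Rabs (x - x0) < d0); pose proof (cond_pos d0); lra. }
  split_Rabs; lra. }
destruct (peak_concentrates b x0 d hb Hd) as (q1 & q2 & d' & Hq & Hq1 & Hd' & Hin & Hout); try lra.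
set (c := base_cos b x0) in *.
assert (Hc : -1 <= c <= 1) by apply COS_bound.
destruct (continuity_ab_maj (fun y => Rabs (g y)) (- b) b ltac:(lra)) as [xM [HM _]].
{ intros y _; apply continuity_pt_filterlim, (continuous_comp g Rabs); [apply Hg|apply continuous_Rabs]. }
set (M := Rabs (g xM)) in *.
assert (HM0 : 0 <= M) by apply Rabs_pos.
assert (Key : forall N, 2 * d' * (g x0 / 2 * q1 ^ N) <= 2 * b * (M * q2 ^ N)).
{ intros N.
  destruct (orth_modes_peak_pow b c r N Hr Or) as [CN ON].
  (* Adding [M * q2 ^ N] makes the integrand nonnegative on the whole interval, so its integral may
     be bounded below by the part over [[x0 - d', x0 + d']]. *)
  set (f x := r x * peak b c x ^ N * mode b 0 x + M * q2 ^ N).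
  assert (Ef : forall x, f x = g x * peak b c x ^ N + M * q2 ^ N) by (intros; unfold f, g; ring).
  assert (Hq2N : 0 <= q2 ^ N) by (apply pow_le; lra).
  assert (Cf : forall x, continuous f x).
  { intros x; apply continuous_plusR; [|apply continuous_const].
    now apply (continuous_mult_mode b _ 0 CN). }
  assert (If : RInt f (- b) b = 2 * b * (M * q2 ^ N)).
  { unfold f; rewrite (RInt_plus (V := R_CompleteNormedModule)).
    - rewrite (ON 0%nat), (RInt_const (V := R_CompleteNormedModule)).
      unfold plus, scal; simpl; unfold mult; simpl; ring.
    - apply ex_RInt_cont, (continuous_mult_mode b _ 0 CN).
    - apply ex_RInt_cont; intros; apply continuous_const. }
  assert (Hf0 : forall x, - b <= x <= b -> 0 <= f x).
  { intros x Hx; rewrite Ef.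
    pose proof (peak_bounds b c x Hc) as Hp.
    assert (HpN : 0 <= peak b c x ^ N) by (apply pow_le; lra).
    destruct (Rle_dec (Rabs (x - x0)) d) as [Hn|Hn].
    - pose proof (Hgd x Hn); assert (0 <= g x * peak b c x ^ N) by (apply Rmult_le_pos; lra).
      assert (0 <= M * q2 ^ N) by (apply Rmult_le_pos; lra). lra.
    - assert (HpN2 : peak b c x ^ N <= q2 ^ N).
      { apply pow_incr; split; [lra|]; apply Hout; [exact Hx|lra]. }
      pose proof (HM x Hx) as HMx; fold M in HMx.
      assert (- M <= g x) by (split_Rabs; lra).
      assert (M * peak b c x ^ N <= M * q2 ^ N) by (apply Rmult_le_compat_l; lra).
      assert (- M * peak b c x ^ N <= g x * peak b c x ^ N) by (apply Rmult_le_compat_r; lra).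
      lra. }
  rewrite <- If.
  apply Rle_trans with (RInt f (x0 - d') (x0 + d')); [|apply RInt_sub_le; try lra; assumption].
  replace (2 * d' * (g x0 / 2 * q1 ^ N)) with
    (RInt (fun _ => g x0 / 2 * q1 ^ N) (x0 - d') (x0 + d')).
  2:{ rewrite (RInt_const (V := R_CompleteNormedModule)); unfold scal; simpl; unfold mult; simpl; ring. }
  apply RInt_le; [lra|apply ex_RInt_cont; intros; apply continuous_const|now apply ex_RInt_cont|].
  intros x Hx; rewrite Ef.
  assert (Hxx : Rabs (x - x0) <= d') by (apply Rabs_le; lra).
  assert (0 <= M * q2 ^ N) by (apply Rmult_le_pos; lra).
  assert (g x0 / 2 * q1 ^ N <= g x * peak b c x ^ N); [|lra].
  apply Rmult_le_compat; [lra|apply pow_le; lra| |].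
  - apply Hgd; lra.
  - apply pow_incr; split; [lra|now apply Hin]. }
assert (Hrat : Rabs (q2 / q1) < 1).
{ rewrite Rabs_pos_eq; [apply (Rmult_lt_reg_r q1); [lra|]; field_simplify; lra|].
  apply Rmult_le_pos; [lra|apply Rlt_le, Rinv_0_lt_compat; lra]. }
assert (He : 0 < d' * g x0 / (2 * b * (M + 1))).
{ apply Rdiv_lt_0_compat; [apply Rmult_lt_0_compat; lra|]; nra. }
destruct (pow_lt_1_zero (q2 / q1) Hrat _ He) as [N HN].
specialize (HN N (le_n _)); specialize (Key N).
assert (Hq1N : 0 < q1 ^ N) by (apply pow_lt; lra).
assert (Hq2N : 0 <= q2 ^ N) by (apply pow_le; lra).
unfold Rdiv in HN; rewrite Rpow_mult_distr, pow_inv in HN.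
fold (q2 ^ N / q1 ^ N) in HN; fold (d' * g x0 / (2 * b * (M + 1))) in HN.
rewrite Rabs_pos_eq in HN.
2:{ apply Rmult_le_pos; [lra|apply Rlt_le, Rinv_0_lt_compat; lra]. }
assert (HN2 : q2 ^ N * (2 * b * (M + 1)) < d' * g x0 * q1 ^ N).
{ apply (Rmult_lt_compat_r (q1 ^ N * (2 * b * (M + 1)))) in HN.
  2:{ apply Rmult_lt_0_compat; [lra|nra]. }
  replace (q2 ^ N / q1 ^ N * (q1 ^ N * (2 * b * (M + 1)))) with (q2 ^ N * (2 * b * (M + 1))) in HN
    by (field; lra).
  replace (d' * g x0 / (2 * b * (M + 1)) * (q1 ^ N * (2 * b * (M + 1)))) with (d' * g x0 * q1 ^ N) in HN
    by (field; split; nra).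
  exact HN. }
nra.
Qed.

Lemma modes_complete (b : R) (r : R -> R) : 0 < b ->
  (forall x, continuous r x) -> orth_modes b r -> forall x, - b < x < b -> r x = 0.
Proof.
intros hb Hr Or x Hx; apply Rle_antisym; [now apply (modes_complete_le b r)|].
assert (H : 0 * r x + -1 * r x <= 0); [|lra].
apply (modes_complete_le b (fun x => 0 * r x + -1 * r x) hb); [|now apply orth_modes_lin|exact Hx].
intros y; apply continuous_plusR;
  apply continuous_multR; first [apply continuous_const|apply Hr].
Qed.

Definition coef (b : R) (g : R -> R) (n : nat) : R := RInt (fun x => g x * mode b n x) (- b) b / b.

(** Absolute summability makes the sum of the series continuous with coefficients [c n], so its
    difference with [g] is orthogonal to every mode and vanishes by completeness. *)
Lemma mode_expansion (b : R) (g : R -> R) (c : nat -> R) : 0 < b ->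
  (forall x, continuous g x) -> (forall n, coef b g n = c n) ->
  ex_series (fun n => Rabs (c n)) ->
  forall x, - b < x < b -> g x = Series (fun n => c n * mode b n x).
Proof.
intros hb Hg Hgc Hc x Hx.
pose proof (fun y => mode_series_continuous b c y Hc) as CS.
set (S y := Series (fun n => c n * mode b n y)) in *.
assert (H : 1 * g x + -1 * S x = 0); [|unfold S in *; lra].
apply (modes_complete b (fun x => 1 * g x + -1 * S x) hb); [| |exact Hx].
- intros y; apply continuous_plusR;
    apply continuous_multR; first [apply continuous_const|apply Hg|apply CS].
- intros n.
  rewrite (RInt_eq _ (fun x => 1 * (g x * mode b n x) + -1 * (S x * mode b n x))) by (intros; ring).
  rewrite RInt_lin by (apply ex_RInt_cont; now apply continuous_mult_mode).
  unfold S; rewrite (mode_series_coef b c n hb Hc), <- Hgc; unfold coef; in_R; field; lra.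
Qed.

Lemma coef_abs_le (b M : R) (g : R -> R) (n : nat) : 0 < b ->
  (forall x, continuous g x) -> (forall x, - b <= x <= b -> Rabs (g x) <= M) ->
  Rabs (coef b g n) <= 2 * M.
Proof.
intros hb Hg HM.
assert (H : Rabs (RInt (fun x => g x * mode b n x) (- b) b) <= (b - - b) * M).
{ apply abs_RInt_le_const; [lra|apply ex_RInt_cont; now apply continuous_mult_mode|].
  intros x Hx; rewrite Rabs_mult; pose proof (HM x Hx); pose proof (mode_abs_le b n x).
  pose proof (Rabs_pos (g x)); pose proof (Rabs_pos (mode b n x)); nra. }
unfold coef; rewrite Rabs_div by lra; rewrite (Rabs_pos_eq b) by lra.
apply (Rmult_le_reg_r b); [exact hb|]; field_simplify; lra.
Qed.

Lemma coef_minus (b : R) (f g : R -> R) (n : nat) :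
  (forall x, continuous f x) -> (forall x, continuous g x) ->
  coef b (fun x => f x - g x) n = coef b f n - coef b g n.
Proof.
intros Hf Hg; unfold coef.
rewrite (RInt_eq _ (fun x => 1 * (f x * mode b n x) + -1 * (g x * mode b n x))) by (intros; ring).
rewrite RInt_lin by (apply ex_RInt_cont; now apply continuous_mult_mode).
unfold Rdiv; ring.
Qed.

(** With the integrating factor [exp (a s)], the function [q] below is nonincreasing. The weight
    [exp (g s)] in the source improves the divisor from [a] to [a + g]: existence uses [g = 0],
    uniqueness a large [g]. *)
Lemma ode_bound_upper (p r : R -> R) (a g B t1 t : R) : t1 <= t -> 0 < a + g ->
  (forall s, t1 <= s <= t -> is_derive p s (- a * p s + r s)) ->
  (forall s, t1 <= s <= t -> r s <= B * exp (g * s)) ->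
  p t <= exp (- a * (t - t1)) * Rmax 0 (p t1) + Rmax 0 B * exp (g * t) / (a + g).
Proof.
intros Ht Hag Hp Hr.
set (q s := exp (a * s) * p s - Rmax 0 B * exp ((a + g) * s) / (a + g)).
assert (HB := Rmax_r 0 B); assert (HB0 := Rmax_l 0 B).
assert (Hq : q t <= q t1).
{ set (dq s := exp (a * s) * (r s - Rmax 0 B * exp (g * s))).
  assert (Hdq : forall s, t1 <= s <= t -> is_derive q s (dq s)).
  { intros s Hs; unfold q, dq; pose proof (Hp s Hs) as H; auto_derive.
    - now exists (- a * p s + r s).
    - replace (Derive _ s) with (- a * p s + r s) by (symmetry; apply is_derive_unique, H).
      replace ((a + g) * s) with (a * s + g * s) by ring; rewrite exp_plus; field; lra. }
  destruct (MVT_gen q t1 t dq) as [c [Hc1 Hc2]]; rewrite ?Rmin_left, ?Rmax_right in * by exact Ht.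
  - intros s Hs; apply Hdq; lra.
  - intros s Hs; apply continuity_pt_filterlim.
    apply ex_derive_continuousR.
    exists (dq s); apply Hdq; lra.
  - assert (dq c <= 0); [|nra].
    unfold dq; pose proof (exp_pos (a * c)); pose proof (exp_pos (g * c)); pose proof (Hr c Hc1).
    assert (B * exp (g * c) <= Rmax 0 B * exp (g * c)) by nra.
    nra. }
unfold q in Hq.
assert (E1 : exp (a * t) * exp (- (a * t)) = 1) by (rewrite <- exp_plus, Rplus_opp_r; apply exp_0).
assert (E2 : exp ((a + g) * t) * exp (- (a * t)) = exp (g * t)).
{ rewrite <- exp_plus; f_equal; ring. }
assert (E3 : exp (a * t1) * exp (- (a * t)) = exp (- a * (t - t1))).
{ rewrite <- exp_plus; f_equal; ring. }
assert (Hpos : 0 <= Rmax 0 B * exp ((a + g) * t1) / (a + g)).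
{ apply Rmult_le_pos; [apply Rmult_le_pos; [exact HB0|apply Rlt_le, exp_pos]|].
  now apply Rlt_le, Rinv_0_lt_compat. }
assert (Hq2 : exp (a * t) * p t <= exp (a * t1) * Rmax 0 (p t1)
   + Rmax 0 B * exp ((a + g) * t) / (a + g)).
{ pose proof (exp_pos (a * t1)); pose proof (Rmax_r 0 (p t1)).
  assert (exp (a * t1) * p t1 <= exp (a * t1) * Rmax 0 (p t1)) by nra. lra. }
apply (Rmult_le_compat_r (exp (- (a * t)))) in Hq2; [|apply Rlt_le, exp_pos].
replace (exp (a * t) * p t * exp (- (a * t))) with (exp (a * t) * exp (- (a * t)) * p t) in Hq2 by ring.
rewrite E1 in Hq2.
replace ((exp (a * t1) * Rmax 0 (p t1) + Rmax 0 B * exp ((a + g) * t) / (a + g)) * exp (- (a * t)))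
  with (exp (a * t1) * exp (- (a * t)) * Rmax 0 (p t1)
     + Rmax 0 B * (exp ((a + g) * t) * exp (- (a * t))) / (a + g)) in Hq2 by (unfold Rdiv; ring).
rewrite E2, E3 in Hq2; lra.
Qed.

Lemma ode_bound (p r : R -> R) (a g B t1 t : R) : t1 <= t -> 0 < a + g ->
  (forall s, t1 <= s <= t -> is_derive p s (- a * p s + r s)) ->
  (forall s, t1 <= s <= t -> Rabs (r s) <= B * exp (g * s)) ->
  Rabs (p t) <= exp (- a * (t - t1)) * Rabs (p t1) + B * exp (g * t) / (a + g).
Proof.
intros Ht Hag Hp Hr.
assert (HB : 0 <= B).
{ pose proof (Hr t ltac:(lra)) as H; pose proof (Rabs_pos (r t)); pose proof (exp_pos (g * t)); nra. }
assert (H1 : p t <= exp (- a * (t - t1)) * Rmax 0 (p t1) + Rmax 0 B * exp (g * t) / (a + g)).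
{ apply (ode_bound_upper p r); trivial.
  intros s Hs; eapply Rle_trans; [apply Rle_abs|now apply Hr]. }
assert (H2 : - p t <= exp (- a * (t - t1)) * Rmax 0 (- p t1) + Rmax 0 B * exp (g * t) / (a + g)).
{ apply (ode_bound_upper (fun s => - p s) (fun s => - r s)); trivial.
  - intros s Hs; replace (- a * - p s + - r s) with (opp (- a * p s + r s)) by (unfold opp; simpl; ring).
    apply (is_derive_opp (K := R_AbsRing) (V := R_NormedModule)), Hp, Hs.
  - intros s Hs; eapply Rle_trans; [apply Rle_abs|rewrite Rabs_Ropp; now apply Hr]. }
rewrite (Rmax_right 0 B) in H1, H2 by exact HB.
pose proof (exp_pos (- a * (t - t1))) as He.
assert (Rmax 0 (p t1) <= Rabs (p t1)) by (apply Rmax_lub; [apply Rabs_pos|apply Rle_abs]).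
assert (Rmax 0 (- p t1) <= Rabs (p t1)).
{ apply Rmax_lub; [apply Rabs_pos|rewrite <- Rabs_Ropp; apply Rle_abs]. }
apply Rabs_le; nra.
Qed.

(** * Maximum principle *)

Lemma derive_left_min (f : R -> R) (t l d : R) : 0 < d -> is_derive f t l ->
  (forall s, t - d < s <= t -> f t <= f s) -> l <= 0.
Proof.
intros Hd Hf Hmin; apply is_derive_Reals in Hf.
apply Rnot_lt_le; intros Hl.
destruct (Hf (l / 2) ltac:(lra)) as [del Hdel].
pose proof (cond_pos del) as Hdp.
set (h := - Rmin (d / 2) (del / 2)).
assert (Hh : 0 < - h /\ - h <= d / 2 /\ - h <= del / 2).
{ unfold h; rewrite Ropp_involutive; repeat split;
    [apply Rmin_glb_lt; lra|apply Rmin_l|apply Rmin_r]. }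
assert (Hh0 : h <> 0) by lra.
assert (Hha : Rabs h < del) by (rewrite Rabs_left; lra).
specialize (Hdel h Hh0 Hha).
assert (Hm : f t <= f (t + h)) by (apply Hmin; lra).
assert (Hq : (f (t + h) - f t) / h <= 0).
{ replace ((f (t + h) - f t) / h) with (- ((f (t + h) - f t) * / (- h))) by (field; lra).
  assert (0 < / (- h)) by (apply Rinv_0_lt_compat; lra). nra. }
split_Rabs; lra.
Qed.

Lemma derive_right_min (f : R -> R) (t l d : R) : 0 < d -> is_derive f t l ->
  (forall s, t <= s < t + d -> f t <= f s) -> 0 <= l.
Proof.
intros Hd Hf Hmin.
assert (H : - l <= 0); [|lra].
apply (derive_left_min (fun s => f (- s)) (- t) (- l) d Hd).
- apply is_derive_Reals.
  replace (- l) with (l * -1) by ring.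
  apply (derivable_pt_lim_comp (fun s => - s) f).
  + apply is_derive_Reals; auto_derive; [exact I|ring].
  + rewrite Ropp_involutive; now apply is_derive_Reals.
- intros s Hs; rewrite Ropp_involutive; apply Hmin; lra.
Qed.

(** At an interior minimum [f1] vanishes; were its derivative negative, [f1] would be negative just
    to the right and [f] would fall below [f x]. *)
Lemma derive2_min (f f1 : R -> R) (x l d : R) : 0 < d ->
  (forall y, x - d < y < x + d -> is_derive f y (f1 y)) -> is_derive f1 x l ->
  (forall y, x - d < y < x + d -> f x <= f y) -> 0 <= l.
Proof.
intros Hd Hf Hf1 Hmin.
assert (H0 : f1 x = 0).
{ apply Rle_antisym.
  - apply (derive_left_min f x _ d Hd); [apply Hf; lra|intros; apply Hmin; lra].
  - apply (derive_right_min f x _ d Hd); [apply Hf; lra|intros; apply Hmin; lra]. }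
apply Rnot_lt_le; intros Hl; apply is_derive_Reals in Hf1.
destruct (Hf1 (- l / 2) ltac:(lra)) as [del Hdel].
pose proof (cond_pos del) as Hdp.
set (h := Rmin (d / 2) (del / 2)).
assert (Hh : 0 < h /\ h <= d / 2 /\ h <= del / 2).
{ unfold h; repeat split; [apply Rmin_glb_lt; lra|apply Rmin_l|apply Rmin_r]. }
assert (Hneg : forall k, 0 < k <= h -> f1 (x + k) < 0).
{ intros k Hk.
  assert (Hka : Rabs k < del) by (rewrite Rabs_pos_eq; lra).
  specialize (Hdel k ltac:(lra) Hka); rewrite H0, Rminus_0_r in Hdel.
  assert (Hq : f1 (x + k) / k < 0) by (split_Rabs; lra).
  apply (Rmult_lt_compat_r k) in Hq; [|lra].
  replace (f1 (x + k) / k * k) with (f1 (x + k)) in Hq by (field; lra); lra. }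
destruct (MVT_gen f x (x + h) f1) as [c [Hc1 Hc2]]; rewrite ?Rmin_left, ?Rmax_right in * by lra.
- intros y Hy; apply Hf; lra.
- intros y Hy; apply continuity_pt_filterlim.
  apply ex_derive_continuousR.
  exists (f1 y); apply Hf; lra.
- assert (Hm : f x <= f (x + h)) by (apply Hmin; lra).
  (* This intermediate point lies strictly to the right of [x], as [Hneg] requires. *)
  destruct (MVT_cor2 f f1 x (x + h)) as [c' [Hc'1 Hc'2]]; [lra| |].
  + intros y Hy; apply is_derive_Reals, Hf; lra.
  + assert (f1 c' < 0); [|nra].
    replace c' with (x + (c' - x)) by ring; apply Hneg; lra.
Qed.

(** The weak form of the equation, with pointwise derivatives and no continuity of them: all that
    the maximum principle uses. [heat] below is the version with jointly continuous derivatives. *)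
Definition heat_eq (b : R) (z phi : R -> R -> R) : Prop :=
  exists z1 z2 : R -> R -> R, forall x t, - b < x < b -> 0 < t ->
    is_derive (fun y => z y t) x (z1 x t) /\
    is_derive (fun y => z1 y t) x (z2 x t) /\
    is_derive (fun s => z x s) t (z2 x t + phi x t).

Lemma heat_eq_lin (b al be : R) (z w phi psi : R -> R -> R) :
  heat_eq b z phi -> heat_eq b w psi ->
  heat_eq b (fun x t => al * z x t + be * w x t) (fun x t => al * phi x t + be * psi x t).
Proof.
intros (z1 & z2 & Hz) (w1 & w2 & Hw).
exists (fun x t => al * z1 x t + be * w1 x t), (fun x t => al * z2 x t + be * w2 x t).
assert (L : forall (f g : R -> R) x lf lg, is_derive f x lf -> is_derive g x lg ->
  is_derive (fun y => al * f y + be * g y) x (al * lf + be * lg)).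
{ intros f g x lf lg Hf Hg; apply is_derive_plusR;
    now apply is_derive_scal. }
intros x t Hx Ht; destruct (Hz x t Hx Ht) as (A1 & A2 & A3); destruct (Hw x t Hx Ht) as (B1 & B2 & B3).
split; [now apply L|split; [now apply L|]].
replace (_ + _) with (al * (z2 x t + phi x t) + be * (w2 x t + psi x t)) by ring.
now apply (L (fun s => z x s) (fun s => w x s)).
Qed.

Lemma heat_eq_shift (b h : R) (z phi : R -> R -> R) : 0 <= h ->
  heat_eq b z phi -> heat_eq b (fun x t => z x (t + h)) (fun x t => phi x (t + h)).
Proof.
intros Hh (z1 & z2 & Hz).
exists (fun x t => z1 x (t + h)), (fun x t => z2 x (t + h)).
intros x t Hx Ht; destruct (Hz x (t + h) Hx ltac:(lra)) as (A1 & A2 & A3).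
split; [exact A1|split; [exact A2|]].
apply is_derive_Reals in A3; apply is_derive_Reals.
replace (z2 x (t + h) + phi x (t + h)) with ((z2 x (t + h) + phi x (t + h)) * 1) by ring.
apply (derivable_pt_lim_comp (fun s => s + h) (fun s => z x s)); [|exact A3].
apply is_derive_Reals; auto_derive; [exact I|ring].
Qed.

Lemma heat_eq_time (b : R) (A dA : R -> R) :
  (forall t, 0 < t -> is_derive A t (dA t)) -> heat_eq b (fun _ t => A t) (fun _ t => dA t).
Proof.
intros HA; exists (fun _ _ => 0), (fun _ _ => 0); intros x t _ Ht.
split; [|split]; try apply (is_derive_const (K := R_AbsRing) (V := R_NormedModule)).
rewrite Rplus_0_l; now apply HA.
Qed.

(** Add [eps t] to make the inequality strict. At a negative minimum in the interior the second
    space derivative is nonnegative and the time derivative nonpositive, which contradicts the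
    equation. The minimum may sit at the final time, so only the left-hand time derivative is
    tested. *)
Lemma max_principle (b T : R) (z phi : R -> R -> R) : 0 < b -> 0 <= T ->
  cont2 z -> heat_eq b z phi ->
  (forall x t, - b < x < b -> 0 < t <= T -> 0 <= phi x t) ->
  (forall x, - b <= x <= b -> 0 <= z x 0) ->
  (forall t, 0 <= t <= T -> 0 <= z (- b) t /\ 0 <= z b t) ->
  forall x t, - b <= x <= b -> 0 <= t <= T -> 0 <= z x t.
Proof.
intros hb HT Cz (z1 & z2 & Hz) Hphi Hz0 Hzb x t Hx Ht.
assert (Heps : forall eps, 0 < eps -> - eps * t <= z x t).
{ intros eps Heps.
  set (f x t := z x t + eps * t).
  assert (Cf : cont2 f).
  { intros u v; apply continuity_2d_pt_plus; [apply Cz|].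
    apply continuity_2d_pt_mult; [apply continuity_2d_pt_const|apply continuity_2d_pt_id2]. }
  destruct (cont2_argmin f (- b) b 0 T) as (x0 & t0 & Hx0 & Ht0 & Hmin); try lra; try assumption.
  destruct (Rle_dec 0 (f x0 t0)) as [H0|H0].
  { pose proof (Hmin x t Hx Ht) as H; unfold f in *; lra. }
  exfalso; apply H0; clear H0.
  assert (Het : 0 <= eps * t0) by nra.
  destruct (Req_dec t0 0) as [->|Hne]; [unfold f; pose proof (Hz0 x0 Hx0); lra|].
  destruct (Req_dec x0 (- b)) as [->|Hnl]; [unfold f; pose proof (Hzb t0 Ht0); lra|].
  destruct (Req_dec x0 b) as [->|Hnr]; [unfold f; pose proof (Hzb t0 Ht0); lra|].
  exfalso.
  destruct (Hz x0 t0 ltac:(lra) ltac:(lra)) as (_ & D2 & Dt).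
  assert (P2 : 0 <= z2 x0 t0).
  { apply (derive2_min (fun y => z y t0) (fun y => z1 y t0) x0 _ (Rmin (x0 + b) (b - x0))).
    - apply Rmin_glb_lt; lra.
    - intros y Hy; apply Hz; [|lra].
      pose proof (Rmin_l (x0 + b) (b - x0)); pose proof (Rmin_r (x0 + b) (b - x0)); lra.
    - exact D2.
    - intros y Hy; pose proof (Rmin_l (x0 + b) (b - x0)); pose proof (Rmin_r (x0 + b) (b - x0)).
      pose proof (Hmin y t0 ltac:(lra) Ht0) as H1; unfold f in H1; lra. }
  assert (P1 : z2 x0 t0 + phi x0 t0 + eps <= 0).
  { apply (derive_left_min (fun s => f x0 s) t0 _ t0); [lra| |].
    - unfold f; apply (is_derive_plusR (fun s => z x0 s) (fun s => eps * s));
        [exact Dt|auto_derive; [exact I|ring]].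
    - intros s Hs; apply Hmin; lra. }
  pose proof (Hphi x0 t0 ltac:(lra) ltac:(lra)); lra. }
apply Rnot_lt_le; intros Hneg.
assert (He : 0 < - z x t / (2 * (t + 1))) by (apply Rdiv_lt_0_compat; lra).
specialize (Heps _ He).
assert (E : - z x t / (2 * (t + 1)) * (t + 1) = - z x t / 2) by (field; lra).
assert (Hle : - z x t / (2 * (t + 1)) * t <= - z x t / 2) by lra.
lra.
Qed.

(** The barrier [A] is constant in space, so [dA] alone has to dominate the source; the maximum
    principle is applied to both [A + z] and [A - z]. *)
Lemma heat_bound (b : R) (z phi : R -> R -> R) (A dA : R -> R) (t x : R) : 0 < b ->
  cont2 z -> heat_eq b z phi ->
  (forall s, 0 <= s -> z (- b) s = 0 /\ z b s = 0) ->
  (forall s, is_derive A s (dA s)) ->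
  (forall s, 0 <= s -> 0 <= A s) ->
  (forall y, - b <= y <= b -> Rabs (z y 0) <= A 0) ->
  (forall y s, - b < y < b -> 0 < s -> Rabs (phi y s) <= dA s) ->
  - b <= x <= b -> 0 <= t -> Rabs (z x t) <= A t.
Proof.
intros hb Cz Hz Hzb HA HA0 Hz0 Hphi Hx Ht.
assert (CA : cont2 (fun _ t => A t)).
{ apply cont2_snd_only; intros s.
  apply ex_derive_continuousR; now exists (dA s). }
assert (HHA : heat_eq b (fun _ t => A t) (fun _ t => dA t)) by (apply heat_eq_time; auto).
assert (Key : forall sg, sg = 1 \/ sg = -1 -> 0 <= 1 * A t + sg * z x t).
{ intros sg Hsg.
  apply (max_principle b t (fun x t => 1 * A t + sg * z x t) (fun x t => 1 * dA t + sg * phi x t));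
    trivial; try lra.
  - intros u v; apply continuity_2d_pt_plus; apply continuity_2d_pt_mult;
      [apply continuity_2d_pt_const|apply CA|apply continuity_2d_pt_const|apply Cz].
  - now apply heat_eq_lin.
  - intros y s Hy Hs; pose proof (Hphi y s Hy ltac:(lra)); destruct Hsg; subst sg; split_Rabs; lra.
  - intros y Hy; pose proof (Hz0 y Hy); destruct Hsg; subst sg; split_Rabs; lra.
  - intros s Hs; destruct (Hzb s ltac:(lra)) as [-> ->]; pose proof (HA0 s ltac:(lra)).
    split; lra. }
pose proof (Key 1 ltac:(lra)); pose proof (Key (-1) ltac:(lra)).
apply Rabs_le; lra.
Qed.

(** Near the point, [u1] differs from the difference quotient of step [h] by at most [K h], where
    [K] bounds [u2]; the quotient is jointly continuous. This gives the joint continuity of [u_x],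
    for which the differentiated sine series is of no help: the available bound on its terms is only
    of order [1/n]. *)
Lemma derive_interpolation (u u1 u2 : R -> R -> R) (x0 t0 : R) :
  cont2 u ->
  locally_2d (fun x t => is_derive (fun y => u y t) x (u1 x t) /\
    is_derive (fun y => u1 y t) x (u2 x t)) x0 t0 ->
  continuity_2d_pt u2 x0 t0 -> continuity_2d_pt u1 x0 t0.
Proof.
intros Cu [d0 Hd0] C2 eps.
destruct (C2 (mkposreal 1 Rlt_0_1)) as [d1 Hd1]; simpl in Hd1.
set (K := Rabs (u2 x0 t0) + 1).
assert (HK : 1 <= K) by (pose proof (Rabs_pos (u2 x0 t0)); unfold K; lra).
pose proof (cond_pos eps) as He; pose proof (cond_pos d0) as Hp0; pose proof (cond_pos d1) as Hp1.
set (d := Rmin d0 d1).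
assert (Hd : 0 < d) by now apply Rmin_glb_lt.
set (h := Rmin (d / 2) (eps / (4 * K))).
assert (HeK : 0 < eps / (4 * K)) by (apply Rdiv_lt_0_compat; lra).
assert (Hh : 0 < h) by (apply Rmin_glb_lt; lra).
assert (Hh1 : h <= d / 2) by apply Rmin_l.
assert (Hh2 : K * h <= eps / 4).
{ replace (eps / 4) with (K * (eps / (4 * K))) by (field; lra).
  apply Rmult_le_compat_l; [lra|apply Rmin_r]. }
assert (Hder : forall x t, Rabs (x - x0) < d -> Rabs (t - t0) < d ->
   is_derive (fun y => u y t) x (u1 x t) /\ is_derive (fun y => u1 y t) x (u2 x t) /\
   Rabs (u2 x t) <= K).
{ intros x t Hx Ht.
  assert (d <= d0) by apply Rmin_l; assert (d <= d1) by apply Rmin_r.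
  destruct (Hd0 x t) as [A1 A2]; try lra.
  split; [exact A1|split; [exact A2|]].
  assert (B1 : Rabs (u2 x t - u2 x0 t0) < 1) by (apply Hd1; lra).
  unfold K; split_Rabs; lra. }
assert (Hquot : forall x t, Rabs (x - x0) < d / 2 -> Rabs (t - t0) < d ->
   Rabs (u1 x t - (u (x + h) t - u x t) / h) <= K * h).
{ intros x t Hx Ht.
  destruct (MVT_cor2 (fun y => u y t) (fun y => u1 y t) x (x + h)) as [c [Hc1 Hc2]]; [lra| |].
  { intros y Hy; apply is_derive_Reals, Hder; [split_Rabs; lra|exact Ht]. }
  replace ((u (x + h) t - u x t) / h) with (u1 c t) by (rewrite Hc1; field; lra).
  destruct (MVT_cor2 (fun y => u1 y t) (fun y => u2 y t) x c) as [c' [Hc'1 Hc'2]]; [lra| |].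
  { intros y Hy; apply is_derive_Reals, Hder; [split_Rabs; lra|exact Ht]. }
  rewrite Rabs_minus_sym, Hc'1, Rabs_mult, (Rabs_pos_eq (c - x)) by lra.
  apply Rmult_le_compat; [apply Rabs_pos|lra| |lra].
  apply Hder; [split_Rabs; lra|exact Ht]. }
assert (CD : continuity_2d_pt (fun x t => (u (x + h) t - u x t) * / h) x0 t0).
{ apply continuity_2d_pt_mult; [|apply continuity_2d_pt_const].
  apply continuity_2d_pt_minus; [|apply Cu].
  apply (cont2_comp u (fun x => x + h) (fun t => t) Cu).
  - intros x; apply (continuous_plusR (fun x => x) (fun _ => h));
      [apply continuous_id|apply continuous_const].
  - intros; apply continuous_id. }
assert (He4 : 0 < eps / 4) by lra.
destruct (CD (mkposreal _ He4)) as [d2 Hd2]; simpl in Hd2; pose proof (cond_pos d2) as Hp2.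
assert (Hdd : 0 < Rmin (d / 2) d2) by (apply Rmin_glb_lt; lra).
exists (mkposreal _ Hdd); simpl; intros x t Hx Ht.
assert (Rmin (d / 2) d2 <= d / 2) by apply Rmin_l; assert (Rmin (d / 2) d2 <= d2) by apply Rmin_r.
pose proof (Hquot x t ltac:(lra) ltac:(lra)) as Q1.
pose proof (Hquot x0 t0 ltac:(rewrite Rminus_diag, Rabs_R0; lra) ltac:(rewrite Rminus_diag, Rabs_R0; lra)) as Q2.
pose proof (Hd2 x t ltac:(lra) ltac:(lra)) as Q3.
unfold Rdiv in Q1, Q2.
split_Rabs; lra.
Qed.

(** The derivatives are explicit witnesses rather than [Derive] terms, so that they can be combined
    linearly and rescaled; [heat_reg_Derive] translates back. *)
Definition heat_reg (b : R) (u u1 u2 ut : R -> R -> R) : Prop :=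
  forall x t, - b < x < b -> 0 < t ->
    (is_derive (fun y => u y t) x (u1 x t) /\
     is_derive (fun y => u1 y t) x (u2 x t) /\
     is_derive (fun s => u x s) t (ut x t)) /\
    continuity_2d_pt u1 x t /\ continuity_2d_pt u2 x t /\ continuity_2d_pt ut x t.

Definition heat (b : R) (u phi : R -> R -> R) : Prop :=
  exists u1 u2 ut, heat_reg b u u1 u2 ut /\
    forall x t, - b < x < b -> 0 < t -> ut x t = u2 x t + phi x t.

Lemma heat_heat_eq (b : R) (u phi : R -> R -> R) : heat b u phi -> heat_eq b u phi.
Proof.
intros (u1 & u2 & ut & Hr & He); exists u1, u2; intros x t Hx Ht.
destruct (Hr x t Hx Ht) as [(A1 & A2 & A3) _]; rewrite <- (He x t Hx Ht); auto.
Qed.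

Lemma heat_ext (b : R) (u w phi psi : R -> R -> R) :
  (forall x t, - b <= x <= b -> 0 <= t -> u x t = w x t) ->
  (forall x t, - b < x < b -> 0 < t -> phi x t = psi x t) ->
  heat b u phi -> heat b w psi.
Proof.
intros Huw Hpp (u1 & u2 & ut & Hr & He); exists u1, u2, ut; split.
- intros x t Hx Ht; destruct (Hr x t Hx Ht) as [(A1 & A2 & A3) C].
  split; [split; [|split; [exact A2|]]|exact C].
  + apply (is_derive_ext_loc (fun y => u y t)); [|exact A1].
    assert (Hd : 0 < Rmin (x + b) (b - x)) by (apply Rmin_glb_lt; lra).
    exists (mkposreal _ Hd); intros y Hy; change (Rabs (y - x) < Rmin (x + b) (b - x)) in Hy.
    pose proof (Rmin_l (x + b) (b - x)); pose proof (Rmin_r (x + b) (b - x)).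
    apply Huw; [split_Rabs; lra|lra].
  + apply (is_derive_ext_loc (fun s => u x s)); [|exact A3].
    exists (mkposreal _ Ht); intros s Hs; change (Rabs (s - t) < t) in Hs.
    apply Huw; [lra|split_Rabs; lra].
- intros x t Hx Ht; rewrite (He x t Hx Ht), (Hpp x t Hx Ht); reflexivity.
Qed.

Lemma interior_locally (b x t : R) : - b < x < b -> 0 < t ->
  locally_2d (fun y s => - b < y < b /\ 0 < s) x t.
Proof.
intros Hx Ht; assert (Hd : 0 < Rmin (Rmin (x + b) (b - x)) t) by (repeat apply Rmin_glb_lt; lra).
exists (mkposreal _ Hd); simpl; intros y s Hy Hs.
pose proof (Rmin_l (Rmin (x + b) (b - x)) t); pose proof (Rmin_r (Rmin (x + b) (b - x)) t).
pose proof (Rmin_l (x + b) (b - x)); pose proof (Rmin_r (x + b) (b - x)).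
split; split_Rabs; lra.
Qed.

Lemma heat_reg_Derive (b : R) (u u1 u2 ut : R -> R -> R) (x t : R) :
  heat_reg b u u1 u2 ut -> - b < x < b -> 0 < t ->
  Derive_n (fun y => u y t) 1 x = u1 x t /\ Derive_n (fun y => u y t) 2 x = u2 x t /\
  Derive (fun s => u x s) t = ut x t /\ ex_derive (Derive_n (fun y => u y t) 1) x.
Proof.
intros Hr Hx Ht; destruct (Hr x t Hx Ht) as [(D1 & D2 & D3) _].
assert (E2 : is_derive (Derive_n (fun y => u y t) 1) x (u2 x t)).
{ apply (is_derive_ext_loc (fun y => u1 y t)); [|exact D2].
  pose proof (locally_2d_1d_const_y _ _ _ (interior_locally b x t Hx Ht)) as HL.
  revert HL; apply filter_imp; intros y [Hy _]; symmetry.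
  apply is_derive_unique, (proj1 (Hr y t Hy Ht)). }
split; [now apply is_derive_unique|split; [now apply is_derive_unique|split; [now apply is_derive_unique|]]].
now exists (u2 x t).
Qed.

(** * The linear heat equation *)

Lemma derive_abs_le (f : R -> R) (t l K d : R) : 0 < d -> is_derive f t l ->
  (forall h, 0 < h < d -> Rabs (f (t + h) - f t) <= K * h) -> Rabs l <= K.
Proof.
intros Hd Hf HK; apply is_derive_Reals in Hf; apply Rnot_lt_le; intros Hl.
destruct (Hf (Rabs l - K) ltac:(lra)) as [del Hdel]; pose proof (cond_pos del) as Hp.
set (h := Rmin (d / 2) (del / 2)).
assert (Hh : 0 < h) by (apply Rmin_glb_lt; lra).
assert (h <= d / 2) by apply Rmin_l; assert (h <= del / 2) by apply Rmin_r.
specialize (Hdel h ltac:(lra) ltac:(rewrite Rabs_pos_eq; lra)).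
specialize (HK h ltac:(lra)).
assert (Hq : Rabs ((f (t + h) - f t) / h) <= K).
{ rewrite Rabs_div, (Rabs_pos_eq h) by lra.
  apply (Rmult_le_reg_r h); [exact Hh|]; field_simplify; lra. }
pose proof (Rabs_triang_inv l ((f (t + h) - f t) / h)); rewrite Rabs_minus_sym in Hdel; lra.
Qed.

(** Times are bounded only from above: the sources to which this applies are constant for negative
    times, while [L] may grow with [T]. *)
Definition lip_time (b : R) (f : R -> R -> R) : Prop :=
  forall T, exists L, 0 <= L /\ forall x s t, - b <= x <= b -> s <= T -> t <= T ->
    Rabs (f x t - f x s) <= L * Rabs (t - s).

Definition duhamel (b : R) (f : R -> R -> R) (n : nat) (t : R) : R :=
  exp (- eig b n * t) * RInt (fun s => exp (eig b n * s) * coef b (fun x => f x s) n) 0 t.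

(** Written through the differential equation rather than as a [Derive]: continuity in [t] and the
    relation between the coefficients of [f], [u] and [u_t] are then immediate. *)
Definition duhamel_dt (b : R) (f : R -> R -> R) (n : nat) (t : R) : R :=
  - eig b n * duhamel b f n t + coef b (fun x => f x t) n.

Lemma coef_continuous (b : R) (f : R -> R -> R) (n : nat) : 0 < b -> cont2 f ->
  forall t, continuous (fun s => coef b (fun x => f x s) n) t.
Proof.
intros hb Cf t; unfold coef, Rdiv.
apply continuous_multR; [|apply continuous_const].
apply (cont2_RInt (fun x s => f x s * mode b n x)); [lra|].
intros x s; apply continuity_2d_pt_mult; [apply Cf|].
apply (cont2_fst_only (mode b n)), mode_continuous.
Qed.

Lemma exp_lin_continuous (k t : R) : continuous (fun s => exp (k * s)) t.
Proof.
apply ex_derive_continuousR; auto_derive; exact I.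
Qed.

Lemma duhamel_integrand_continuous (b : R) (f : R -> R -> R) (n : nat) (t : R) :
  0 < b -> cont2 f ->
  continuous (fun s => exp (eig b n * s) * coef b (fun x => f x s) n) t.
Proof.
intros hb Cf; apply continuous_multR; [apply exp_lin_continuous|].
now apply coef_continuous.
Qed.

Lemma duhamel_0 (b : R) (f : R -> R -> R) (n : nat) : duhamel b f n 0 = 0.
Proof.
unfold duhamel; rewrite (RInt_point (V := R_CompleteNormedModule)).
unfold zero; simpl; ring.
Qed.

Lemma duhamel_derive (b : R) (f : R -> R -> R) (n : nat) (t : R) : 0 < b -> cont2 f ->
  is_derive (duhamel b f n) t (duhamel_dt b f n t).
Proof.
intros hb Cf; unfold duhamel_dt, duhamel.
set (w s := exp (eig b n * s) * coef b (fun x => f x s) n).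
assert (Cw : forall s, continuous w s) by (intros s; now apply duhamel_integrand_continuous).
assert (DW : is_derive (fun t => RInt w 0 t) t (w t)).
{ apply (is_derive_RInt w _ 0).
  - apply filter_forall; intros z; apply (RInt_correct (V := R_CompleteNormedModule)).
    now apply ex_RInt_cont.
  - apply Cw. }
assert (DE : is_derive (fun t => exp (- eig b n * t)) t (- eig b n * exp (- eig b n * t))).
{ auto_derive; [exact I|ring]. }
replace (_ + _) with (- eig b n * exp (- eig b n * t) * RInt w 0 t
  + exp (- eig b n * t) * w t).
- apply (is_derive_multR (fun t => exp (- eig b n * t)) (fun t => RInt w 0 t));
    [exact DE|exact DW].
- unfold w at 2.
  assert (E : exp (- eig b n * t) * exp (eig b n * t) = 1).
  { rewrite <- exp_plus; replace (_ + _) with 0 by ring; apply exp_0. }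
  rewrite <- Rmult_assoc, E; ring.
Qed.

Lemma duhamel_continuous (b : R) (f : R -> R -> R) (n : nat) (t : R) : 0 < b -> cont2 f ->
  continuous (duhamel b f n) t.
Proof.
intros hb Cf; apply ex_derive_continuousR.
eexists; now apply duhamel_derive.
Qed.

Lemma duhamel_dt_continuous (b : R) (f : R -> R -> R) (n : nat) (t : R) : 0 < b -> cont2 f ->
  continuous (duhamel_dt b f n) t.
Proof.
intros hb Cf; apply continuous_plusR.
- apply continuous_multR; [apply continuous_const|now apply duhamel_continuous].
- now apply coef_continuous.
Qed.

Lemma duhamel_le (b M T : R) (f : R -> R -> R) (n : nat) (t : R) : 0 < b -> cont2 f ->
  (forall x s, - b <= x <= b -> 0 <= s <= T -> Rabs (f x s) <= M) ->
  0 <= t <= T -> Rabs (duhamel b f n t) <= 2 * M / eig b n.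
Proof.
intros hb Cf HM Ht; pose proof (eig_pos b n hb) as He.
pose proof (ode_bound (duhamel b f n) (fun t => coef b (fun x => f x t) n) (eig b n) 0 (2 * M) 0 t) as H.
rewrite duhamel_0, Rabs_R0, Rmult_0_l, exp_0, Rmult_0_r, Rplus_0_l, Rplus_0_r, Rmult_1_r in H.
apply H; try lra.
- intros s Hs; now apply duhamel_derive.
- intros s Hs; rewrite Rmult_0_l, exp_0, Rmult_1_r; apply coef_abs_le; trivial.
  + intros x; now apply (cont2_fst f s).
  + intros x Hx; apply HM; lra.
Qed.

(** Linear in [h], without decay in [n]. It controls the initial increment in [duhamel_dt_le], where
    the decay comes from [exp (- eig b n * t)] instead. *)
Lemma duhamel_le_time (b M h : R) (f : R -> R -> R) (n : nat) : 0 < b -> cont2 f -> 0 <= h ->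
  (forall x s, - b <= x <= b -> 0 <= s <= h -> Rabs (f x s) <= M) ->
  Rabs (duhamel b f n h) <= 2 * M * h.
Proof.
intros hb Cf Hh HM; pose proof (eig_pos b n hb) as He.
unfold duhamel; rewrite Rabs_mult, (Rabs_pos_eq (exp _)) by apply Rlt_le, exp_pos.
assert (HR : Rabs (RInt (fun s => exp (eig b n * s) * coef b (fun x => f x s) n) 0 h)
   <= (h - 0) * (exp (eig b n * h) * (2 * M))).
{ apply abs_RInt_le_const; [exact Hh| |].
  - apply ex_RInt_cont; intros s; now apply duhamel_integrand_continuous.
  - intros s Hs; rewrite Rabs_mult, (Rabs_pos_eq (exp _)) by apply Rlt_le, exp_pos.
    apply Rmult_le_compat; [apply Rlt_le, exp_pos|apply Rabs_pos| |].
    + destruct (Req_dec s h) as [->|]; [lra|]; apply Rlt_le, exp_increasing; nra.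
    + apply coef_abs_le; trivial.
      * intros x; now apply (cont2_fst f s).
      * intros x Hx; apply HM; lra. }
assert (E : exp (- eig b n * h) * exp (eig b n * h) = 1).
{ rewrite <- exp_plus; replace (_ + _) with 0 by ring; apply exp_0. }
apply Rle_trans with (exp (- eig b n * h) * ((h - 0) * (exp (eig b n * h) * (2 * M)))).
- apply Rmult_le_compat_l; [apply Rlt_le, exp_pos|exact HR].
- replace (_ * (_ * _)) with (exp (- eig b n * h) * exp (eig b n * h) * (2 * M * h)) by ring.
  rewrite E; lra.
Qed.

Lemma exp_neg_le (y : R) : 0 < y -> exp (- y) <= / y.
Proof.
intros Hy; rewrite exp_Ropp; apply Rinv_le_contravar; [exact Hy|].
pose proof (exp_ineq1 y ltac:(lra)); lra.
Qed.

(* Differencing the source in time gains the factor [1 / eig], which makes the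
   series of time derivatives absolutely convergent for [t > 0]. *)
Lemma duhamel_dt_le (b M L T : R) (f : R -> R -> R) (n : nat) (t : R) : 0 < b -> cont2 f ->
  (forall x s, - b <= x <= b -> 0 <= s <= T -> Rabs (f x s) <= M) ->
  (forall x s s', - b <= x <= b -> s <= T -> s' <= T -> Rabs (f x s' - f x s) <= L * Rabs (s' - s)) ->
  0 < t < T -> Rabs (duhamel_dt b f n t) <= (2 * M / t + 2 * L) / eig b n.
Proof.
intros hb Cf HM HL Ht; pose proof (eig_pos b n hb) as He.
assert (HM0 : 0 <= M).
{ eapply Rle_trans; [apply Rabs_pos|apply (HM 0 0); lra]. }
apply (derive_abs_le (duhamel b f n) t _ _ (T - t)); [lra|now apply duhamel_derive|].
intros h Hh.
(* The increment over a time [h] solves the same equation, with source at most [2 L h] and initial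
   value [duhamel b f n h]. *)
pose proof (ode_bound (fun s => duhamel b f n (s + h) - duhamel b f n s)
  (fun s => coef b (fun x => f x (s + h)) n - coef b (fun x => f x s) n)
  (eig b n) 0 (2 * (L * h)) 0 t) as H.
cbv beta in H.
rewrite duhamel_0, Rplus_0_l, Rminus_0_r, Rmult_0_l, exp_0, Rplus_0_r, Rmult_1_r, Rminus_0_r in H.
assert (H' : Rabs (duhamel b f n (t + h) - duhamel b f n t) <=
  exp (- eig b n * t) * Rabs (duhamel b f n h) + 2 * (L * h) / eig b n).
{ apply H; try lra.
  - intros s Hs.
    replace (_ + _) with (duhamel_dt b f n (s + h) - duhamel_dt b f n s)
      by (unfold duhamel_dt; ring).
    apply is_derive_minusR; [|now apply duhamel_derive].
    apply is_derive_Reals.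
    replace (duhamel_dt b f n (s + h)) with (duhamel_dt b f n (s + h) * 1) by ring.
    apply (derivable_pt_lim_comp (fun s => s + h) (duhamel b f n)).
    + apply is_derive_Reals; auto_derive; [exact I|ring].
    + apply is_derive_Reals; now apply duhamel_derive.
  - intros s Hs; rewrite Rmult_0_l, exp_0, Rmult_1_r.
    rewrite <- coef_minus by (intros; now apply (cont2_fst f)).
    apply coef_abs_le; trivial.
    + intros x; apply continuous_minusR; now apply (cont2_fst f).
    + intros x Hx; replace h with (Rabs (s + h - s)) at 2 by (rewrite Rabs_pos_eq; lra).
      apply HL; lra. }
pose proof (duhamel_le_time b M h f n hb Cf ltac:(lra)) as Hd.
assert (Hd' : Rabs (duhamel b f n h) <= 2 * M * h) by (apply Hd; intros; apply HM; lra).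
(* Exponential decay is traded for the algebraic factor [1 / (eig b n * t)], which is summable in
   [n] and linear in [1/t]. *)
assert (Hexp : exp (- eig b n * t) <= / (eig b n * t)).
{ rewrite Ropp_mult_distr_l_reverse; apply exp_neg_le; nra. }
assert (Hinv : 0 < / (eig b n * t)) by (apply Rinv_0_lt_compat; nra).
apply Rle_trans with (/ (eig b n * t) * (2 * M * h) + 2 * (L * h) / eig b n).
- eapply Rle_trans; [exact H'|]; apply Rplus_le_compat_r.
  apply Rmult_le_compat; [apply Rlt_le, exp_pos|apply Rabs_pos|exact Hexp|exact Hd'].
- right; field; lra.
Qed.

Lemma inv_eig (b K : R) (n : nat) : 0 < b ->
  K / eig b n = K / freq b ^ 2 * / (INR n + 1) ^ 2.
Proof.
intros hb; pose proof (freq_pos b hb); pose proof (pos_INR n).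
unfold eig; field; lra.
Qed.

Lemma ex_series_inv_eig (b K : R) : 0 < b -> ex_series (fun n => K / eig b n).
Proof.
intros hb; apply (ex_series_ext (fun n => K / freq b ^ 2 * / (INR n + 1) ^ 2)).
- intros n; now rewrite inv_eig.
- apply (ex_series_scal (V := R_NormedModule)), ex_series_inv_sq.
Qed.

Definition heat_series (b : R) (c : nat -> R -> R) (x t : R) : R :=
  Series (fun n => c n (Rmax 0 t) * mode b n (clamp (- b) b x)).

Lemma heat_series_continuity (b : R) (c : nat -> R -> R) (K : R) (x t : R) : 0 < b ->
  (forall n s, continuous (c n) s) ->
  locally t (fun s => forall n, Rabs (c n (Rmax 0 s)) <= K / eig b n) ->
  continuity_2d_pt (heat_series b c) x t.
Proof.
intros hb Cc [d Hd].
apply (series_continuity_2d _ (fun n => K / eig b n)); [now apply ex_series_inv_eig| |].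
- intros n; apply continuity_2d_pt_mult.
  + apply (cont2_snd_only (fun s => c n (Rmax 0 s))); intros s.
    apply (continuous_comp (Rmax 0) (c n)); [apply continuous_Rmax0|apply Cc].
  + apply (cont2_fst_only (fun y => mode b n (clamp (- b) b y))); intros y.
    apply (continuous_comp (clamp (- b) b) (mode b n)); [apply continuous_clamp|apply mode_continuous].
- exists d; intros y s _ Hs n; rewrite Rabs_mult.
  pose proof (Hd s Hs n); pose proof (mode_abs_le b n (clamp (- b) b y)).
  pose proof (Rabs_pos (c n (Rmax 0 s))); pose proof (Rabs_pos (mode b n (clamp (- b) b y))).
  nra.
Qed.

(** The Dirichlet solution of [- w'' = g]: minus the double primitive of [g], plus the affine
    function that restores the zero value at [b]. *)
Definition green (b : R) (g : R -> R) (x : R) : R :=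
  - RInt (fun y => RInt g (- b) y) (- b) x
  + RInt (fun y => RInt g (- b) y) (- b) b / (2 * b) * (x + b).

Definition dgreen (b : R) (g : R -> R) (x : R) : R :=
  - RInt g (- b) x + RInt (fun y => RInt g (- b) y) (- b) b / (2 * b).

Lemma primitive_derive (g : R -> R) (a x : R) : (forall y, continuous g y) ->
  is_derive (fun y => RInt g a y) x (g x).
Proof.
intros Cg; apply (is_derive_RInt g _ a); [|apply Cg].
apply filter_forall; intros z; apply (RInt_correct (V := R_CompleteNormedModule)).
now apply ex_RInt_cont.
Qed.

Lemma green_derive (b : R) (g : R -> R) (x : R) : (forall y, continuous g y) ->
  is_derive (green b g) x (dgreen b g x).
Proof.
intros Cg.
apply is_derive_plusR.
- apply (is_derive_opp (K := R_AbsRing) (V := R_NormedModule)).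
  apply (primitive_derive (fun y => RInt g (- b) y)).
  intros y; apply ex_derive_continuousR.
  eexists; now apply primitive_derive.
- set (k := RInt _ _ b / (2 * b)); auto_derive; [exact I|ring].
Qed.

Lemma dgreen_derive (b : R) (g : R -> R) (x : R) : (forall y, continuous g y) ->
  is_derive (dgreen b g) x (- g x).
Proof.
intros Cg.
replace (- g x) with (plus (opp (g x)) zero) by (unfold plus, opp, zero; simpl; ring).
apply is_derive_plusR.
- apply (is_derive_opp (K := R_AbsRing) (V := R_NormedModule)); now apply primitive_derive.
- apply (is_derive_const (K := R_AbsRing) (V := R_NormedModule)).
Qed.

Lemma green_boundary (b : R) (g : R -> R) : 0 < b -> green b g (- b) = 0 /\ green b g b = 0.
Proof.
intros hb; unfold green; split.
- rewrite (RInt_point (V := R_CompleteNormedModule)); unfold zero; simpl; ring.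
- field; lra.
Qed.

Lemma green_coef (b : R) (g : R -> R) (n : nat) : 0 < b -> (forall y, continuous g y) ->
  coef b (green b g) n = coef b g n / eig b n.
Proof.
intros hb Cg; pose proof (eig_pos b n hb) as He.
destruct (green_boundary b g hb) as [B1 B2].
assert (H := mode_by_parts b n (green b g) (dgreen b g) (fun x => -1 * g x) hb).
rewrite B1, B2 in H.
rewrite (RInt_eq (fun x => -1 * g x * mode b n x) (fun x => -1 * (g x * mode b n x))) in H by (intros; ring).
rewrite RInt_scalR in H by (apply ex_RInt_cont; now apply continuous_mult_mode).
unfold coef; apply (Rmult_eq_reg_l (b * eig b n)); [|nra].
field_simplify; [|lra|lra].
rewrite <- (Rmult_1_l (RInt (fun x => g x * mode b n x) (- b) b)).
assert (H1 : -1 * RInt (fun x => g x * mode b n x) (- b) b =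
  - (0 * dmode b n b - 0 * dmode b n (- b)) - eig b n * RInt (fun x => green b g x * mode b n x) (- b) b).
{ apply H.
  - intros x _; now apply green_derive.
  - intros x _; replace (-1 * g x) with (- g x) by ring; now apply dgreen_derive.
  - intros x _; apply continuous_multR; [apply continuous_const|apply Cg]. }
lra.
Qed.

Lemma linear_heat (b : R) (f : R -> R -> R) : 0 < b -> cont2 f -> lip_time b f ->
  exists u, cont2 u /\ (forall x t, u x t = u (clamp (- b) b x) (Rmax 0 t)) /\
    (forall x, u x 0 = 0) /\ (forall t, u (- b) t = 0 /\ u b t = 0) /\ heat b u f.
Proof.
intros hb Cf Lf.
set (u := heat_series b (duhamel b f)); set (ut := heat_series b (duhamel_dt b f)).
assert (HM : forall T, exists M, 0 < M /\ forall x s, - b <= x <= b -> 0 <= s <= T -> Rabs (f x s) <= M).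
{ intros T; destruct (cont2_bounded f (- b) b 0 T Cf) as [M HM]; now exists M. }
assert (Bu : forall T, exists K, forall s n, 0 <= s <= T -> Rabs (duhamel b f n s) <= K / eig b n).
{ intros T; destruct (HM T) as [M [_ HMT]]; exists (2 * M); intros s n Hs.
  now apply (duhamel_le b M T). }
(* Locally uniform in time: within [t / 2] of [t] the factor [1 / s] is at most [1 / (t / 2)], and
   [2 * t] bounds all the times involved. *)
assert (But : forall t, 0 < t -> exists K d, 0 < d < t /\ forall s n, Rabs (s - t) < d ->
   Rabs (duhamel_dt b f n s) <= K / eig b n).
{ intros t Ht; destruct (HM (2 * t)) as [M [HM0 HMT]]; destruct (Lf (2 * t)) as [L [HL0 HL]].
  exists (2 * M / (t / 2) + 2 * L), (t / 2); split; [lra|].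
  intros s n Hs.
  eapply Rle_trans; [apply (duhamel_dt_le b M L (2 * t)); trivial; split_Rabs; lra|].
  apply Rmult_le_compat_r; [apply Rlt_le, Rinv_0_lt_compat, eig_pos, hb|].
  apply Rplus_le_compat_r, Rmult_le_compat_l; [lra|].
  apply Rinv_le_contravar; split_Rabs; lra. }
assert (Cu : cont2 u).
{ intros x t; destruct (Bu (Rabs t + 1)) as [K HK].
  apply (heat_series_continuity b _ K); [exact hb|intros; now apply duhamel_continuous|].
  exists (mkposreal 1 Rlt_0_1); intros s Hs n; change (Rabs (s - t) < 1) in Hs; apply HK.
  unfold Rmax; destruct (Rle_dec 0 s); split_Rabs; lra. }
assert (Cut : forall x t, 0 < t -> continuity_2d_pt ut x t).
{ intros x t Ht; destruct (But t Ht) as (K & d & Hd & HK).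
  apply (heat_series_continuity b _ K); [exact hb|intros; now apply duhamel_dt_continuous|].
  exists (mkposreal d (proj1 Hd)); intros s Hs n; change (Rabs (s - t) < d) in Hs.
  rewrite Rmax_right by (split_Rabs; lra); now apply HK. }
assert (Dt : forall x t, 0 < t -> is_derive (fun s => u x s) t (ut x t)).
{ intros x t Ht; destruct (But t Ht) as (K & d & Hd & HK).
  unfold ut, heat_series; rewrite (Rmax_right 0 t) by lra.
  apply (series_derive (fun n s => duhamel b f n (Rmax 0 s) * mode b n (clamp (- b) b x))
    (fun n s => duhamel_dt b f n s * mode b n (clamp (- b) b x)) (fun n => K / eig b n)).
  - now apply ex_series_inv_eig.
  - intros s; destruct (Bu (Rabs s)) as [K' HK'].
    apply (ex_series_dominated _ (fun n => K' / eig b n)); [now apply ex_series_inv_eig|].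
    intros n; rewrite Rabs_mult.
    assert (H1 : Rabs (duhamel b f n (Rmax 0 s)) <= K' / eig b n).
    { apply HK'; unfold Rmax; destruct (Rle_dec 0 s); split_Rabs; lra. }
    pose proof (mode_abs_le b n (clamp (- b) b x)).
    pose proof (Rabs_pos (duhamel b f n (Rmax 0 s))); pose proof (Rabs_pos (mode b n (clamp (- b) b x))).
    nra.
  - exists (mkposreal d (proj1 Hd)); intros s Hs n; change (Rabs (s - t) < d) in Hs.
    assert (Hs0 : 0 < s) by (split_Rabs; lra).
    split.
    + apply (is_derive_ext_loc (fun r => mode b n (clamp (- b) b x) * duhamel b f n r)).
      * exists (mkposreal s Hs0); intros r Hr; change (Rabs (r - s) < s) in Hr.
        rewrite Rmax_right by (split_Rabs; lra); apply Rmult_comm.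
      * rewrite (Rmult_comm (duhamel_dt b f n s)).
        apply is_derive_scal; now apply duhamel_derive.
    + rewrite Rabs_mult; pose proof (HK s n Hs); pose proof (mode_abs_le b n (clamp (- b) b x)).
      pose proof (Rabs_pos (duhamel_dt b f n s)); pose proof (Rabs_pos (mode b n (clamp (- b) b x))).
      nra. }
(* The candidate for [- u_xx], continuous because [u_t] is already known to be. *)
set (g t x := f x t - ut x t).
assert (Cg : forall t x, 0 < t -> continuous (g t) x).
{ intros t x Ht; apply continuous_minusR; [now apply (cont2_fst f)|].
  apply (continuous_2d_comp ut (fun y => y) (fun _ => t));
    [now apply Cut|apply continuous_id|apply continuous_const]. }
(* Both sides have the same coefficients: those of [green b (g t)] are [(f_n - u_n') / eig], which
   is [u_n] by the ordinary differential equation. *)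
assert (Eu : forall x t, - b < x < b -> 0 < t -> u x t = green b (g t) x).
{ intros x t Hx Ht; destruct (But t Ht) as (K & d & Hd & HK); destruct (Bu t) as [K' HK'].
  unfold u, heat_series; rewrite clamp_id, Rmax_right by lra; symmetry.
  apply (mode_expansion b (green b (g t)) (fun n => duhamel b f n t)); trivial.
  - intros y; apply ex_derive_continuousR.
    eexists; apply green_derive; intros; now apply Cg.
  - intros n; rewrite green_coef; [|exact hb|intros; now apply Cg].
    unfold g; rewrite coef_minus.
    2:{ intros; now apply (cont2_fst f). }
    2:{ intros y; apply (continuous_2d_comp ut (fun y => y) (fun _ => t));
        [now apply Cut|apply continuous_id|apply continuous_const]. }
    assert (E : coef b (fun x => ut x t) n = duhamel_dt b f n t).
    { unfold coef; rewrite (RInt_ext _ (fun x => Series (fun k => duhamel_dt b f k t * mode b k x) * mode b n x)).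
      - rewrite mode_series_coef; [field; lra|exact hb|].
        apply (ex_series_dominated _ (fun n => K / eig b n)); [now apply ex_series_inv_eig|].
        intros k; rewrite Rabs_Rabsolu; apply HK; rewrite Rminus_diag, Rabs_R0; lra.
      - intros y Hy; rewrite Rmin_left, Rmax_right in Hy by lra.
        unfold ut, heat_series; rewrite clamp_id, Rmax_right by lra; reflexivity. }
    rewrite E; unfold duhamel_dt; field; apply Rgt_not_eq, eig_pos, hb.
  - apply (ex_series_dominated _ (fun n => K' / eig b n)); [now apply ex_series_inv_eig|].
    intros k; rewrite Rabs_Rabsolu; apply HK'; lra. }
exists u; split; [exact Cu|split; [|split; [|split]]].
- intros x t; unfold u, heat_series.
  rewrite (clamp_id _ _ (clamp (- b) b x)) by (apply clamp_bounds; lra).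
  rewrite (Rmax_right 0 (Rmax 0 t)) by apply Rmax_l; reflexivity.
- intros x; unfold u, heat_series; rewrite Rmax_left by lra.
  rewrite (Series_single _ 0); intros; rewrite duhamel_0; ring.
- intros t; unfold u, heat_series; rewrite !clamp_id by lra; split;
    (rewrite (Series_single _ 0); intros; rewrite ?mode_left, ?mode_right by exact hb; ring).
(* Space derivatives are read off the Green representation, never off the sine series. *)
- exists (fun x t => dgreen b (g t) x), (fun x t => ut x t - f x t), ut.
  assert (D1 : forall x t, - b < x < b -> 0 < t -> is_derive (fun y => u y t) x (dgreen b (g t) x)).
  { intros x t Hx Ht; apply (is_derive_ext_loc (green b (g t))).
    - assert (Hd : 0 < Rmin (x + b) (b - x)) by (apply Rmin_glb_lt; lra).
      exists (mkposreal _ Hd); intros y Hy; change (Rabs (y - x) < Rmin (x + b) (b - x)) in Hy.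
      pose proof (Rmin_l (x + b) (b - x)); pose proof (Rmin_r (x + b) (b - x)).
      symmetry; apply Eu; [split_Rabs; lra|exact Ht].
    - apply green_derive; intros; now apply Cg. }
  assert (D2 : forall x t, 0 < t -> is_derive (fun y => dgreen b (g t) y) x (ut x t - f x t)).
  { intros x t Ht; replace (ut x t - f x t) with (- g t x) by (unfold g; ring).
    apply dgreen_derive; intros; now apply Cg. }
  assert (C2 : forall x t, 0 < t -> continuity_2d_pt (fun x t => ut x t - f x t) x t).
  { intros x t Ht; apply continuity_2d_pt_minus; [now apply Cut|apply Cf]. }
  split; [|intros; ring].
  intros x t Hx Ht; split; [split; [|split]|split; [|split]]; auto.
  apply (derive_interpolation u _ (fun x t => ut x t - f x t)); auto.
  assert (Hd : 0 < Rmin (Rmin (x + b) (b - x)) t) by (repeat apply Rmin_glb_lt; lra).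
  exists (mkposreal _ Hd); simpl; intros y s Hy Hs.
  pose proof (Rmin_l (Rmin (x + b) (b - x)) t); pose proof (Rmin_r (Rmin (x + b) (b - x)) t).
  pose proof (Rmin_l (x + b) (b - x)); pose proof (Rmin_r (x + b) (b - x)).
  split; [apply D1|apply D2]; split_Rabs; lra.
Qed.

(** * The truncated nonlocal problem *)

(* The reaction term as a function of [h = 1 / (1 - w)]. *)
Definition nonlocal (b chi lam : R) (h : R -> R) (x : R) : R :=
  lam * h x ^ 2 / (1 + chi * RInt h (- b) b) ^ 2.

Lemma RInt_ge_len (b : R) (h : R -> R) : 0 < b -> (forall x, continuous h x) ->
  (forall x, - b <= x <= b -> 1 <= h x) -> 2 * b <= RInt h (- b) b.
Proof.
intros hb Ch H1.
replace (2 * b) with (RInt (fun _ => 1) (- b) b).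
- apply RInt_le; [lra|apply ex_RInt_cont; intros; apply continuous_const|now apply ex_RInt_cont|].
  intros x Hx; apply H1; lra.
- rewrite (RInt_const (V := R_CompleteNormedModule)); unfold scal; simpl; unfold mult; simpl; ring.
Qed.

Lemma nonlocal_bounds (b chi lam m : R) (h : R -> R) (x : R) : 0 < b -> 0 < chi -> 0 < lam ->
  (forall x, continuous h x) -> (forall x, - b <= x <= b -> 1 <= h x <= m) -> - b <= x <= b ->
  0 <= nonlocal b chi lam h x <= lam * m ^ 2 / (1 + 2 * b * chi) ^ 2.
Proof.
intros hb hchi hlam Ch Hh Hx.
pose proof (RInt_ge_len b h hb Ch (fun x Hx => proj1 (Hh x Hx))) as HI.
pose proof (Hh x Hx) as Hhx.
assert (HD : 0 < 1 + 2 * b * chi) by nra.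
assert (HD2 : 1 + 2 * b * chi <= 1 + chi * RInt h (- b) b) by nra.
unfold nonlocal; split.
- apply Rmult_le_pos; [nra|]; apply Rlt_le, Rinv_0_lt_compat, pow_lt; lra.
- apply Rmult_le_compat; [nra| | |].
  + apply Rlt_le, Rinv_0_lt_compat, pow_lt; lra.
  + apply Rmult_le_compat_l; [lra|]; apply pow_incr; lra.
  + apply Rinv_le_contravar; [apply pow_lt; lra|apply pow_incr; lra].
Qed.

(** With [p] and [q] the reciprocals of the two denominators, [h^2 p^2 - g^2 q^2 = (h - g) (h + g)
    p^2 + g^2 (p - q) (p + q)]. The first term gives [2 m]; the second gives [4 b chi m^2], since
    [|p - q|] is at most [2 b chi] times the distance of [h] and [g] and [p + q <= 2]. *)
Definition nonlocal_lip (b chi lam m : R) : R := lam * (2 * m + 4 * b * chi * m ^ 2).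

Lemma nonlocal_lipschitz (b chi lam m eta : R) (h g : R -> R) (x : R) : 0 < b -> 0 < chi -> 0 < lam ->
  (forall x, continuous h x) -> (forall x, continuous g x) ->
  (forall x, - b <= x <= b -> 1 <= h x <= m) -> (forall x, - b <= x <= b -> 1 <= g x <= m) ->
  (forall x, - b <= x <= b -> Rabs (h x - g x) <= eta) -> - b <= x <= b ->
  Rabs (nonlocal b chi lam h x - nonlocal b chi lam g x) <= nonlocal_lip b chi lam m * eta.
Proof.
intros hb hchi hlam Ch Cg Hh Hg He Hx.
pose proof (RInt_ge_len b h hb Ch (fun x Hx => proj1 (Hh x Hx))) as HI.
pose proof (RInt_ge_len b g hb Cg (fun x Hx => proj1 (Hg x Hx))) as HJ.
assert (HIJ : Rabs (RInt h (- b) b - RInt g (- b) b) <= 2 * b * eta).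
{ replace (RInt h (- b) b - RInt g (- b) b) with (RInt (fun x => 1 * h x + -1 * g x) (- b) b).
  2:{ rewrite RInt_lin by now apply ex_RInt_cont. (in_R; ring). }
  replace (2 * b) with (b - - b) by ring.
  apply abs_RInt_le_const; [lra| |].
  - apply ex_RInt_cont; intros y; apply continuous_plusR;
      apply continuous_multR; auto; apply continuous_const.
  - intros y Hy; replace (1 * h y + -1 * g y) with (h y - g y) by ring; now apply He. }
set (I := RInt h (- b) b) in *; set (J := RInt g (- b) b) in *.
pose proof (Hh x Hx) as Hhx; pose proof (Hg x Hx) as Hgx; pose proof (He x Hx) as Hex.
unfold nonlocal; fold I J.
set (p := / (1 + chi * I)); set (q := / (1 + chi * J)).
assert (Hp : 0 < p <= 1).
{ unfold p; split; [apply Rinv_0_lt_compat; nra|]; rewrite <- Rinv_1; apply Rinv_le_contravar; nra. }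
assert (Hq : 0 < q <= 1).
{ unfold q; split; [apply Rinv_0_lt_compat; nra|]; rewrite <- Rinv_1; apply Rinv_le_contravar; nra. }
assert (Hpq : p - q = chi * (J - I) * (p * q)) by (unfold p, q; field; split; nra).
assert (Hpq' : Rabs (p - q) <= chi * (2 * b * eta)).
{ rewrite Hpq, Rabs_mult, Rabs_mult, (Rabs_pos_eq chi), (Rabs_pos_eq (p * q)), (Rabs_minus_sym J) by nra.
  assert (0 <= p * q <= 1) by nra.
  assert (0 <= chi * Rabs (I - J)) by (apply Rmult_le_pos; [lra|apply Rabs_pos]).
  assert (chi * Rabs (I - J) <= chi * (2 * b * eta)) by (apply Rmult_le_compat_l; lra).
  nra. }
replace (lam * h x ^ 2 / (1 + chi * I) ^ 2 - lam * g x ^ 2 / (1 + chi * J) ^ 2) with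
  (lam * ((h x - g x) * (h x + g x) * p ^ 2 + g x ^ 2 * ((p - q) * (p + q)))).
2:{ unfold p, q; field; split; nra. }
rewrite Rabs_mult, (Rabs_pos_eq lam) by lra.
unfold nonlocal_lip; rewrite (Rmult_assoc lam); apply Rmult_le_compat_l; [lra|].
eapply Rle_trans; [apply Rabs_triang|].
rewrite Rmult_plus_distr_r; apply Rplus_le_compat.
- rewrite !Rabs_mult, (Rabs_pos_eq (h x + g x)), (Rabs_pos_eq (p ^ 2)) by nra.
  assert (0 <= p ^ 2 <= 1) by nra.
  pose proof (Rabs_pos (h x - g x)).
  apply Rle_trans with (Rabs (h x - g x) * (h x + g x) * 1).
  + apply Rmult_le_compat_l; [apply Rmult_le_pos|]; lra.
  + nra.
- rewrite !Rabs_mult, (Rabs_pos_eq (g x ^ 2)), (Rabs_pos_eq (p + q)) by nra.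
  pose proof (Rabs_pos (p - q)).
  assert (Hgm : 0 <= g x ^ 2 <= m ^ 2) by (split; [nra|apply pow_incr; lra]).
  assert (H1 : Rabs (p - q) * (p + q) <= chi * (2 * b * eta) * 2).
  { apply Rmult_le_compat; lra. }
  assert (H2 : 0 <= Rabs (p - q) * (p + q)) by (apply Rmult_le_pos; lra).
  apply Rle_trans with (m ^ 2 * (chi * (2 * b * eta) * 2)); [apply Rmult_le_compat; lra|].
  right; ring.
Qed.

Lemma nonlocal_cont2 (b chi lam : R) (h : R -> R -> R) : 0 < b -> 0 < chi -> cont2 h ->
  (forall x t, 1 <= h x t) -> cont2 (fun x t => nonlocal b chi lam (fun y => h y t) x).
Proof.
intros hb hchi Ch H1 x t; unfold nonlocal, Rdiv.
assert (CI : cont2 (fun _ t => RInt (fun y => h y t) (- b) b)).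
{ apply (cont2_snd_only (fun t => RInt (fun y => h y t) (- b) b)), cont2_RInt; [lra|exact Ch]. }
apply continuity_2d_pt_mult.
- apply continuity_2d_pt_mult; [apply continuity_2d_pt_const|].
  simpl; apply continuity_2d_pt_mult; [apply Ch|].
  apply continuity_2d_pt_mult; [apply Ch|apply continuity_2d_pt_const].
- assert (C1 : continuity_2d_pt (fun _ t => 1 + chi * RInt (fun y => h y t) (- b) b) x t).
  { apply continuity_2d_pt_plus; [apply continuity_2d_pt_const|].
    apply continuity_2d_pt_mult; [apply continuity_2d_pt_const|apply CI]. }
  apply continuity_2d_pt_inv.
  + simpl; apply continuity_2d_pt_mult; [exact C1|].
    apply continuity_2d_pt_mult; [exact C1|apply continuity_2d_pt_const].
  + apply pow_nonzero, Rgt_not_eq.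
    pose proof (RInt_ge_len b (fun y => h y t) hb (fun y => cont2_fst h t y Ch) (fun y _ => H1 y t)).
    apply Rlt_gt; nra.
Qed.

(* [1 / (1 - s)] frozen outside [[0, 1/2]], where the solution will be seen to stay. *)
Definition trunc_inv (s : R) : R := / (1 - clamp 0 (1 / 2) s).

Lemma trunc_inv_bounds (s : R) : 1 <= trunc_inv s <= 2.
Proof.
unfold trunc_inv; pose proof (clamp_bounds 0 (1 / 2) s ltac:(lra)) as H; split.
- rewrite <- Rinv_1 at 1; apply Rinv_le_contravar; lra.
- replace 2 with (/ (1 / 2)) at 2 by field; apply Rinv_le_contravar; lra.
Qed.

Lemma inv_lipschitz (a c d : R) : 0 < d -> d <= a -> d <= c -> Rabs (/ a - / c) <= / d ^ 2 * Rabs (a - c).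
Proof.
intros Hd Ha Hc; replace (/ a - / c) with ((c - a) * / (a * c)) by (field; lra).
rewrite Rabs_mult, (Rabs_minus_sym c a), Rmult_comm.
apply Rmult_le_compat_r; [apply Rabs_pos|].
rewrite Rabs_pos_eq by (apply Rlt_le, Rinv_0_lt_compat; nra).
apply Rinv_le_contravar; nra.
Qed.

Lemma trunc_inv_lipschitz (s r : R) : Rabs (trunc_inv r - trunc_inv s) <= 4 * Rabs (r - s).
Proof.
unfold trunc_inv; pose proof (clamp_bounds 0 (1 / 2) s ltac:(lra)) as Hs.
pose proof (clamp_bounds 0 (1 / 2) r ltac:(lra)) as Hr.
eapply Rle_trans; [apply (inv_lipschitz _ _ (1 / 2)); lra|].
pose proof (clamp_lipschitz 0 (1 / 2) s r) as HL.
replace (1 - clamp 0 (1 / 2) r - (1 - clamp 0 (1 / 2) s))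
  with (- (clamp 0 (1 / 2) r - clamp 0 (1 / 2) s)) by ring.
rewrite Rabs_Ropp; replace (/ (1 / 2) ^ 2) with 4 by field; lra.
Qed.

Lemma trunc_inv_continuous (s : R) : continuous trunc_inv s.
Proof. apply (continuous_lipschitz _ 4), trunc_inv_lipschitz. Qed.

Definition trunc_source (b chi lam : R) (u : R -> R -> R) (x t : R) : R :=
  nonlocal b chi lam (fun y => trunc_inv (u y t)) x.

(** The [4] here is the square of the bound [2] on [trunc_inv]; the [4] in [trunc_lip] is the
    Lipschitz constant of [trunc_inv]. *)
Definition trunc_sup (b chi lam : R) : R := 4 * lam / (1 + 2 * b * chi) ^ 2.
Definition trunc_lip (b chi lam : R) : R := 4 * nonlocal_lip b chi lam 2.

Lemma trunc_source_cont2 (b chi lam : R) (u : R -> R -> R) : 0 < b -> 0 < chi -> cont2 u ->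
  cont2 (trunc_source b chi lam u).
Proof.
intros hb hchi Cu; apply (nonlocal_cont2 b chi lam (fun y t => trunc_inv (u y t))); trivial.
- now apply (cont2_1d trunc_inv); [apply trunc_inv_continuous|].
- intros; apply trunc_inv_bounds.
Qed.

Lemma trunc_inv_comp_continuous (u : R -> R -> R) (t x : R) : cont2 u -> continuous (fun y => trunc_inv (u y t)) x.
Proof.
intros Cu; apply (continuous_comp (fun y => u y t) trunc_inv); [now apply cont2_fst|apply trunc_inv_continuous].
Qed.

Lemma trunc_source_bounds (b chi lam : R) (u : R -> R -> R) (x t : R) : 0 < b -> 0 < chi -> 0 < lam ->
  cont2 u -> - b <= x <= b -> 0 <= trunc_source b chi lam u x t <= trunc_sup b chi lam.
Proof.
intros hb hchi hlam Cu Hx; unfold trunc_sup.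
replace (4 * lam) with (lam * 2 ^ 2) by ring.
apply (nonlocal_bounds b chi lam 2); trivial.
- intros y; now apply trunc_inv_comp_continuous.
- intros; apply trunc_inv_bounds.
Qed.

Lemma trunc_source_lipschitz (b chi lam eta : R) (u v : R -> R -> R) (x t s : R) :
  0 < b -> 0 < chi -> 0 < lam -> cont2 u -> cont2 v ->
  (forall x, - b <= x <= b -> Rabs (u x t - v x s) <= eta) -> - b <= x <= b ->
  Rabs (trunc_source b chi lam u x t - trunc_source b chi lam v x s) <= trunc_lip b chi lam * eta.
Proof.
intros hb hchi hlam Cu Cv He Hx; unfold trunc_lip.
replace (4 * nonlocal_lip b chi lam 2 * eta) with (nonlocal_lip b chi lam 2 * (4 * eta)) by ring.
apply nonlocal_lipschitz; trivial.
- intros y; now apply trunc_inv_comp_continuous.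
- intros y; now apply trunc_inv_comp_continuous.
- intros; apply trunc_inv_bounds.
- intros; apply trunc_inv_bounds.
- intros y Hy; eapply Rle_trans; [apply trunc_inv_lipschitz|].
  pose proof (He y Hy); lra.
Qed.

Lemma trunc_sup_pos (b chi lam : R) : 0 < b -> 0 < chi -> 0 < lam -> 0 < trunc_sup b chi lam.
Proof. intros; apply Rdiv_lt_0_compat; [lra|apply pow_lt; nra]. Qed.

Lemma nonlocal_lip_pos (b chi lam m : R) : 0 < b -> 0 < chi -> 0 < lam -> 0 < m -> 0 < nonlocal_lip b chi lam m.
Proof.
intros hb hchi hlam Hm; apply Rmult_lt_0_compat; [exact hlam|apply Rplus_lt_0_compat; [lra|]].
apply Rmult_lt_0_compat; [nra|now apply pow_lt].
Qed.

Lemma trunc_lip_pos (b chi lam : R) : 0 < b -> 0 < chi -> 0 < lam -> 0 < trunc_lip b chi lam.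
Proof. intros; unfold trunc_lip; pose proof (nonlocal_lip_pos b chi lam 2); lra. Qed.

(** * Picard iteration for the truncated problem *)

Definition dirichlet (b : R) (u : R -> R -> R) : Prop :=
  cont2 u /\ (forall x t, u x t = u (clamp (- b) b x) (Rmax 0 t)) /\
  (forall x, u x 0 = 0) /\ (forall t, u (- b) t = 0 /\ u b t = 0).

(** The increment bound is tailored to be invariant: if [u] satisfies it, the source of the next
    iterate changes over a time [h] by at most the time derivative of this very bound, and the first
    increment of the iterate from [t = 0] is at most [trunc_sup * h]. *)
Definition picard_set (b chi lam : R) (u : R -> R -> R) : Prop :=
  dirichlet b u /\
  forall x t h, - b <= x <= b -> 0 <= t -> 0 <= h ->
    Rabs (u x (t + h) - u x t) <= trunc_sup b chi lam * h * exp (trunc_lip b chi lam * t).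

Lemma exp_scal_derive (K g t : R) : is_derive (fun s => K * exp (g * s)) t (g * (K * exp (g * t))).
Proof. auto_derive; [exact I|ring]. Qed.

(** Comparison with the barrier [K exp (g t)], which reproduces itself when the sources differ by at
    most [g] times it. It yields both the invariance of [picard_set] and the contraction. *)
Lemma heat_diff_bound (b K g : R) (u v phi psi : R -> R -> R) (x t : R) : 0 < b -> 0 <= K ->
  cont2 u -> cont2 v -> heat_eq b u phi -> heat_eq b v psi ->
  (forall s, 0 <= s -> u (- b) s = v (- b) s /\ u b s = v b s) ->
  (forall y, - b <= y <= b -> Rabs (u y 0 - v y 0) <= K) ->
  (forall y s, - b < y < b -> 0 < s -> Rabs (phi y s - psi y s) <= g * (K * exp (g * s))) ->
  - b <= x <= b -> 0 <= t -> Rabs (u x t - v x t) <= K * exp (g * t).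
Proof.
intros hb HK Cu Cv Hu Hv Hbd Hi Hs Hx Ht.
replace (u x t - v x t) with (1 * u x t + -1 * v x t) by ring.
apply (heat_bound b (fun x t => 1 * u x t + -1 * v x t) (fun x t => 1 * phi x t + -1 * psi x t)
  (fun t => K * exp (g * t)) (fun t => g * (K * exp (g * t)))); trivial.
- intros y s; apply continuity_2d_pt_plus; apply continuity_2d_pt_mult;
    [apply continuity_2d_pt_const|apply Cu|apply continuity_2d_pt_const|apply Cv].
- now apply heat_eq_lin.
- intros s Hs0; destruct (Hbd s Hs0) as [-> ->]; split; ring.
- intros s; apply exp_scal_derive.
- intros s _; apply Rmult_le_pos; [exact HK|apply Rlt_le, exp_pos].
- intros y Hy; rewrite Rmult_0_r, exp_0, Rmult_1_r.
  replace (1 * u y 0 + -1 * v y 0) with (u y 0 - v y 0) by ring; now apply Hi.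
- intros y s Hy Hs0; replace (1 * phi y s + -1 * psi y s) with (phi y s - psi y s) by ring.
  now apply Hs.
Qed.

Lemma heat_time_bound (b K : R) (u phi : R -> R -> R) (x t : R) : 0 < b -> 0 <= K ->
  dirichlet b u -> heat_eq b u phi ->
  (forall y s, - b < y < b -> 0 < s -> Rabs (phi y s) <= K) ->
  - b <= x <= b -> 0 <= t -> Rabs (u x t) <= K * t.
Proof.
intros hb HK (Cu & _ & H0 & Hbd) Hu Hphi Hx Ht.
apply (heat_bound b u phi (fun t => K * t) (fun _ => K)); auto.
- intros s; auto_derive; [exact I|ring].
- intros s Hs; now apply Rmult_le_pos.
- intros y _; rewrite H0, Rabs_R0; lra.
Qed.

Lemma picard_set_lip_time (b chi lam : R) (u : R -> R -> R) : 0 < b -> 0 < chi -> 0 < lam ->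
  picard_set b chi lam u -> lip_time b (trunc_source b chi lam u).
Proof.
intros hb hchi hlam [(Cu & Inv & _) HL] T.
pose proof (trunc_sup_pos b chi lam hb hchi hlam) as HC; pose proof (trunc_lip_pos b chi lam hb hchi hlam) as HLp.
set (L := trunc_sup b chi lam * exp (trunc_lip b chi lam * Rabs T)).
assert (HL0 : 0 <= L) by (apply Rmult_le_pos; [lra|apply Rlt_le, exp_pos]).
exists (trunc_lip b chi lam * L); split; [nra|].
intros x s t Hx Hs Ht; rewrite Rmult_assoc; apply trunc_source_lipschitz; trivial.
assert (Key : forall y s t, - b <= y <= b -> s <= t -> t <= T -> Rabs (u y t - u y s) <= L * Rabs (t - s)).
{ clear x s t Hx Hs Ht; intros y s t Hy Hst Ht.
  rewrite (Inv y t), (Inv y s), clamp_id by exact Hy.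
  set (h := Rmax 0 t - Rmax 0 s).
  assert (Hh : 0 <= h <= t - s).
  { unfold h, Rmax; destruct (Rle_dec 0 t); destruct (Rle_dec 0 s); lra. }
  replace (Rmax 0 t) with (Rmax 0 s + h) by (unfold h; ring).
  eapply Rle_trans; [apply HL; [exact Hy|apply Rmax_l|lra]|].
  rewrite Rmult_assoc, (Rmult_comm h), <- Rmult_assoc.
  rewrite (Rabs_pos_eq (t - s)) by lra.
  apply Rmult_le_compat; [|lra| |lra].
  - apply Rmult_le_pos; [lra|apply Rlt_le, exp_pos].
  - apply Rmult_le_compat_l; [lra|].
    destruct (Req_dec (Rmax 0 s) (Rabs T)) as [->|Hne]; [lra|].
    apply Rlt_le, exp_increasing, Rmult_lt_compat_l; [exact HLp|].
    revert Hne; unfold Rmax; destruct (Rle_dec 0 s); intros; split_Rabs; lra. }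
intros y Hy; destruct (Rle_dec s t) as [Hst|Hst]; [now apply Key|].
rewrite Rabs_minus_sym, (Rabs_minus_sym t s); apply Key; lra || assumption.
Qed.

(** The hypothesis sits under the existential so that choice turns this into a step function defined
    on all [u]; outside [picard_set] the witness is arbitrary. *)
Lemma picard_step (b chi lam : R) (u : R -> R -> R) : 0 < b -> 0 < chi -> 0 < lam ->
  exists v, picard_set b chi lam u -> picard_set b chi lam v /\ heat b v (trunc_source b chi lam u).
Proof.
intros hb hchi hlam.
destruct (classic (picard_set b chi lam u)) as [Hu|Hu]; [|exists u; intros H; contradiction].
pose proof Hu as [(Cu & Inv & H0 & Hbd) HL].
pose proof (trunc_sup_pos b chi lam hb hchi hlam) as HC; pose proof (trunc_lip_pos b chi lam hb hchi hlam) as HLp.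
destruct (linear_heat b (trunc_source b chi lam u) hb) as (v & Cv & Iv & V0 & Vb & Hv).
- now apply trunc_source_cont2.
- now apply picard_set_lip_time.
- exists v; intros _; split; [|exact Hv].
  assert (Dv : dirichlet b v) by (repeat split; auto; apply Vb).
  split; [exact Dv|].
  apply heat_heat_eq in Hv.
  intros x t h Hx Ht Hh.
  (* The time shift of [v] is compared with [v] itself. *)
  apply (heat_diff_bound b (trunc_sup b chi lam * h) (trunc_lip b chi lam)
    (fun x t => v x (t + h)) v (fun x t => trunc_source b chi lam u x (t + h)) (trunc_source b chi lam u)); trivial.
  + nra.
  + apply (cont2_comp v (fun x => x) (fun t => t + h) Cv).
    * intros; apply continuous_id.
    * intros s; apply (continuous_plusR (fun s => s) (fun _ => h));
        [apply continuous_id|apply continuous_const].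
  + now apply heat_eq_shift.
  + intros s Hs; destruct (Vb s) as [-> ->]; destruct (Vb (s + h)) as [-> ->]; now split.
  + intros y Hy; rewrite Rplus_0_l, V0, Rminus_0_r.
    apply (heat_time_bound b _ v (trunc_source b chi lam u)); trivial; try lra.
    intros z s Hz Hs; pose proof (trunc_source_bounds b chi lam u z s hb hchi hlam Cu ltac:(lra)).
    rewrite Rabs_pos_eq; lra.
  + intros y s Hy Hs; apply trunc_source_lipschitz; trivial; [|lra].
    intros z Hz; apply HL; lra.
Qed.

Lemma le_geom (X Y K : R) : (forall k : nat, X <= Y + K * (1 / 2) ^ k) -> X <= Y.
Proof.
intros H; apply Rnot_lt_le; intros Hlt.
assert (Hr : Rabs (1 / 2) < 1) by (rewrite Rabs_pos_eq; lra).
assert (HK : 0 < Rabs K + 1) by (pose proof (Rabs_pos K); lra).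
assert (He : 0 < (X - Y) / (Rabs K + 1)) by (apply Rdiv_lt_0_compat; lra).
destruct (pow_lt_1_zero (1 / 2) Hr _ He) as [N HN]; specialize (HN N (le_n _)).
assert (Hp : 0 < (1 / 2) ^ N) by (apply pow_lt; lra).
rewrite Rabs_pos_eq in HN by lra.
assert (H1 : (1 / 2) ^ N * (Rabs K + 1) < X - Y).
{ apply (Rmult_lt_compat_r (Rabs K + 1)) in HN; [|exact HK].
  replace ((X - Y) / (Rabs K + 1) * (Rabs K + 1)) with (X - Y) in HN by (field; lra); exact HN. }
pose proof (H N); pose proof (Rle_abs K); nra.
Qed.

Lemma geom_tail (c : R) (k : nat) :
  ex_series (fun n => c * (1 / 2) ^ n) /\
  Series (fun n => c * (1 / 2) ^ n) - sum_n (fun n => c * (1 / 2) ^ n) k = c * (1 / 2) ^ k.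
Proof.
assert (Hr : Rabs (1 / 2) < 1) by (rewrite Rabs_pos_eq; lra).
split.
- apply (ex_series_scal (V := R_NormedModule)); now apply ex_series_geom.
- rewrite Series_scal_l, Series_geom by exact Hr.
  assert (E : sum_n (fun n => c * (1 / 2) ^ n) k = 2 * c - c * (1 / 2) ^ k).
  { induction k as [|k IH].
    - rewrite sum_O; simpl; ring.
    - rewrite sum_Sn, IH; unfold plus; simpl; field. }
  rewrite E; field.
Qed.

Lemma truncated_solution (b chi lam : R) : 0 < b -> 0 < chi -> 0 < lam ->
  exists u, dirichlet b u /\ heat b u (trunc_source b chi lam u).
Proof.
intros hb hchi hlam.
pose proof (trunc_sup_pos b chi lam hb hchi hlam) as HC; pose proof (trunc_lip_pos b chi lam hb hchi hlam) as HLp.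
set (C0 := trunc_sup b chi lam) in *; set (L0 := trunc_lip b chi lam) in *.
set (step u := proj1_sig (constructive_indefinite_description _ (picard_step b chi lam u hb hchi hlam))).
assert (Hstep : forall u, picard_set b chi lam u ->
  picard_set b chi lam (step u) /\ heat b (step u) (trunc_source b chi lam u)).
{ intros u; unfold step; now destruct (constructive_indefinite_description _ _). }
set (U := fix U (k : nat) : R -> R -> R := match k with O => fun _ _ => 0 | S k => step (U k) end).
assert (HU : forall k, picard_set b chi lam (U k)).
{ induction k as [|k IH]; [|now apply Hstep].
  split; [split; [|split; [|split]]|].
  - intros x t; apply continuity_2d_pt_const.
  - reflexivity.
  - reflexivity.
  - now split.
  - intros x t h Hx Ht Hh; simpl; rewrite Rminus_0_r, Rabs_R0.
    apply Rmult_le_pos; [fold C0; nra|apply Rlt_le, exp_pos]. }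
assert (HUS : forall k, heat_eq b (U (S k)) (trunc_source b chi lam (U k))).
{ intros k; apply heat_heat_eq; simpl; now apply Hstep. }
(* The contraction factor in the norm weighted by [exp (- g t)] is [L0 / g = 1/2]. The constant [B]
   makes the first increment, at most [C0 t = B g t], smaller than [B exp (g t)]. *)
set (g := 2 * L0); set (B := C0 / g).
assert (Hg : 0 < g) by (unfold g; lra).
assert (HB : 0 < B) by now apply Rdiv_lt_0_compat.
assert (Hinc : forall k x t, - b <= x <= b -> 0 <= t ->
  Rabs (U (S k) x t - U k x t) <= B * (1 / 2) ^ k * exp (g * t)).
{ induction k as [|k IH]; intros x t Hx Ht.
  - change (U 0%nat x t) with 0; rewrite Rminus_0_r; simpl pow; rewrite Rmult_1_r.
    apply Rle_trans with (C0 * t).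
    + apply (heat_time_bound b _ (U 1%nat) (trunc_source b chi lam (U 0%nat))); trivial; try lra.
      * exact (proj1 (HU 1%nat)).
      * intros z s Hz Hs.
        pose proof (trunc_source_bounds b chi lam (U 0%nat) z s hb hchi hlam (proj1 (proj1 (HU 0%nat))) ltac:(lra)) as H.
        fold C0 in H; rewrite Rabs_pos_eq; lra.
    + replace (C0 * t) with (B * (g * t)) by (unfold B; field; lra).
      apply Rmult_le_compat_l; [lra|].
      destruct (Req_dec t 0) as [->|Hne]; [rewrite Rmult_0_r; apply Rlt_le, exp_pos|].
      pose proof (exp_ineq1 (g * t) ltac:(nra)); lra.
  - destruct (HU (S k)) as [(C1 & _ & Z1 & B1) _]; destruct (HU (S (S k))) as [(C2 & _ & Z2 & B2) _].
    destruct (HU k) as [(C3 & _) _].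
    assert (Hp : 0 < (1 / 2) ^ S k) by (apply pow_lt; lra).
    apply (heat_diff_bound b (B * (1 / 2) ^ S k) g (U (S (S k))) (U (S k))
      (trunc_source b chi lam (U (S k))) (trunc_source b chi lam (U k))); trivial; try apply HUS.
    + nra.
    + intros s Hs; destruct (B1 s) as [-> ->]; destruct (B2 s) as [-> ->]; now split.
    + intros y _; rewrite Z1, Z2, Rminus_0_r, Rabs_R0; nra.
    + intros y s Hy Hs.
      replace (g * (B * (1 / 2) ^ S k * exp (g * s))) with (L0 * (B * (1 / 2) ^ k * exp (g * s)))
        by (unfold g; simpl; field).
      apply trunc_source_lipschitz; trivial; [|lra].
      intros z Hz; apply IH; lra. }
assert (Hinc' : forall k x t, Rabs (U (S k) x t - U k x t) <= B * exp (g * Rmax 0 t) * (1 / 2) ^ k).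
{ intros k x t; destruct (HU (S k)) as [(_ & I1 & _) _]; destruct (HU k) as [(_ & I0 & _) _].
  rewrite I1, I0.
  eapply Rle_trans; [apply Hinc; [apply clamp_bounds; lra|apply Rmax_l]|right; ring]. }
(* The limit is a telescoping series starting from [U 0 = 0], so its partial sum up to [k] is
   [U (S k)] and the results on dominated series apply. *)
set (u x t := Series (fun k => U (S k) x t - U k x t)).
assert (Cu : cont2 u).
{ intros x t.
  apply (series_continuity_2d _ (fun k => B * exp (g * (Rabs t + 1)) * (1 / 2) ^ k)).
  - apply (geom_tail _ 0).
  - intros k; apply continuity_2d_pt_minus; apply HU.
  - exists (mkposreal 1 Rlt_0_1); intros y s _ Hs k; simpl in Hs.
    eapply Rle_trans; [apply Hinc'|].
    apply Rmult_le_compat_r; [apply pow_le; lra|apply Rmult_le_compat_l; [lra|]].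
    apply Rlt_le, exp_increasing, Rmult_lt_compat_l; [exact Hg|].
    unfold Rmax; destruct (Rle_dec 0 s); split_Rabs; lra. }
assert (Hlim : forall k x t, 0 <= t -> Rabs (u x t - U (S k) x t) <= B * exp (g * t) * (1 / 2) ^ k).
{ intros k x t Ht.
  destruct (geom_tail (B * exp (g * t)) k) as [E1 E2].
  assert (ES : sum_n (fun k => U (S k) x t - U k x t) k = U (S k) x t).
  { clear; induction k as [|k IH].
    - rewrite sum_O; change (U 0%nat x t) with 0; (in_R; ring).
    - rewrite sum_Sn, IH; unfold plus; simpl; (in_R; ring). }
  rewrite <- ES, <- E2; apply series_tail_le; [exact E1|].
  intros n; eapply Rle_trans; [apply Hinc'|rewrite Rmax_right by exact Ht; lra]. }
assert (Du : dirichlet b u).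
{ split; [exact Cu|split; [|split]].
  - intros x t; apply Series_ext; intros k.
    destruct (HU (S k)) as [(_ & I1 & _) _]; destruct (HU k) as [(_ & I0 & _) _]; now rewrite (I1 x t), (I0 x t).
  - intros x; unfold u; rewrite (Series_single _ 0); intros;
      rewrite !(proj1 (proj2 (proj2 (proj1 (HU _))))); ring.
  - assert (Hbd : forall k t, U k (- b) t = 0 /\ U k b t = 0) by (intros k; apply (proj1 (HU k))).
    intros t; unfold u; split.
    + rewrite (Series_single _ 0); intros; rewrite !(proj1 (Hbd _ t)); ring.
    + rewrite (Series_single _ 0); intros; rewrite !(proj2 (Hbd _ t)); ring. }
(* Derivatives are not passed to the limit. The limit inherits the closed condition [picard_set], so
   one more step applies to it; that step produces a classical solution, which then turns out to be
   [u] itself. *)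
assert (Pu : picard_set b chi lam u).
{ split; [exact Du|]; intros x t h Hx Ht Hh; fold C0 L0.
  apply (le_geom _ _ (B * exp (g * t) + B * exp (g * (t + h)))); intros k.
  pose proof (Hlim k x t Ht); pose proof (Hlim k x (t + h) ltac:(lra)).
  pose proof (proj2 (HU (S k)) x t h Hx Ht Hh) as H1; fold C0 L0 in H1.
  rewrite Rmult_plus_distr_r; split_Rabs; lra. }
exists u; split; [exact Du|].
destruct (Hstep u Pu) as [Pv Hv].
apply (heat_ext b (step u) u (trunc_source b chi lam u) (trunc_source b chi lam u)); [|reflexivity|exact Hv].
apply heat_heat_eq in Hv; destruct Pv as [(Cv & _ & V0 & Vb) _].
intros x t Hx Ht.
(* Both functions are geometrically close to [U (S (S k))]: [step u] by the contraction estimate,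
   [u] by [Hlim]. *)
assert (HA : Rabs (step u x t - u x t) <= 0).
{ apply (le_geom _ _ (2 * B * exp (g * t))); intros k; rewrite Rplus_0_l.
  assert (Hp : 0 < (1 / 2) ^ k) by (apply pow_lt; lra).
  destruct (HU (S k)) as [(C1 & _) _]; destruct (HU (S (S k))) as [(C2 & _ & Z2 & B2) _].
  assert (H1 : Rabs (step u x t - U (S (S k)) x t) <= B * (1 / 2) ^ k * exp (g * t)).
  { apply (heat_diff_bound b (B * (1 / 2) ^ k) g (step u) (U (S (S k)))
      (trunc_source b chi lam u) (trunc_source b chi lam (U (S k)))); trivial; try apply HUS.
    - nra.
    - intros s _; destruct (Vb s) as [-> ->]; destruct (B2 s) as [-> ->]; now split.
    - intros y _; rewrite V0, Z2, Rminus_0_r, Rabs_R0; nra.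
    - intros y s Hy Hs.
      apply Rle_trans with (L0 * (B * exp (g * s) * (1 / 2) ^ k)).
      + apply trunc_source_lipschitz; trivial; [|lra].
        intros z Hz; apply Hlim; lra.
      + pose proof (exp_pos (g * s)).
        assert (0 < B * (1 / 2) ^ k * exp (g * s)) by (apply Rmult_lt_0_compat; [now apply Rmult_lt_0_compat|lra]).
        replace (B * exp (g * s) * (1 / 2) ^ k) with (B * (1 / 2) ^ k * exp (g * s)) by ring.
        apply Rmult_le_compat_r; [lra|unfold g; lra]. }
  pose proof (Hlim (S k) x t Ht) as H2.
  assert (H3 : B * exp (g * t) * (1 / 2) ^ S k <= B * exp (g * t) * (1 / 2) ^ k).
  { apply Rmult_le_compat_l; [apply Rmult_le_pos; [lra|apply Rlt_le, exp_pos]|simpl; lra]. }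
  split_Rabs; lra. }
pose proof (Rabs_pos (step u x t - u x t)); split_Rabs; lra.
Qed.

(** * Existence *)

Lemma continuous_pair_ext (b : R) (f g : R -> R -> R) (x t : R) : - b < x < b -> 0 < t ->
  (forall y s, - b < y < b -> 0 < s -> g y s = f y s) -> continuity_2d_pt f x t ->
  continuous (fun p : R * R => g (fst p) (snd p)) (x, t).
Proof.
intros Hx Ht Hfg Cf.
apply (continuous_ext_loc _ (fun p : R * R => f (fst p) (snd p))).
- apply (locally_2d_locally (fun y s => f y s = g y s)).
  destruct (interior_locally b x t Hx Ht) as [d Hd]; exists d; intros y s Hy Hs.
  destruct (Hd y s Hy Hs); symmetry; now apply Hfg.
- now apply continuity_2d_pt_filterlim.
Qed.

Lemma heat_C21 (b : R) (u phi : R -> R -> R) : cont2 u -> heat b u phi ->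
  C21_on (fun p => Omega b (fst p) /\ time p_infty (snd p)) u.
Proof.
intros Cu (u1 & u2 & ut & Hr & _) x t [Hx [Ht _]]; simpl in Hx, Ht.
destruct (heat_reg_Derive b u u1 u2 ut x t Hr Hx Ht) as (_ & _ & _ & Hex).
destruct (Hr x t Hx Ht) as [(D1 & D2 & D3) (C1 & C2 & Ct)].
split; [|split; [now exists (ut x t)|]].
- intros k Hk; destruct k as [|[|[|k]]]; [| | |lia].
  + split; [exact I|]; apply (continuous_pair_ext b u); auto.
  + split; [now exists (u1 x t)|].
    apply (continuous_pair_ext b u1 (fun y s => Derive_n (fun z => u z s) 1 y)); auto.
    intros y s Hy Hs; now apply (heat_reg_Derive b u u1 u2 ut).
  + split; [exact Hex|].
    apply (continuous_pair_ext b u2 (fun y s => Derive_n (fun z => u z s) 2 y)); auto.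
    intros y s Hy Hs; now apply (heat_reg_Derive b u u1 u2 ut).
- apply (continuous_pair_ext b ut (fun y s => Derive (fun r => u y r) s)); auto.
  intros y s Hy Hs; now apply (heat_reg_Derive b u u1 u2 ut).
Qed.

(** The threshold reads [lam < chi (1 + 2 b chi) / (4 b)], so [trunc_sup] is below
    [chi / (b (1 + 2 b chi))], which is [1 / (2 b^2)] times [2 b chi / (1 + 2 b chi) < 1]. *)
Lemma trunc_sup_small (b chi lam : R) : 0 < b -> 0 < chi ->
  0 < lam < chi * (1 + chi * len_Omega b) / (2 * len_Omega b) ->
  trunc_sup b chi lam <= 1 / (2 * b ^ 2).
Proof.
unfold len_Omega; intros hb hchi [hl hlam].
assert (Hk : 0 < 1 + 2 * b * chi) by nra.
assert (H1 : lam * (4 * b) < chi * (1 + 2 * b * chi)).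
{ apply (Rmult_lt_compat_r (4 * b)) in hlam; [|lra].
  replace (chi * (1 + chi * (2 * b)) / (2 * (2 * b)) * (4 * b)) with (chi * (1 + 2 * b * chi)) in hlam
    by (field; lra); exact hlam. }
unfold trunc_sup; apply (Rmult_le_reg_r ((1 + 2 * b * chi) ^ 2 * (2 * b ^ 2))).
- apply Rmult_lt_0_compat; [apply pow_lt; lra|nra].
- replace (4 * lam / (1 + 2 * b * chi) ^ 2 * ((1 + 2 * b * chi) ^ 2 * (2 * b ^ 2)))
    with (lam * (4 * b) * (2 * b)) by (field; lra).
  replace (1 / (2 * b ^ 2) * ((1 + 2 * b * chi) ^ 2 * (2 * b ^ 2))) with ((1 + 2 * b * chi) ^ 2)
    by (field; lra).
  nra.
Qed.

Lemma truncated_nonneg (b chi lam : R) (u : R -> R -> R) (x t : R) :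
  0 < b -> 0 < chi -> 0 < lam -> dirichlet b u -> heat b u (trunc_source b chi lam u) ->
  - b <= x <= b -> 0 <= t -> 0 <= u x t.
Proof.
intros hb hchi hlam (Cu & _ & H0 & Hbd) Hu Hx Ht.
apply (max_principle b t u (trunc_source b chi lam u)); trivial; try lra.
- now apply heat_heat_eq.
- intros y s Hy Hs; apply trunc_source_bounds; trivial; lra.
- intros y _; rewrite H0; lra.
- intros s _; destruct (Hbd s) as [-> ->]; lra.
Qed.

(** Minus the second derivative of the parabola [p] is exactly [1 / (2 b^2)]. Its maximum [1/4] lies
    below the truncation level [1/2], so together with [truncated_nonneg] the truncation is never
    active. *)
Lemma truncated_le_quarter (b chi lam : R) (u : R -> R -> R) (x t : R) :
  0 < b -> 0 < chi -> 0 < lam -> trunc_sup b chi lam <= 1 / (2 * b ^ 2) ->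
  dirichlet b u -> heat b u (trunc_source b chi lam u) ->
  - b <= x <= b -> 0 <= t -> u x t <= 1 / 4.
Proof.
intros hb hchi hlam Hs (Cu & _ & H0 & Hbd) Hu Hx Ht.
set (p (x t : R) := 1 / 4 - x ^ 2 / (4 * b ^ 2)).
assert (Hbb : 0 < 4 * b ^ 2) by nra.
assert (Hp : heat_eq b p (fun _ _ => 1 / (2 * b ^ 2))).
{ exists (fun x _ => - x / (2 * b ^ 2)), (fun _ _ => - 1 / (2 * b ^ 2)); intros y s _ _.
  split; [|split].
  - unfold p; auto_derive; [exact I|field; lra].
  - auto_derive; [exact I|field; lra].
  - unfold p; auto_derive; [exact I|field; lra]. }
assert (Cp : cont2 p).
{ apply (cont2_fst_only (fun x => 1 / 4 - x ^ 2 / (4 * b ^ 2))); intros y.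
  apply ex_derive_continuousR; auto_derive; exact I. }
assert (Hp0 : forall y, - b <= y <= b -> 0 <= p y 0).
{ intros y Hy; unfold p.
  replace (1 / 4 - y ^ 2 / (4 * b ^ 2)) with ((b ^ 2 - y ^ 2) / (4 * b ^ 2)) by (field; lra).
  apply Rmult_le_pos; [nra|apply Rlt_le, Rinv_0_lt_compat, Hbb]. }
assert (HA : 0 <= 1 * p x t + -1 * u x t).
{ apply (max_principle b t (fun x t => 1 * p x t + -1 * u x t)
    (fun x t => 1 * (1 / (2 * b ^ 2)) + -1 * trunc_source b chi lam u x t)); trivial; try lra.
  - intros y s; apply continuity_2d_pt_plus; apply continuity_2d_pt_mult;
      [apply continuity_2d_pt_const|apply Cp|apply continuity_2d_pt_const|apply Cu].
  - apply heat_eq_lin; [exact Hp|now apply heat_heat_eq].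
  - intros y s Hy _; pose proof (trunc_source_bounds b chi lam u y s hb hchi hlam Cu ltac:(lra)); lra.
  - intros y Hy; pose proof (Hp0 y Hy); rewrite H0; lra.
  - intros s _; destruct (Hbd s) as [-> ->].
    pose proof (Hp0 (- b) ltac:(lra)) as H1; pose proof (Hp0 b ltac:(lra)) as H2; unfold p in *; lra. }
assert (0 <= x ^ 2 / (4 * b ^ 2)).
{ apply Rmult_le_pos; [apply pow2_ge_0|apply Rlt_le, Rinv_0_lt_compat, Hbb]. }
unfold p in HA; lra.
Qed.

Lemma reaction_nonlocal (b chi lam : R) (w h : R -> R) (x : R) : 0 < b -> - b < x < b ->
  (forall y, - b <= y <= b -> h y = 1 / (1 - w y) /\ 1 - w y <> 0) ->
  1 + chi * RInt h (- b) b <> 0 ->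
  reaction b chi lam w x = nonlocal b chi lam h x.
Proof.
intros hb Hx Hh HI; unfold reaction, nonlocal.
rewrite (RInt_ext (fun y => 1 / (1 - w y)) h).
- destruct (Hh x ltac:(lra)) as [-> Hne]; field; now split.
- intros y Hy; rewrite Rmin_left, Rmax_right in Hy by lra; symmetry; apply Hh; lra.
Qed.

Lemma global_existence (b chi lam : R) : 0 < b -> 0 < chi ->
  0 < lam < chi * (1 + chi * len_Omega b) / (2 * len_Omega b) ->
  exists u, global_solution b chi lam (fun _ => 0) u /\
    forall x t, Omega_bar b x -> 0 < t -> 0 <= u x t.
Proof.
intros hb hchi hlam.
destruct (truncated_solution b chi lam hb hchi ltac:(lra)) as (u & Du & Hu).
pose proof Du as (Cu & _ & H0 & Hbd).
assert (Hlo : forall x t, - b <= x <= b -> 0 <= t -> 0 <= u x t).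
{ intros; apply (truncated_nonneg b chi lam u); trivial; lra. }
assert (Hup : forall x t, - b <= x <= b -> 0 <= t -> u x t <= 1 / 4).
{ intros; apply (truncated_le_quarter b chi lam u); trivial; [lra|now apply trunc_sup_small]. }
exists u; split; [|intros x t Hx Ht; apply Hlo; [exact Hx|lra]].
split; [now apply (heat_C21 b u (trunc_source b chi lam u))|].
split; [|split; [|split; [|split; [|split]]]].
- apply continuous_on_forall; intros [x t] _.
  apply (continuity_2d_pt_filterlim u x t), Cu.
- intros x t Hx [Ht _]; unfold Omega in Hx.
  pose proof (Hlo x t ltac:(lra) ltac:(lra)); pose proof (Hup x t ltac:(lra) ltac:(lra)); lra.
- intros x t Hx [Ht _].
  rewrite (reaction_nonlocal b chi lam _ (fun y => trunc_inv (u y t))); trivial.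
  + destruct Hu as (u1 & u2 & ut & Hr & He).
    destruct (heat_reg_Derive b u u1 u2 ut x t Hr Hx Ht) as (_ & -> & -> & _); now apply He.
  + intros y Hy; unfold trunc_inv; pose proof (Hlo y t Hy ltac:(lra)); pose proof (Hup y t Hy ltac:(lra)).
    rewrite clamp_id by lra; split; [unfold Rdiv; ring|lra].
  + pose proof (RInt_ge_len b (fun y => trunc_inv (u y t)) hb (fun y => trunc_inv_comp_continuous u t y Cu)
      (fun y _ => proj1 (trunc_inv_bounds _))); apply Rgt_not_eq; nra.
- intros x t [->| ->] _; apply Hbd.
- intros T' [HT' _].
  eapply Rbar_le_lt_trans; [|exact (ltac:(simpl; lra) : Rbar_lt (1 / 4) 1)].
  apply (proj2 (Lub_Rbar_correct _)).
  intros z (x & t & Hx & Ht & ->); apply Hup; [exact Hx|lra].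
- split; [apply ex_RInt_cont; intros; apply continuous_const|].
  set (K := trunc_sup b chi lam).
  assert (HK : 0 < K) by (apply trunc_sup_pos; lra).
  apply filterlim_locally; intros eps; pose proof (cond_pos eps) as Heps.
  (* The bound [u <= K t] on an interval of length [2 b] makes the [L^1] norm at most [2 b K t],
     hence below [eps / 2]. *)
  assert (Hd : 0 < eps / (4 * b * K)) by (apply Rdiv_lt_0_compat; nra).
  exists (mkposreal _ Hd); intros t Ht Ht0.
  change (Rabs (t - 0) < eps / (4 * b * K)) in Ht.
  rewrite Rminus_0_r, Rabs_pos_eq in Ht by lra.
  change (Rabs (RInt (fun x => Rabs (u x t - 0)) (- b) b - 0) < eps).
  rewrite Rminus_0_r.
  apply Rle_lt_trans with ((b - - b) * (K * t)).
  + apply abs_RInt_le_const; [lra| |].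
    * apply ex_RInt_cont; intros y; apply (continuous_comp (fun x => u x t - 0) Rabs);
        [|apply continuous_Rabs].
      apply continuous_minusR; [now apply (cont2_fst u)|apply continuous_const].
    * intros y Hy; rewrite Rabs_Rabsolu, Rminus_0_r.
      apply (heat_time_bound b K u (trunc_source b chi lam u)); trivial; try lra.
      -- now apply heat_heat_eq.
      -- intros z s Hz Hs; pose proof (trunc_source_bounds b chi lam u z s hb hchi ltac:(lra) Cu ltac:(lra)) as H.
         rewrite Rabs_pos_eq; unfold K; lra.
  + apply (Rmult_lt_compat_r (4 * b * K)) in Ht; [|nra].
    replace (eps / (4 * b * K) * (4 * b * K)) with (pos eps) in Ht by (field; lra).
    assert (t * (2 * b * K) < eps); nra.
Qed.

(** * Uniqueness *)

Lemma heat_minus (b : R) (u w phi psi : R -> R -> R) : heat b u phi -> heat b w psi ->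
  heat b (fun x t => u x t - w x t) (fun x t => phi x t - psi x t).
Proof.
intros (u1 & u2 & ut & Hu & Eu) (w1 & w2 & wt & Hw & Ew).
exists (fun x t => u1 x t - w1 x t), (fun x t => u2 x t - w2 x t), (fun x t => ut x t - wt x t).
split.
- intros x t Hx Ht; destruct (Hu x t Hx Ht) as [(A1 & A2 & A3) (A4 & A5 & A6)].
  destruct (Hw x t Hx Ht) as [(B1 & B2 & B3) (B4 & B5 & B6)].
  split; [split; [|split]|split; [|split]];
    first [now apply is_derive_minusR
          |now apply continuity_2d_pt_minus].
- intros x t Hx Ht; rewrite Eu, Ew by assumption; ring.
Qed.

Lemma scaled_interior (b th x : R) : 0 < b -> 0 < th < 1 -> - b <= x <= b -> - b < th * x < b.
Proof. intros; nra. Qed.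

Lemma scaled_clamp_continuous (b th x : R) : continuous (fun y => th * clamp (- b) b y) x.
Proof.
apply continuous_multR; [apply continuous_const|apply continuous_clamp].
Qed.

(* Evaluating at [th * x] with [th < 1] keeps the derivatives of [d], which need not extend
   to the boundary, continuous on the whole of [[-b, b]]. *)
Lemma scaled_coef_derive (b th s : R) (n : nat) (d d1 d2 dt : R -> R -> R) :
  0 < b -> 0 < th < 1 -> 0 < s -> heat_reg b d d1 d2 dt ->
  is_derive (fun s => RInt (fun x => d (th * x) s * mode b n x) (- b) b) s
    (- (eig b n / th ^ 2) * RInt (fun x => d (th * x) s * mode b n x) (- b) b
     + (- (d (th * b) s * dmode b n b - d (- (th * b)) s * dmode b n (- b)) / th ^ 2
        + RInt (fun x => (dt (th * clamp (- b) b x) s - d2 (th * clamp (- b) b x) s) * mode b n x) (- b) b)).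
Proof.
intros hb Hth Hs Hr.
set (c x := th * clamp (- b) b x).
assert (Hc : forall x, - b < c x < b).
{ intros x; apply scaled_interior; [exact hb|exact Hth|apply clamp_bounds; lra]. }
assert (Cc : forall x, continuous c x) by (intros; apply scaled_clamp_continuous).
assert (Hcid : forall x, Rmin (- b) b < x < Rmax (- b) b -> c x = th * x).
{ intros x Hx; rewrite Rmin_left, Rmax_right in Hx by lra; unfold c; rewrite clamp_id by lra; reflexivity. }
assert (Cd : forall (f : R -> R -> R) (r : R), (forall x, - b < x < b -> continuity_2d_pt f x r) ->
  forall x, continuous (fun x => f (c x) r) x).
{ intros f r Hf x; apply (continuous_2d_comp f c (fun _ => r)); [now apply Hf|apply Cc|apply continuous_const]. }
assert (Et : ex_RInt (fun x => dt (c x) s * mode b n x) (- b) b).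
{ apply ex_RInt_cont, continuous_mult_mode, Cd; intros x Hx; now apply Hr. }
assert (E2 : ex_RInt (fun x => d2 (c x) s * mode b n x) (- b) b).
{ apply ex_RInt_cont, continuous_mult_mode, Cd; intros x Hx; now apply Hr. }
assert (H1 : is_derive (fun s => RInt (fun x => d (c x) s * mode b n x) (- b) b) s
  (RInt (fun x => dt (c x) s * mode b n x) (- b) b)).
{ assert (Dd : forall r x, 0 < r -> is_derive (fun r => d (c x) r * mode b n x) r (dt (c x) r * mode b n x)).
  { intros r x Hr0; apply (is_derive_ext (fun r => mode b n x * d (c x) r)); [intros; apply Rmult_comm|].
    rewrite Rmult_comm; apply is_derive_scal, Hr; auto. }
  rewrite (RInt_eq _ (fun x => Derive (fun r => d (c x) r * mode b n x) s))
    by (intros x; symmetry; apply is_derive_unique; now apply Dd).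
  apply (is_derive_RInt_param (fun r x => d (c x) r * mode b n x)).
  - exists (mkposreal s Hs); intros r Hrs x _; change (Rabs (r - s) < s) in Hrs.
    eexists; apply Dd; split_Rabs; lra.
  - intros x _.
    apply (continuity_2d_pt_ext_loc (fun r x => dt (c x) r * mode b n x)).
    + exists (mkposreal s Hs); simpl; intros r y Hrs _.
      symmetry; apply is_derive_unique, Dd; split_Rabs; lra.
    + apply continuity_2d_pt_mult.
      * assert (C : continuity_2d_pt (fun y r => dt (c y) r) x s).
        { apply (continuity_2d_pt_comp dt c (fun r => r)); [now apply Hr|apply Cc|apply continuous_id]. }
        intros eps; destruct (C eps) as [del Hdel]; exists del; auto.
      * apply (cont2_snd_only (mode b n)), mode_continuous.
  - exists (mkposreal s Hs); intros r Hrs; change (Rabs (r - s) < s) in Hrs.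
    apply ex_RInt_cont, continuous_mult_mode; intros x.
    apply (continuous_comp c (fun y => d y r)); [apply Cc|].
    apply ex_derive_continuousR.
    exists (d1 (c x) r); apply Hr; [apply Hc|split_Rabs; lra]. }
assert (HP : forall r, RInt (fun x => d (c x) r * mode b n x) (- b) b =
   RInt (fun x => d (th * x) r * mode b n x) (- b) b).
{ intros r; apply RInt_ext; intros x Hx; now rewrite Hcid. }
apply (is_derive_ext (fun s => RInt (fun x => d (c x) s * mode b n x) (- b) b)); [exact HP|].
match goal with |- is_derive _ _ ?l =>
  replace l with (RInt (fun x => dt (c x) s * mode b n x) (- b) b); [exact H1|] end.
(* The second derivative of the dilated profile is [th ^ 2] times [d_xx], so the mode decays at the
   rate [eig b n / th ^ 2]; the values at the two ends survive as boundary terms. *)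
assert (H2 := mode_by_parts b n (fun x => d (th * x) s) (fun x => th * d1 (th * x) s)
  (fun x => th * (th * d2 (th * x) s)) hb).
assert (Dlin : forall x, is_derive (fun x => th * x) x th) by (intros; auto_derive; [exact I|ring]).
assert (H3 : RInt (fun x => th * (th * d2 (th * x) s) * mode b n x) (- b) b =
  - (d (th * b) s * dmode b n b - d (th * - b) s * dmode b n (- b))
  - eig b n * RInt (fun x => d (th * x) s * mode b n x) (- b) b).
{ apply H2; intros x Hx; pose proof (scaled_interior b th x hb Hth Hx) as Hi.
  - apply (is_derive_comp (fun y => d y s) (fun x => th * x)); [now apply Hr|apply Dlin].
  - apply is_derive_scal.
    apply (is_derive_comp (fun y => d1 y s) (fun x => th * x)); [now apply Hr|apply Dlin].
  - apply continuous_multR; [apply continuous_const|].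
    apply continuous_multR; [apply continuous_const|].
    apply (continuous_2d_comp d2 (fun x => th * x) (fun _ => s)); [now apply Hr| |apply continuous_const].
    apply ex_derive_continuousR; eexists; apply Dlin. }
rewrite (RInt_ext _ (fun x => th ^ 2 * (d2 (c x) s * mode b n x))) in H3
  by (intros x Hx; rewrite (Hcid x Hx); simpl; ring).
rewrite RInt_scalR in H3 by exact E2.
rewrite (RInt_eq (fun x => (dt (c x) s - d2 (c x) s) * mode b n x)
  (fun x => 1 * (dt (c x) s * mode b n x) + -1 * (d2 (c x) s * mode b n x))) by (intros; ring).
rewrite RInt_lin by assumption.
replace (th * - b) with (- (th * b)) in H3 by ring.
assert (Halg : forall I0 I2 It bd mu : R, th ^ 2 * I2 = - bd - mu * I0 ->
  It = - (mu / th ^ 2) * I0 + (- bd / th ^ 2 + (1 * It + -1 * I2))).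
{ intros I0 I2 It bd mu HA.
  replace I2 with ((- bd - mu * I0) / th ^ 2) by (rewrite <- HA; field; lra); field; lra. }
apply Halg, H3.
Qed.

(** The boundary values, at most [eta], enter with the weight [dmode], of order [n + 1]. This is
    harmless since [n] is fixed while [eta] tends to zero as [th] tends to 1. The condition on
    [th ^ 2] bounds [1 / th ^ 2] by 2, turning the boundary contribution [2 k eta] into
    [4 k eta]. *)
Lemma scaled_coef_bound (b th eta B g t1 t : R) (n : nat) (d phi : R -> R -> R) :
  0 < b -> / 2 <= th ^ 2 -> 0 < th < 1 -> 0 < t1 <= t -> 0 <= g -> 0 <= B -> heat b d phi ->
  (forall s, t1 <= s <= t -> Rabs (d (th * b) s) <= eta /\ Rabs (d (- (th * b)) s) <= eta) ->
  (forall x s, - b < x < b -> 0 < s <= t -> Rabs (phi x s) <= B * exp (g * s)) ->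
  Rabs (RInt (fun x => d (th * x) t * mode b n x) (- b) b) <=
  Rabs (RInt (fun x => d (th * x) t1 * mode b n x) (- b) b)
  + (4 * ((INR n + 1) * freq b) * eta + 2 * b * B) * exp (g * t) / (eig b n + g).
Proof.
intros hb Hth2 Hth Ht Hg HB (d1 & d2 & dt & Hr & He) Hbd Hphi.
pose proof (eig_pos b n hb) as Hmu.
set (k := (INR n + 1) * freq b).
assert (Hk : 0 < k) by (apply Rmult_lt_0_compat; [pose proof (pos_INR n); lra|now apply freq_pos]).
assert (Heta : 0 <= eta).
{ eapply Rle_trans; [apply Rabs_pos|apply (Hbd t); lra]. }
assert (Hi2 : 0 < / th ^ 2 <= 2).
{ split; [apply Rinv_0_lt_compat, pow_lt; lra|].
  rewrite <- (Rinv_inv 2); apply Rinv_le_contravar; lra. }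
assert (Hi1 : 1 <= / th ^ 2) by (rewrite <- Rinv_1 at 1; apply Rinv_le_contravar; nra).
set (a := eig b n / th ^ 2).
assert (Ha : eig b n <= a) by (unfold a, Rdiv; nra).
set (p s := RInt (fun x => d (th * x) s * mode b n x) (- b) b).
set (r s := - (d (th * b) s * dmode b n b - d (- (th * b)) s * dmode b n (- b)) / th ^ 2
  + RInt (fun x => (dt (th * clamp (- b) b x) s - d2 (th * clamp (- b) b x) s) * mode b n x) (- b) b).
assert (Hrs : forall s, t1 <= s <= t -> Rabs (r s) <= (4 * k * eta + 2 * b * B) * exp (g * s)).
{ intros s Hs.
  assert (Hexp : 1 <= exp (g * s)).
  { rewrite <- exp_0; destruct (Req_dec g 0) as [->|Hg0]; [rewrite Rmult_0_l; lra|].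
    apply Rlt_le, exp_increasing; apply Rmult_lt_0_compat; lra. }
  destruct (Hbd s Hs) as [Hb1 Hb2].
  pose proof (dmode_abs_le b n b hb) as Hm1; pose proof (dmode_abs_le b n (- b) hb) as Hm2; fold k in Hm1, Hm2.
  unfold r; eapply Rle_trans; [apply Rabs_triang|].
  rewrite Rmult_plus_distr_r; apply Rplus_le_compat.
  - unfold Rdiv; rewrite Rabs_mult, Rabs_Ropp, (Rabs_pos_eq (/ th ^ 2)) by lra.
    assert (HX : Rabs (d (th * b) s * dmode b n b - d (- (th * b)) s * dmode b n (- b)) <= 2 * k * eta).
    { eapply Rle_trans; [apply Rabs_triang|]; rewrite Rabs_Ropp, !Rabs_mult.
      assert (Rabs (d (th * b) s) * Rabs (dmode b n b) <= eta * k)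
        by (apply Rmult_le_compat; auto using Rabs_pos).
      assert (Rabs (d (- (th * b)) s) * Rabs (dmode b n (- b)) <= eta * k)
        by (apply Rmult_le_compat; auto using Rabs_pos).
      lra. }
    assert (H0 : 0 <= k * eta) by (apply Rmult_le_pos; lra).
    apply Rle_trans with (2 * k * eta * 2).
    + apply Rmult_le_compat; [apply Rabs_pos|lra|exact HX|lra].
    + nra.
  - replace (2 * b * B * exp (g * s)) with ((b - - b) * (B * exp (g * s))) by ring.
    apply abs_RInt_le_const; [lra| |].
    + apply ex_RInt_cont, continuous_mult_mode; intros x.
      assert (Hc : - b < th * clamp (- b) b x < b).
      { apply scaled_interior; [exact hb|exact Hth|apply clamp_bounds; lra]. }
      apply continuous_minusR.
      * apply (continuous_2d_comp dt (fun x => th * clamp (- b) b x) (fun _ => s));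
          [apply Hr; [exact Hc|lra]|apply scaled_clamp_continuous|apply continuous_const].
      * apply (continuous_2d_comp d2 (fun x => th * clamp (- b) b x) (fun _ => s));
          [apply Hr; [exact Hc|lra]|apply scaled_clamp_continuous|apply continuous_const].
    + intros x Hx.
      assert (Hc : - b < th * clamp (- b) b x < b).
      { apply scaled_interior; [exact hb|exact Hth|apply clamp_bounds; lra]. }
      rewrite (He _ s Hc ltac:(lra)).
      replace (d2 (th * clamp (- b) b x) s + phi (th * clamp (- b) b x) s - d2 (th * clamp (- b) b x) s)
        with (phi (th * clamp (- b) b x) s) by ring.
      rewrite Rabs_mult; pose proof (Hphi _ s Hc ltac:(lra)) as Hp; pose proof (mode_abs_le b n x).
      pose proof (Rabs_pos (phi (th * clamp (- b) b x) s)); pose proof (Rabs_pos (mode b n x)).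
      nra. }
pose proof (ode_bound p r a g (4 * k * eta + 2 * b * B) t1 t) as H.
assert (H' : Rabs (p t) <= exp (- a * (t - t1)) * Rabs (p t1)
   + (4 * k * eta + 2 * b * B) * exp (g * t) / (a + g)).
{ apply H; try lra; [|exact Hrs].
  intros s Hs; apply (scaled_coef_derive b th s n d d1 d2 dt); trivial; lra. }
assert (He1 : exp (- a * (t - t1)) <= 1).
{ rewrite <- exp_0; destruct (Req_dec t t1) as [->|Hne]; [rewrite Rminus_diag, Rmult_0_r; lra|].
  apply Rlt_le, exp_increasing; nra. }
fold (p t) (p t1).
eapply Rle_trans; [exact H'|]; apply Rplus_le_compat.
- pose proof (Rabs_pos (p t1)); nra.
- assert (0 <= k * eta) by (apply Rmult_le_pos; lra).
  assert (0 <= b * B) by (apply Rmult_le_pos; lra).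
  apply Rmult_le_compat_l; [apply Rmult_le_pos; [lra|apply Rlt_le, exp_pos]|].
  apply Rinv_le_contravar; lra.
Qed.

(* Letting [th -> 1]. *)
Lemma coef_bound (b B g t1 t : R) (n : nat) (d phi : R -> R -> R) :
  0 < b -> 0 < t1 <= t -> 0 <= g -> 0 <= B -> heat b d phi ->
  cont2 (fun x s => d x (Rmax t1 s)) ->
  (forall s, 0 < s -> d (- b) s = 0 /\ d b s = 0) ->
  (forall x s, - b < x < b -> 0 < s <= t -> Rabs (phi x s) <= B * exp (g * s)) ->
  Rabs (RInt (fun x => d x t * mode b n x) (- b) b) <=
  Rabs (RInt (fun x => d x t1 * mode b n x) (- b) b) + 2 * b * B * exp (g * t) / (eig b n + g).
Proof.
intros hb Ht Hg HB Hd Cd Hbd Hphi.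
pose proof (eig_pos b n hb) as Hmu.
set (k := (INR n + 1) * freq b).
assert (Hk : 0 < k) by (apply Rmult_lt_0_compat; [pose proof (pos_INR n); lra|now apply freq_pos]).
set (P th s := RInt (fun x => d (th * x) s * mode b n x) (- b) b).
assert (CP : forall s, t1 <= s -> continuous (fun th => P th s) 1).
{ intros s Hs; unfold P.
  apply (cont2_RInt (fun x th => d (th * x) s * mode b n x)); [lra|].
  intros x th; apply continuity_2d_pt_mult; [|apply (cont2_fst_only (mode b n)), mode_continuous].
  refine (continuity_1d_2d_pt_comp (fun y => d y s) (fun x th => th * x) x th _ _).
  - apply continuity_pt_filterlim; change (continuous (fun y => d y s) (th * x)).
    apply (continuous_ext (fun y => d y (Rmax t1 s))); [intros y; now rewrite Rmax_right|].
    apply (cont2_fst (fun x s => d x (Rmax t1 s)) s), Cd.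
  - apply continuity_2d_pt_mult; [apply continuity_2d_pt_id2|apply continuity_2d_pt_id1]. }
assert (P1 : forall s, P 1 s = RInt (fun x => d x s * mode b n x) (- b) b).
{ intros s; apply RInt_eq; intros x; now rewrite Rmult_1_l. }
rewrite <- !P1.
set (M := exp (g * t) / (eig b n + g)).
assert (HM : 0 < M) by (apply Rdiv_lt_0_compat; [apply exp_pos|lra]).
apply Rnot_lt_le; intros Hlt.
set (gap := Rabs (P 1 t) - (Rabs (P 1 t1) + 2 * b * B * exp (g * t) / (eig b n + g))).
assert (Hgap : 0 < gap) by (unfold gap; lra).
(* Three errors have to stay below [gap] together: replacing [th] by 1 at time [t], the same at time
   [t1], and the boundary term [4 k eps M]. Each is at most a quarter of it. *)
set (eps := Rmin (gap / 4) (gap / (16 * k * M))).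
assert (Heps : 0 < eps).
{ apply Rmin_glb_lt; [lra|apply Rdiv_lt_0_compat; [lra|]].
  apply Rmult_lt_0_compat; [lra|exact HM]. }
assert (Heps1 : eps <= gap / 4) by apply Rmin_l.
assert (Heps2 : 4 * k * eps * M <= gap / 4).
{ replace (gap / 4) with (4 * k * (gap / (16 * k * M)) * M) by (field; lra).
  apply Rmult_le_compat_r; [lra|apply Rmult_le_compat_l; [lra|apply Rmin_r]]. }
(* At [th = 1] the boundary values vanish, and compactness of [[t1, t]] makes the smallness nearby
   uniform in time; [sg] selects the endpoint. *)
assert (Cbd : forall sg, sg = 1 \/ sg = -1 -> exists del : posreal, forall th, Rabs (th - 1) < del ->
  forall s, t1 <= s <= t -> Rabs (d (sg * (th * b)) s) <= eps).
{ intros sg Hsg.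
  assert (C : cont2 (fun s th => d (sg * (th * b)) (Rmax t1 s))).
  { intros s th.
    assert (C1 : cont2 (fun th s => d (sg * (th * b)) (Rmax t1 s))).
    { apply (cont2_comp (fun x s => d x (Rmax t1 s)) (fun th => sg * (th * b)) (fun s => s) Cd).
      - intros y; apply ex_derive_continuousR; auto_derive; exact I.
      - intros; apply continuous_id. }
    intros e; destruct (C1 th s e) as [del Hdel]; exists del; auto. }
  destruct (cont2_unif_snd _ t1 t 1 (mkposreal eps Heps) C) as [del Hdel]; exists del.
  intros th Hth s Hs; specialize (Hdel th Hth s Hs); simpl in Hdel.
  rewrite Rmax_right in Hdel by lra.
  destruct (Hbd s ltac:(lra)) as [Z1 Z2].
  replace (d (sg * (1 * b)) s) with 0 in Hdel.
  - rewrite Rminus_0_r in Hdel; lra.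
  - destruct Hsg; subst sg; [rewrite !Rmult_1_l; now symmetry|].
    replace (-1 * (1 * b)) with (- b) by ring; now symmetry. }
destruct (Cbd 1 ltac:(lra)) as [e1 He1]; destruct (Cbd (-1) ltac:(lra)) as [e2 He2].
assert (CPe : forall s, t1 <= s -> exists del : posreal, forall th, Rabs (th - 1) < del ->
  Rabs (P th s - P 1 s) < eps).
{ intros s Hs; destruct (proj1 (filterlim_locally (fun th => P th s) (P 1 s)) (CP s Hs) (mkposreal eps Heps))
    as [del Hdel]; exists del; exact Hdel. }
destruct (CPe t ltac:(lra)) as [e3 He3]; destruct (CPe t1 ltac:(lra)) as [e4 He4].
(* The bound [1/4] ensures [th >= 7/8], hence [th ^ 2 >= 1/2]. *)
set (del := Rmin (Rmin (Rmin e1 e2) (Rmin e3 e4)) (1 / 4)).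
pose proof (cond_pos e1); pose proof (cond_pos e2); pose proof (cond_pos e3); pose proof (cond_pos e4).
assert (Hdel : 0 < del) by (repeat apply Rmin_glb_lt; lra).
assert (Hdele : del <= e1 /\ del <= e2 /\ del <= e3 /\ del <= e4 /\ del <= 1 / 4).
{ unfold del; repeat split; unfold Rmin; repeat destruct (Rle_dec _ _); lra. }
set (th := 1 - del / 2).
assert (Hth : Rabs (th - 1) < del) by (unfold th; rewrite Rabs_left; lra).
assert (Q3 : Rabs (P th t - P 1 t) < eps) by (apply He3; lra).
assert (Q4 : Rabs (P th t1 - P 1 t1) < eps) by (apply He4; lra).
assert (Q : Rabs (P th t) <= Rabs (P th t1) + (4 * k * eps + 2 * b * B) * exp (g * t) / (eig b n + g)).
{ apply (scaled_coef_bound b th eps B g t1 t n d phi); trivial.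
  - unfold th; nra.
  - unfold th; lra.
  - intros s Hs; split.
    + rewrite <- (Rmult_1_l (th * b)); apply He1; [lra|exact Hs].
    + replace (- (th * b)) with (-1 * (th * b)) by ring; apply He2; [lra|exact Hs]. }
assert (QE : (4 * k * eps + 2 * b * B) * exp (g * t) / (eig b n + g) =
  4 * k * eps * M + 2 * b * B * exp (g * t) / (eig b n + g)) by (unfold M; field; lra).
rewrite QE in Q; unfold gap in *.
split_Rabs; lra.
Qed.

(** With the weight [g = (freq b * m) ^ 2], each coefficient is at most a constant over
    [(n + 1)^2 + m^2], so their sum is at most a constant over [m]. Letting [t1] tend to zero along
    the [L^1] hypothesis removes the initial term. *)
Lemma heat_smoothing (b B m t : R) (d phi : R -> R -> R) (x : R) :
  0 < b -> 0 < t -> 1 <= m -> 0 <= B -> heat b d phi ->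
  (forall t1, 0 < t1 -> cont2 (fun x s => d x (Rmax t1 s))) ->
  (forall s, 0 < s -> d (- b) s = 0 /\ d b s = 0) ->
  (forall eps, 0 < eps -> exists t1, 0 < t1 < t /\ RInt (fun x => Rabs (d x t1)) (- b) b <= eps) ->
  (forall x s, - b < x < b -> 0 < s <= t -> Rabs (phi x s) <= B * exp ((freq b * m) ^ 2 * s)) ->
  - b <= x <= b ->
  Rabs (d x t) <= 4 * B / (freq b ^ 2 * m) * exp ((freq b * m) ^ 2 * t).
Proof.
intros hb Ht Hm HB Hd Cd Hbd Hini Hphi Hx.
pose proof (freq_pos b hb) as Hw.
set (g := (freq b * m) ^ 2) in *.
assert (Hg : 0 < g) by (apply pow_lt; nra).
assert (Cs : forall s, 0 < s -> forall y, continuous (fun y => d y s) y).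
{ intros s Hs y; apply (continuous_ext (fun y => d y (Rmax s s))); [intros z; now rewrite Rmax_left by lra|].
  apply (cont2_fst (fun x r => d x (Rmax s r)) s); now apply Cd. }
set (K := 2 * B * exp (g * t)).
assert (HK : 0 <= K) by (apply Rmult_le_pos; [lra|apply Rlt_le, exp_pos]).
assert (Hc : forall n, Rabs (coef b (fun y => d y t) n) <= K / freq b ^ 2 * / ((INR n + 1) ^ 2 + m ^ 2)).
{ intros n; pose proof (eig_pos b n hb) as Hmu.
  assert (HI : Rabs (RInt (fun y => d y t * mode b n y) (- b) b) <= 2 * b * B * exp (g * t) / (eig b n + g)).
  (* Otherwise the [L^1] norm at a suitable [t1] would be at most half the excess [X - Y], while
     [coef_bound] requires it to cover the whole excess. *)
  { apply Rnot_lt_le; intros Hlt.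
    set (X := Rabs (RInt (fun y => d y t * mode b n y) (- b) b)) in *.
    set (Y := 2 * b * B * exp (g * t) / (eig b n + g)) in *.
    assert (He : 0 < (X - Y) / 2) by lra.
    destruct (Hini _ He) as (t1 & Ht1 & Hi).
    pose proof (coef_bound b B g t1 t n d phi hb ltac:(lra) ltac:(lra) HB Hd (Cd t1 ltac:(lra)) Hbd Hphi) as HX.
    fold X Y in HX.
    assert (H1 : Rabs (RInt (fun y => d y t1 * mode b n y) (- b) b) <= RInt (fun y => Rabs (d y t1)) (- b) b).
    { assert (Ca : forall y, continuous (fun y => Rabs (d y t1 * mode b n y)) y).
      { intros y; apply (continuous_comp (fun y => d y t1 * mode b n y) Rabs); [|apply continuous_Rabs].
        apply continuous_mult_mode, Cs; lra. }
      eapply Rle_trans; [apply abs_RInt_le; [lra|apply ex_RInt_cont, continuous_mult_mode, Cs; lra]|].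
      apply RInt_le; [lra|now apply ex_RInt_cont| |].
      - apply ex_RInt_cont; intros y; apply (continuous_comp (fun y => d y t1) Rabs);
          [apply Cs; lra|apply continuous_Rabs].
      - intros y Hy; rewrite Rabs_mult; pose proof (mode_abs_le b n y).
        pose proof (Rabs_pos (d y t1)); pose proof (Rabs_pos (mode b n y)); nra. }
    lra. }
  unfold coef; rewrite Rabs_div, (Rabs_pos_eq b) by lra.
  apply (Rmult_le_reg_r b); [exact hb|].
  replace (Rabs (RInt (fun x => d x t * mode b n x) (- b) b) / b * b) with
    (Rabs (RInt (fun x => d x t * mode b n x) (- b) b)) by (field; lra).
  eapply Rle_trans; [exact HI|right].
  replace (eig b n + g) with (freq b ^ 2 * ((INR n + 1) ^ 2 + m ^ 2)) by (unfold eig, g; ring).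
  assert (Hq : 0 < (INR n + 1) ^ 2 + m ^ 2) by (pose proof (pos_INR n); nra).
  set (q := (INR n + 1) ^ 2 + m ^ 2) in *; unfold K; field; lra. }
destruct (Series_inv_sq_shift m Hm) as [ES HS].
assert (EK : ex_series (fun n => K / freq b ^ 2 * / ((INR n + 1) ^ 2 + m ^ 2)))
  by (apply (ex_series_scal (V := R_NormedModule)), ES).
assert (Hfin : Series (fun n => K / freq b ^ 2 * / ((INR n + 1) ^ 2 + m ^ 2))
   <= 4 * B / (freq b ^ 2 * m) * exp (g * t)).
{ rewrite Series_scal_l.
  replace (4 * B / (freq b ^ 2 * m) * exp (g * t)) with (K / freq b ^ 2 * (2 / m)) by (unfold K; field; lra).
  apply Rmult_le_compat_l; [|exact HS].
  apply Rmult_le_pos; [exact HK|apply Rlt_le, Rinv_0_lt_compat, pow_lt, Hw]. }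
assert (Hpos : 0 <= 4 * B / (freq b ^ 2 * m) * exp (g * t)).
{ apply Rmult_le_pos; [|apply Rlt_le, exp_pos].
  apply Rmult_le_pos; [lra|apply Rlt_le, Rinv_0_lt_compat; apply Rmult_lt_0_compat; [now apply pow_lt|lra]]. }
destruct (Hbd t Ht) as [Z1 Z2].
destruct (Req_dec x (- b)) as [->|Hl]; [rewrite Z1, Rabs_R0; exact Hpos|].
destruct (Req_dec x b) as [->|Hr]; [rewrite Z2, Rabs_R0; exact Hpos|].
rewrite (mode_expansion b (fun y => d y t) (coef b (fun y => d y t)) hb); try (lra || reflexivity).
- eapply Rle_trans; [|exact Hfin]; apply Series_abs_le; [exact EK|].
  intros n; rewrite Rabs_mult; pose proof (Hc n); pose proof (mode_abs_le b n x).
  pose proof (Rabs_pos (coef b (fun y => d y t) n)); pose proof (Rabs_pos (mode b n x)); nra.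
- intros y; now apply Cs.
- apply (ex_series_dominated _ _ EK); intros n; rewrite Rabs_Rabsolu; apply Hc.
Qed.

(** Values of a solution outside the closed interval are arbitrary; this replaces them by the
    boundary values. Time is left alone, since continuity is known only for [t > 0]. *)
Definition clamp_ext (b : R) (u : R -> R -> R) (x t : R) : R := u (clamp (- b) b x) t.

Lemma global_solution_heat (b chi lam : R) (u0 : R -> R) (u : R -> R -> R) : 0 < b ->
  global_solution b chi lam u0 u ->
  heat b (clamp_ext b u) (fun x t => reaction b chi lam (fun y => u y t) x).
Proof.
intros hb (HC & _ & _ & He & _).
apply (heat_ext b u _ (fun x t => reaction b chi lam (fun y => u y t) x)); [|reflexivity|].
- intros x t Hx _; unfold clamp_ext; now rewrite clamp_id.
- exists (fun x t => Derive_n (fun y => u y t) 1 x), (fun x t => Derive_n (fun y => u y t) 2 x),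
    (fun x t => Derive (fun s => u x s) t); split.
  + intros x t Hx Ht; destruct (HC x t) as (H1 & H2 & H3); [now repeat split|].
    destruct (H1 1%nat ltac:(lia)) as [E1 C1]; destruct (H1 2%nat ltac:(lia)) as [E2 C2].
    split; [split; [|split]|split; [|split]].
    * apply Derive_correct, E1.
    * apply (Derive_correct (Derive_n (fun y => u y t) 1)), E2.
    * apply Derive_correct, H2.
    * apply continuity_2d_pt_filterlim, C1.
    * apply continuity_2d_pt_filterlim, C2.
    * apply continuity_2d_pt_filterlim, H3.
  + intros x t Hx Ht; apply He; [exact Hx|now split].
Qed.

(** Nothing pointwise is known as [t] tends to 0, so time is cut off at a positive [t1]. The clamped
    map [G] sends the plane into the domain, where the relative continuity of the definition
    applies. *)
Lemma global_solution_cont2 (b chi lam : R) (u0 : R -> R) (u : R -> R -> R) (t1 : R) : 0 < b -> 0 < t1 ->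
  global_solution b chi lam u0 u -> cont2 (fun x s => clamp_ext b u x (Rmax t1 s)).
Proof.
intros hb Ht1 (_ & Cu & _) x s; apply continuity_2d_pt_filterlim.
set (G (p : R * R) := (clamp (- b) b (fst p), Rmax t1 (snd p))).
assert (HG : forall p, Omega_bar b (fst (G p)) /\ time p_infty (snd (G p))).
{ intros p; split; [apply clamp_bounds; lra|].
  split; [|exact I]; simpl; pose proof (Rmax_l t1 (snd p)); lra. }
apply (filterlim_comp _ _ _ G (fun p : R * R => u (fst p) (snd p)) _ _ _) with
  (2 := Cu (G (x, s)) (HG (x, s))).
intros P HP.
assert (CG : filterlim G (locally (x, s)) (locally (G (x, s)))).
{ apply filterlim_locally; intros eps; exists eps; intros [y r] [Hy Hr]; split; simpl.
  - change (Rabs (y - x) < eps) in Hy; change (Rabs (clamp (- b) b y - clamp (- b) b x) < eps).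
    pose proof (clamp_lipschitz (- b) b x y); lra.
  - change (Rabs (r - s) < eps) in Hr; change (Rabs (Rmax t1 r - Rmax t1 s) < eps).
    unfold Rmax; destruct (Rle_dec t1 r); destruct (Rle_dec t1 s); split_Rabs; lra. }
apply (filter_imp (F := locally (x, s)) _ _) with (2 := CG _ HP).
intros p Hp; apply Hp, HG.
Qed.

Lemma global_solution_bound (b chi lam : R) (u0 : R -> R) (u : R -> R -> R) (T : R) : 0 < b -> 0 < T ->
  global_solution b chi lam u0 u ->
  exists sg, 0 <= sg < 1 /\ forall x t, - b <= x <= b -> 0 < t <= T -> 0 <= u x t <= sg.
Proof.
intros hb HT (_ & _ & H01 & _ & Hbd & Hsup & _).
specialize (Hsup T (conj HT I)).
destruct (Lub_Rbar_correct (fun z => exists x t, Omega_bar b x /\ 0 < t <= T /\ z = u x t)) as [Hub _].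
destruct (Lub_Rbar _) as [sg| |]; simpl in Hsup; try contradiction.
- exists sg; assert (Hle : forall x t, - b <= x <= b -> 0 < t <= T -> u x t <= sg).
  { intros x t Hx Ht; apply (Hub (u x t)); now exists x, t. }
  split.
  + split; [|exact Hsup].
    rewrite <- (Hbd b T); [apply Hle; lra|now right|now split].
  + intros x t Hx Ht; split; [|now apply Hle].
    destruct (Req_dec x (- b)) as [->|Hl]; [right; symmetry; apply Hbd; [now left|now split]|].
    destruct (Req_dec x b) as [->|Hr]; [right; symmetry; apply Hbd; [now right|now split]|].
    apply H01; [unfold Omega; lra|now split].
(* The supremum cannot be minus infinity, since the set contains [u b T]. *)
- exfalso; apply (Hub (u b T)); exists b, T; repeat split; unfold Omega_bar; lra.
Qed.

Lemma global_solution_initial (b chi lam : R) (u : R -> R -> R) (eps : R) : 0 < b -> 0 < eps ->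
  global_solution b chi lam (fun _ => 0) u -> exists del, 0 < del /\
    forall t, 0 < t < del -> RInt (fun x => Rabs (clamp_ext b u x t)) (- b) b <= eps.
Proof.
intros hb Heps (_ & _ & _ & _ & _ & _ & _ & Hini).
destruct (proj1 (filterlim_locally _ _) Hini (mkposreal eps Heps)) as [del Hdel].
exists del; split; [apply cond_pos|]; intros t Ht.
assert (H : Rabs (RInt (fun x => Rabs (u x t - 0)) (- b) b - 0) < eps).
{ apply (Hdel t); [change (Rabs (t - 0) < del); rewrite Rabs_pos_eq; lra|lra]. }
rewrite (RInt_ext _ (fun x => Rabs (u x t - 0))); [split_Rabs; lra|].
intros x Hx; rewrite Rmin_left, Rmax_right in Hx by lra.
unfold clamp_ext; rewrite clamp_id, Rminus_0_r by lra; reflexivity.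
Qed.

Lemma clamp_ext_continuous (b chi lam : R) (u0 : R -> R) (u : R -> R -> R) (t x : R) : 0 < b -> 0 < t ->
  global_solution b chi lam u0 u -> continuous (fun y => clamp_ext b u y t) x.
Proof.
intros hb Ht Hu; apply (continuous_ext (fun y => clamp_ext b u y (Rmax t t))).
- intros y; now rewrite Rmax_left by lra.
- apply (cont2_fst (fun x s => clamp_ext b u x (Rmax t s)) t), (global_solution_cont2 b chi lam u0); trivial.
Qed.

(** On [[0, sg]] the function [1 / (1 - s)] is at most [1 / (1 - sg)] and has Lipschitz constant
    [1 / (1 - sg)^2]; the constant combines these with [nonlocal_lip]. *)
Lemma reaction_lipschitz (b chi lam sg E : R) (u0 : R -> R) (u w : R -> R -> R) (x t : R) :
  0 < b -> 0 < chi -> 0 < lam -> 0 < t -> 0 <= sg < 1 ->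
  global_solution b chi lam u0 u -> global_solution b chi lam u0 w ->
  (forall y, - b <= y <= b -> 0 <= u y t <= sg) -> (forall y, - b <= y <= b -> 0 <= w y t <= sg) ->
  (forall y, - b <= y <= b -> Rabs (u y t - w y t) <= E) -> - b < x < b ->
  Rabs (reaction b chi lam (fun y => u y t) x - reaction b chi lam (fun y => w y t) x)
  <= nonlocal_lip b chi lam (/ (1 - sg)) * (/ (1 - sg)) ^ 2 * E.
Proof.
intros hb hchi hlam Ht Hsg Hu Hw Bu Bw HE Hx.
assert (Gen : forall v, global_solution b chi lam u0 v -> (forall y, - b <= y <= b -> 0 <= v y t <= sg) ->
  (forall y, continuous (fun y => / (1 - clamp_ext b v y t)) y) /\
  (forall y, - b <= y <= b -> 1 <= / (1 - clamp_ext b v y t) <= / (1 - sg)) /\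
  reaction b chi lam (fun y => v y t) x = nonlocal b chi lam (fun y => / (1 - clamp_ext b v y t)) x).
{ intros v Hv Bv.
  assert (Bc : forall y, 0 <= clamp_ext b v y t <= sg) by (intros y; apply Bv, clamp_bounds; lra).
  assert (Cc : forall y, continuous (fun y => / (1 - clamp_ext b v y t)) y).
  { intros y; apply continuity_pt_filterlim, (continuity_pt_inv (fun y => 1 - clamp_ext b v y t)).
    - apply continuity_pt_filterlim; change (continuous (fun y => 1 - clamp_ext b v y t) y).
      apply continuous_minusR; [apply continuous_const|].
      now apply (clamp_ext_continuous b chi lam u0).
    - pose proof (Bc y); lra. }
  assert (Hb1 : forall y, - b <= y <= b -> 1 <= / (1 - clamp_ext b v y t) <= / (1 - sg)).
  { intros y _; specialize (Bc y); set (c := clamp_ext b v y t) in *; clearbody c.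
    split; [rewrite <- Rinv_1|]; apply Rinv_le_contravar; lra. }
  split; [exact Cc|split; [exact Hb1|]].
  apply reaction_nonlocal; trivial.
  - intros y Hy; unfold clamp_ext; rewrite clamp_id by exact Hy; pose proof (Bv y Hy).
    split; [unfold Rdiv; ring|lra].
  - pose proof (RInt_ge_len b _ hb Cc (fun y Hy => proj1 (Hb1 y Hy))) as HI.
    apply Rgt_not_eq, Rplus_lt_le_0_compat; [lra|apply Rmult_le_pos; [lra|]].
    eapply Rle_trans; [|exact HI]; lra. }
destruct (Gen u Hu Bu) as (C1 & B1 & ->); destruct (Gen w Hw Bw) as (C2 & B2 & ->).
rewrite Rmult_assoc; apply nonlocal_lipschitz; trivial; try lra.
intros y Hy; pose proof (Bu y Hy); pose proof (Bw y Hy); pose proof (HE y Hy) as Hd.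
unfold clamp_ext; rewrite clamp_id by exact Hy.
eapply Rle_trans; [apply (inv_lipschitz _ _ (1 - sg)); lra|].
rewrite pow_inv; apply Rmult_le_compat_l; [apply Rlt_le, Rinv_0_lt_compat, pow_lt; lra|].
replace (1 - u y t - (1 - w y t)) with (- (u y t - w y t)) by ring; now rewrite Rabs_Ropp.
Qed.

Lemma global_uniqueness (b chi lam : R) (u w : R -> R -> R) (x t : R) : 0 < b -> 0 < chi -> 0 < lam ->
  global_solution b chi lam (fun _ => 0) u -> global_solution b chi lam (fun _ => 0) w ->
  - b <= x <= b -> 0 < t -> w x t = u x t.
Proof.
intros hb hchi hlam Hu Hw Hx Ht.
destruct (global_solution_bound b chi lam _ u t hb Ht Hu) as (s1 & Hs1 & Bu).
destruct (global_solution_bound b chi lam _ w t hb Ht Hw) as (s2 & Hs2 & Bw).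
set (sg := Rmax s1 s2).
assert (Hsg : 0 <= sg < 1) by (unfold sg, Rmax; destruct (Rle_dec s1 s2); lra).
pose proof (Rmax_l s1 s2) as Hm1; pose proof (Rmax_r s1 s2) as Hm2; fold sg in Hm1, Hm2.
set (L := nonlocal_lip b chi lam (/ (1 - sg)) * (/ (1 - sg)) ^ 2).
assert (HL : 0 < L).
{ assert (0 < / (1 - sg)) by (apply Rinv_0_lt_compat; lra).
  apply Rmult_lt_0_compat; [now apply nonlocal_lip_pos|now apply pow_lt]. }
pose proof (freq_pos b hb) as Hf; assert (Hf2 : 0 < freq b ^ 2) by now apply pow_lt.
(* Chosen so that the factor [4 L / (freq b ^ 2 * m)] produced by [heat_smoothing] is at most
   [1/2]. *)
set (m := Rmax 1 (8 * L / freq b ^ 2)).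
assert (Hm : 1 <= m) by apply Rmax_l.
assert (Hm8 : 8 * L <= freq b ^ 2 * m).
{ replace (8 * L) with (freq b ^ 2 * (8 * L / freq b ^ 2)) by (field; lra).
  apply Rmult_le_compat_l; [lra|apply Rmax_r]. }
set (g := (freq b * m) ^ 2).
assert (Hg : 0 < g) by (apply pow_lt; nra).
set (d x t := clamp_ext b u x t - clamp_ext b w x t).
assert (Ed : forall y s, - b <= y <= b -> d y s = u y s - w y s).
{ intros y s Hy; unfold d, clamp_ext; now rewrite !clamp_id. }
pose proof (heat_minus b _ _ _ _ (global_solution_heat b chi lam _ u hb Hu)
  (global_solution_heat b chi lam _ w hb Hw)) as Hd; fold d in Hd.
(* The start uses only that both solutions lie in [[0, 1)], so that the difference is at most
   [1 <= exp (g s)]. In the step the sources differ by at most [L] times the previous bound. *)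
assert (Key : forall k y s, - b <= y <= b -> 0 < s <= t -> Rabs (d y s) <= (1 / 2) ^ k * exp (g * s)).
{ induction k as [|k IH]; intros y s Hy Hs.
  - rewrite Ed by exact Hy; simpl pow; rewrite Rmult_1_l.
    pose proof (Bu y s Hy Hs); pose proof (Bw y s Hy Hs).
    pose proof (exp_ineq1 (g * s) ltac:(nra)).
    assert (0 < g * s) by nra. split_Rabs; lra.
  - assert (Hp : 0 < (1 / 2) ^ k) by (apply pow_lt; lra).
    assert (Hz : forall v, global_solution b chi lam (fun _ => 0) v -> forall s, 0 < s ->
      clamp_ext b v (- b) s = 0 /\ clamp_ext b v b s = 0).
    { intros v (_ & _ & _ & _ & Hbd & _) r Hr; unfold clamp_ext; rewrite !clamp_id by lra.
      split; apply Hbd; try (split; [exact Hr|exact I]); [now left|now right]. }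
    eapply Rle_trans; [apply (heat_smoothing b (L * (1 / 2) ^ k) m s d _ y hb (proj1 Hs) Hm ltac:(nra) Hd)|].
    + intros t1 Ht1 y' s'; apply continuity_2d_pt_minus.
      * apply (global_solution_cont2 b chi lam _ u t1 hb Ht1 Hu).
      * apply (global_solution_cont2 b chi lam _ w t1 hb Ht1 Hw).
    + intros r Hr; unfold d; destruct (Hz u Hu r Hr) as [-> ->]; destruct (Hz w Hw r Hr) as [-> ->].
      split; ring.
    + intros eps Heps.
      destruct (global_solution_initial b chi lam u (eps / 2) hb ltac:(lra) Hu) as (d1 & Hd1 & I1).
      destruct (global_solution_initial b chi lam w (eps / 2) hb ltac:(lra) Hw) as (d2 & Hd2 & I2).
      set (t1 := Rmin (s / 2) (Rmin (d1 / 2) (d2 / 2))).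
      assert (Ht1 : 0 < t1) by (repeat apply Rmin_glb_lt; lra).
      assert (t1 <= s / 2) by apply Rmin_l.
      assert (t1 <= d1 / 2) by (eapply Rle_trans; [apply Rmin_r|apply Rmin_l]).
      assert (t1 <= d2 / 2) by (eapply Rle_trans; [apply Rmin_r|apply Rmin_r]).
      exists t1; split; [lra|].
      specialize (I1 t1 ltac:(lra)); specialize (I2 t1 ltac:(lra)).
      assert (C1 : forall z, continuous (fun z => clamp_ext b u z t1) z)
        by (intros z; now apply (clamp_ext_continuous b chi lam (fun _ => 0))).
      assert (C2 : forall z, continuous (fun z => clamp_ext b w z t1) z)
        by (intros z; now apply (clamp_ext_continuous b chi lam (fun _ => 0))).
      assert (A1 : forall z, continuous (fun z => Rabs (clamp_ext b u z t1)) z)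
        by (intros z; apply (continuous_comp (fun z => clamp_ext b u z t1) Rabs); [apply C1|apply continuous_Rabs]).
      assert (A2 : forall z, continuous (fun z => Rabs (clamp_ext b w z t1)) z)
        by (intros z; apply (continuous_comp (fun z => clamp_ext b w z t1) Rabs); [apply C2|apply continuous_Rabs]).
      apply Rle_trans with (RInt (fun z => 1 * Rabs (clamp_ext b u z t1) + 1 * Rabs (clamp_ext b w z t1)) (- b) b).
      * apply RInt_le; [lra| | |].
        -- apply ex_RInt_cont; intros z; apply (continuous_comp (fun z => d z t1) Rabs); [|apply continuous_Rabs].
           apply continuous_minusR; [apply C1|apply C2].
        -- apply ex_RInt_cont; intros z; apply continuous_plusR;
             apply continuous_multR; first [apply continuous_const|apply A1|apply A2].
        -- intros z _; unfold d; split_Rabs; lra.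
      * rewrite RInt_lin by now apply ex_RInt_cont. lra.
    + intros y' r Hy' Hr; rewrite Rmult_assoc.
      apply reaction_lipschitz with (u0 := fun _ => 0); trivial; try lra.
      * intros z Hz'; pose proof (Bu z r Hz' ltac:(lra)); lra.
      * intros z Hz'; pose proof (Bw z r Hz' ltac:(lra)); lra.
      * intros z Hz'; rewrite <- Ed by exact Hz'; apply IH; [exact Hz'|lra].
    + exact Hy.
    + fold g; apply Rmult_le_compat_r; [apply Rlt_le, exp_pos|].
      apply (Rmult_le_reg_r (freq b ^ 2 * m)); [apply Rmult_lt_0_compat; lra|].
      replace (4 * (L * (1 / 2) ^ k) / (freq b ^ 2 * m) * (freq b ^ 2 * m)) with (4 * L * (1 / 2) ^ k)
        by (field; split; lra).
      simpl pow; nra. }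
assert (H0 : Rabs (d x t) <= 0).
{ apply (le_geom _ _ (exp (g * t))); intros k; rewrite Rplus_0_l, Rmult_comm; apply Key; lra. }
rewrite Ed in H0 by exact Hx; split_Rabs; lra.
Qed.

(** * Stationary solutions *)

Lemma expanding (f df : R -> R) (s r : R) :
  (forall s, is_derive f s (df s)) -> (forall s, 1 <= df s) ->
  s <= r -> r - s <= f r - f s.
Proof.
intros Df Hdf Hsr.
destruct (MVT_gen f s r df) as [c [_ Hc]].
- intros x _; apply Df.
- intros x _; apply continuity_pt_filterlim.
  apply ex_derive_continuousR; eexists; apply Df.
- pose proof (Hdf c); nra.
Qed.

Lemma expanding_abs (f df : R -> R) (s r : R) :
  (forall s, is_derive f s (df s)) -> (forall s, 1 <= df s) ->
  Rabs (r - s) <= Rabs (f r - f s).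
Proof.
intros Df Hdf; destruct (Rle_dec s r) as [H|H].
- pose proof (expanding f df s r Df Hdf H); rewrite !Rabs_pos_eq; lra.
- pose proof (expanding f df r s Df Hdf ltac:(lra)); rewrite !Rabs_left; lra.
Qed.

(** Expansion forces [f] to cross the value [y] between [- a] and [a], where [a = |y - f 0|], and
    the intermediate value theorem applies. *)
Lemma inverse_exists (f df : R -> R) :
  (forall s, is_derive f s (df s)) -> (forall s, 1 <= df s) ->
  exists g, forall y, f (g y) = y.
Proof.
intros Df Hdf; assert (H : forall y, exists s, f s = y).
{ intros y; set (a := Rabs (y - f 0)).
  assert (Ha : 0 <= a) by apply Rabs_pos.
  pose proof (expanding f df 0 a Df Hdf Ha); pose proof (expanding f df (- a) 0 Df Hdf ltac:(lra)).
  destruct (IVT_cor (fun s => f s - y) (- a) a) as [s [_ Hs]].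
  - intros s; apply continuity_pt_filterlim; change (continuous (fun s => f s - y) s).
    apply continuous_minusR; [|apply continuous_const].
    apply ex_derive_continuousR; eexists; apply Df.
  - lra.
  - assert (f (- a) - y <= 0) by (unfold a in *; split_Rabs; lra).
    assert (0 <= f a - y) by (unfold a in *; split_Rabs; lra). nra.
  - exists s; lra. }
exists (fun y => proj1_sig (constructive_indefinite_description _ (H y))).
intros y; now destruct (constructive_indefinite_description _ (H y)).
Qed.

(** The inverse is 1-Lipschitz by expansion, so the mean value theorem makes the difference quotient
    [1 / df c] with [c] within [|h|] of [g y]; reciprocals are 1-Lipschitz on [[1, oo)]. *)
Lemma inverse_derive (f df g : R -> R) (y : R) :
  (forall s, is_derive f s (df s)) -> (forall s, 1 <= df s) ->
  (forall y, f (g y) = y) ->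
  (forall s, continuous df s) -> is_derive g y (/ df (g y)).
Proof.
intros Df Hdf Hg Cdf; apply is_derive_Reals; intros eps Heps.
destruct (proj1 (filterlim_locally _ _) (Cdf (g y)) (mkposreal eps Heps)) as [del Hdel].
exists del; intros h Hh0 Hh.
set (k := g (y + h) - g y).
assert (Hk : Rabs k <= Rabs h).
{ pose proof (expanding_abs f df (g y) (g (y + h)) Df Hdf) as H; rewrite !Hg in H; fold k in H.
  now replace (y + h - y) with h in H by ring. }
destruct (MVT_gen f (g y) (g (y + h)) df) as [c [Hc1 Hc2]].
- intros x _; apply Df.
- intros x _; apply continuity_pt_filterlim.
  apply ex_derive_continuousR; eexists; apply Df.
- rewrite !Hg in Hc2; fold k in Hc2.
  pose proof (Hdf c) as H1; pose proof (Hdf (g y)) as H2.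
  assert (Eh : h = df c * k) by lra.
  assert (Hk0 : k <> 0) by (intros E; apply Hh0; rewrite Eh, E; ring).
  replace (k / h) with (/ df c) by (rewrite Eh; field; lra).
  assert (Hcy : Rabs (c - g y) <= Rabs k).
  { unfold k in *; revert Hc1; unfold Rmin, Rmax; destruct (Rle_dec (g y) (g (y + h))); split_Rabs; lra. }
  assert (Hd : Rabs (df c - df (g y)) < eps) by (apply Hdel; change (Rabs (c - g y) < del); lra).
  pose proof (inv_lipschitz (df c) (df (g y)) 1 Rlt_0_1 H1 H2) as HI.
  rewrite pow1, Rinv_1, Rmult_1_l in HI; lra.
Qed.

(** * Hyperbolic functions *)

Lemma sinh_derive (s : R) : is_derive sinh s (cosh s).
Proof. apply is_derive_Reals, derivable_pt_lim_sinh. Qed.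

Lemma cosh_derive (s : R) : is_derive cosh s (sinh s).
Proof. apply is_derive_Reals, derivable_pt_lim_cosh. Qed.

Lemma cosh_sq (s : R) : cosh s ^ 2 = 1 + sinh s ^ 2.
Proof.
unfold cosh, sinh.
assert (E : exp s * exp (- s) = 1) by (rewrite <- exp_plus, Rplus_opp_r; apply exp_0).
replace (((exp s + exp (- s)) / 2) ^ 2) with (((exp s - exp (- s)) / 2) ^ 2 + exp s * exp (- s)) by field.
lra.
Qed.

Lemma cosh_ge_1 (s : R) : 1 <= cosh s.
Proof.
pose proof (cosh_sq s); pose proof (pow2_ge_0 (sinh s)).
assert (0 < cosh s) by (unfold cosh; pose proof (exp_pos s); pose proof (exp_pos (- s)); lra).
nra.
Qed.

Lemma sinh_odd (s : R) : sinh (- s) = - sinh s.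
Proof. unfold sinh; rewrite Ropp_involutive; field. Qed.

Lemma cosh_even (s : R) : cosh (- s) = cosh s.
Proof. unfold cosh; rewrite Ropp_involutive; field. Qed.

Lemma sinh_le (s r : R) : s <= r -> sinh s <= sinh r.
Proof. intros [H| ->]; [now apply Rlt_le, sinh_lt|lra]. Qed.

Lemma cosh_sq_le (s r : R) : - r <= s <= r -> cosh s ^ 2 <= cosh r ^ 2.
Proof.
intros H; rewrite !cosh_sq.
pose proof (sinh_le s r ltac:(lra)); pose proof (sinh_le (- r) s ltac:(lra)) as H1.
rewrite sinh_odd in H1; nra.
Qed.

Lemma sinh_ge (s : R) : 0 <= s -> s <= sinh s.
Proof.
intros Hs; destruct (MVT_gen sinh 0 s cosh) as [c [_ Hc]].
- intros x _; apply sinh_derive.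
- intros x _; apply continuity_pt_filterlim.
  apply ex_derive_continuousR; eexists; apply sinh_derive.
- rewrite sinh_0 in Hc; pose proof (cosh_ge_1 c); nra.
Qed.

(** From [e <= 3]: [sinh (1/2)] is less than half the square root of 3. The bound makes [S <= 1/2] a
    convenient cap on the parameter of the stationary family. *)
Lemma cosh_half : cosh (1 / 2) ^ 2 <= 2.
Proof.
rewrite cosh_sq; set (E := exp (1 / 2)).
assert (HE : 0 < E) by apply exp_pos.
assert (E2 : E * E <= 3).
{ unfold E; rewrite <- exp_plus; replace (1 / 2 + 1 / 2) with 1 by field; apply exp_le_3. }
assert (Hs : sinh (1 / 2) <= 1).
{ unfold sinh; fold E; pose proof (exp_pos (- (1 / 2))); nra. }
pose proof (sinh_ge (1 / 2) ltac:(lra)); nra.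
Qed.

Lemma sinh_le_double (s : R) : 0 <= s <= 1 / 2 -> sinh s <= 2 * s.
Proof.
intros Hs; destruct (MVT_gen sinh 0 s cosh) as [c [Hc1 Hc]].
- intros x _; apply sinh_derive.
- intros x _; apply continuity_pt_filterlim.
  apply ex_derive_continuousR; eexists; apply sinh_derive.
- rewrite Rmin_left, Rmax_right in Hc1 by lra; rewrite sinh_0 in Hc.
  pose proof (cosh_sq_le c (1 / 2) ltac:(lra)); pose proof cosh_half; pose proof (cosh_ge_1 c).
  assert (cosh c <= 2) by nra. nra.
Qed.

(** The analogue of Kepler's equation, with [x] as time and [s] as eccentric anomaly: its derivative
    [2 cosh^2 s] is proportional to [z], and being at least 1 it makes the change of variable
    invertible. *)
Definition kepler (s : R) : R := s + sinh s * cosh s.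

Lemma kepler_derive (s : R) : is_derive kepler s (2 * cosh s ^ 2).
Proof.
replace (2 * cosh s ^ 2) with (1 + (cosh s * cosh s + sinh s * sinh s)).
- apply is_derive_plusR; [apply (is_derive_id (K := R_AbsRing))|].
  apply (is_derive_multR sinh cosh); [apply sinh_derive|apply cosh_derive].
- pose proof (cosh_sq s); lra.
Qed.

Lemma kepler_derive_ge (s : R) : 1 <= 2 * cosh s ^ 2.
Proof. pose proof (cosh_ge_1 s); nra. Qed.

Lemma cosh_continuous (s : R) : continuous cosh s.
Proof.
apply ex_derive_continuousR; eexists; apply cosh_derive.
Qed.

(** With [K = kepler S] and [C = cosh S], the profile solves [z'' = mu / z^2] for
    [mu = K^2 / (2 b^2 C^6)], and the integral of [1 / z] is [I = 4 b S C^2 / K]. This is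
    [lam = mu (1 + chi I)^2] written out. *)
Definition stationary_lambda (b chi S : R) : R :=
  (kepler S + 4 * b * chi * S * cosh S ^ 2) ^ 2 / (2 * b ^ 2 * cosh S ^ 6).

(* With [1 - v = z0 cosh^2 s] and [x] proportional to [s + sinh s cosh s], the equation
   [z'' = mu / z^2] is the repulsive Kepler problem in its explicit parametrization. *)
Lemma stationary_family (b chi S : R) : 0 < b -> 0 < chi -> 0 < S ->
  exists v, stationary_solution b chi (stationary_lambda b chi S) v /\
    ex_RInt (fun x => Derive v x ^ 2) (- b) b /\
    RInt (fun x => Derive v x ^ 2) (- b) b =
      2 * kepler S * (sinh S * cosh S - S) / (b * cosh S ^ 4).
Proof.
intros hb hchi HS.
destruct (inverse_exists kepler _ kepler_derive kepler_derive_ge) as [sg Hsg].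
assert (Ck : forall s, continuous (fun s => 2 * cosh s ^ 2) s).
{ intros s; apply (continuous_ext (fun s => 2 * (cosh s * cosh s))); [intros; (in_R; ring)|].
  apply continuous_multR; [apply continuous_const|].
  apply continuous_multR; apply cosh_continuous. }
assert (Dsg : forall y, is_derive sg y (/ (2 * cosh (sg y) ^ 2))).
{ intros y; now apply (inverse_derive kepler (fun s => 2 * cosh s ^ 2) sg y kepler_derive kepler_derive_ge). }
assert (Hinv : forall s, sg (kepler s) = s).
{ intros s; pose proof (expanding_abs kepler _ s (sg (kepler s)) kepler_derive kepler_derive_ge) as H.
  rewrite Hsg, Rminus_diag, Rabs_R0 in H; split_Rabs; lra. }
assert (Hmono : forall y y', y <= y' -> sg y <= sg y').
{ intros y y' Hy; apply Rnot_lt_le; intros Hlt.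
  pose proof (expanding kepler _ (sg y') (sg y) kepler_derive kepler_derive_ge ltac:(lra)) as H.
  rewrite !Hsg in H; lra. }
set (K := kepler S); set (C := cosh S).
assert (HC : 1 <= C) by apply cosh_ge_1.
assert (HK : 0 < K).
{ unfold K, kepler; pose proof (sinh_ge S ltac:(lra)); fold C; nra. }
set (s x := sg (x * (K / b))).
assert (Ds : forall x, is_derive s x (K / b / (2 * cosh (s x) ^ 2))).
{ intros x; unfold s.
  replace (K / b / (2 * cosh (sg (x * (K / b))) ^ 2)) with
    (scal (K / b) (/ (2 * cosh (sg (x * (K / b))) ^ 2))) by reflexivity.
  apply (is_derive_comp sg (fun x => x * (K / b))); [apply Dsg|].
  auto_derive; [exact I|ring]. }
assert (sb : s b = S).
{ unfold s; replace (b * (K / b)) with K by (field; lra); apply Hinv. }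
assert (smb : s (- b) = - S).
{ unfold s; replace (- b * (K / b)) with (kepler (- S)); [apply Hinv|].
  unfold kepler; rewrite sinh_odd, cosh_even; unfold K, kepler; field; lra. }
assert (Hs : forall x, - b <= x <= b -> - S <= s x <= S).
{ intros x Hx; assert (0 < K / b) by now apply Rdiv_lt_0_compat.
  split; [rewrite <- smb|rewrite <- sb]; apply Hmono; nra. }
assert (Hch : forall x, 1 <= cosh (s x)) by (intros; apply cosh_ge_1).
set (v x := 1 - cosh (s x) ^ 2 / C ^ 2).
set (v1 x := - (K / (b * C ^ 2)) * (sinh (s x) / cosh (s x))).
set (v2 x := - (K ^ 2 / (2 * b ^ 2 * C ^ 2)) / cosh (s x) ^ 4).
assert (Dv : forall x, is_derive v x (v1 x)).
{ intros x; unfold v.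
  assert (D : is_derive (fun r => 1 - cosh r ^ 2 / C ^ 2) (s x) (- 2 * cosh (s x) * sinh (s x) / C ^ 2)).
  { auto_derive; [exact I|field; lra]. }
  replace (v1 x) with (scal (K / b / (2 * cosh (s x) ^ 2)) (- 2 * cosh (s x) * sinh (s x) / C ^ 2)).
  - apply (is_derive_comp (fun r => 1 - cosh r ^ 2 / C ^ 2) s); [exact D|apply Ds].
  - pose proof (Hch x); unfold v1, scal; simpl; unfold mult; simpl; field; lra. }
assert (Dth : forall r, is_derive (fun r => sinh r / cosh r) r (/ cosh r ^ 2)).
{ intros r; pose proof (cosh_ge_1 r) as Hr.
  replace (/ cosh r ^ 2) with ((cosh r * cosh r - sinh r * sinh r) / cosh r ^ 2).
  - apply is_derive_div; [apply sinh_derive|apply cosh_derive|lra].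
  - pose proof (cosh_sq r); replace (cosh r * cosh r - sinh r * sinh r) with 1 by lra; field; lra. }
assert (Dv1 : forall x, is_derive v1 x (v2 x)).
{ intros x; unfold v1.
  replace (v2 x) with (- (K / (b * C ^ 2)) * scal (K / b / (2 * cosh (s x) ^ 2)) (/ cosh (s x) ^ 2)).
  - apply is_derive_scal, (is_derive_comp (fun r => sinh r / cosh r) s); [apply Dth|apply Ds].
  - pose proof (Hch x); unfold v2, scal; simpl; unfold mult; simpl; field; lra. }
assert (Cs : forall x, continuous s x).
{ intros x; apply ex_derive_continuousR; eexists; apply Ds. }
assert (Cch : forall n x, continuous (fun x => / cosh (s x) ^ n) x).
{ intros n x; apply (continuous_comp s (fun r => / cosh r ^ n)); [apply Cs|].
  apply ex_derive_continuousR.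
  auto_derive; apply pow_nonzero; pose proof (Hch x); lra. }
assert (Cv2 : forall x, continuous v2 x).
{ intros x; apply continuous_multR; [apply continuous_const|apply (Cch 4%nat)]. }
assert (Cv1 : forall x, continuous v1 x).
{ intros x; apply ex_derive_continuousR; eexists; apply Dv1. }
assert (Cv : forall x, continuous v x).
{ intros x; apply ex_derive_continuousR; eexists; apply Dv. }
assert (E1 : forall x, Derive_n v 1 x = v1 x) by (intros; now apply is_derive_unique).
assert (E2 : forall x, Derive_n v 2 x = v2 x).
{ intros x; simpl; rewrite (Derive_ext _ v1); [now apply is_derive_unique|exact E1]. }
(* The integrand is a constant multiple of the derivative of [s], so the integral is proportional to
   [s b - s (- b) = 2 S]. *)
assert (HI : RInt (fun y => 1 / (1 - v y)) (- b) b = 4 * b * S * C ^ 2 / K).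
{ rewrite (RInt_eq _ (fun y => 2 * b * C ^ 2 / K * (K / b / (2 * cosh (s y) ^ 2)))).
  2:{ intros y; pose proof (Hch y); unfold v; in_R; field; repeat split; try lra.
      replace (C ^ 2 - (C ^ 2 - cosh (s y) ^ 2)) with (cosh (s y) ^ 2) by ring.
      apply pow_nonzero; lra. }
  assert (Cd : forall y, continuous (fun y => K / b / (2 * cosh (s y) ^ 2)) y).
  { intros y; apply (continuous_ext (fun y => K / (2 * b) * / cosh (s y) ^ 2)).
    - intros z; pose proof (Hch z); in_R; field; lra.
    - apply continuous_multR; [apply continuous_const|apply Cch]. }
  rewrite RInt_scalR by now apply ex_RInt_cont.
  rewrite (is_RInt_unique _ (- b) b (minus (s b) (s (- b))))
    by (apply (is_RInt_derive s); intros; [apply Ds|apply Cd]).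
  rewrite sb, smb; unfold minus, plus, opp; simpl; in_R; field; lra. }
assert (HE : is_RInt (fun x => Derive v x ^ 2) (- b) b
  (2 * K * (sinh S * C - S) / (b * C ^ 4))).
(* The square of [v'] is a multiple of [tanh^2 s], and [dx] of [cosh^2 s ds]; their product is a
   multiple of [sinh^2 s ds], of which [w] is twice the primitive. *)
{ set (w r := sinh r * cosh r - r).
  assert (Dw : forall r, is_derive w r (2 * sinh r ^ 2)).
  { intros r; replace (2 * sinh r ^ 2) with
      (cosh r * cosh r + sinh r * sinh r - 1).
    - apply is_derive_minusR; [|apply (is_derive_id (K := R_AbsRing))].
      apply (is_derive_multR sinh cosh); [apply sinh_derive|apply cosh_derive].
    - pose proof (cosh_sq r); lra. }
  apply (is_RInt_ext (fun x => v1 x ^ 2)).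
  { intros x _; f_equal; symmetry; apply E1. }
  replace (2 * K * (sinh S * C - S) / (b * C ^ 4)) with
    (minus (K / (b * C ^ 4) * w (s b)) (K / (b * C ^ 4) * w (s (- b)))).
  - apply (is_RInt_derive (fun x => K / (b * C ^ 4) * w (s x))).
    + intros x _.
      replace (v1 x ^ 2) with (K / (b * C ^ 4) * scal (K / b / (2 * cosh (s x) ^ 2)) (2 * sinh (s x) ^ 2)).
      * apply is_derive_scal, (is_derive_comp w s); [apply Dw|apply Ds].
      * pose proof (Hch x); unfold v1, scal; simpl; unfold mult; simpl; field; lra.
    + intros x _; apply (continuous_ext (fun x => v1 x * v1 x)); [intros; simpl; ring|].
      apply continuous_multR; apply Cv1.
  - rewrite sb, smb; unfold w; rewrite sinh_odd, cosh_even; fold C.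
    unfold minus, plus, opp; simpl; field; lra. }
exists v; split; [|split; [eexists; exact HE|apply is_RInt_unique, HE]].
split; [|split; [|split; [|split]]].
- intros x Hx k Hk; destruct k as [|[|[|k]]]; [| | |lia].
  + split; [exact I|apply Cv].
  + split; [eexists; apply Dv|].
    apply (continuous_ext v1); [intros; symmetry; apply E1|apply Cv1].
  + split.
    * exists (v2 x); apply (is_derive_ext v1); [intros; symmetry; apply E1|apply Dv1].
    * apply (continuous_ext v2); [intros; symmetry; apply E2|apply Cv2].
- apply continuous_on_forall; intros x _; apply Cv.
- intros x Hx; unfold Omega in Hx; unfold v.
  pose proof (cosh_sq_le (s x) S (Hs x ltac:(lra))) as Hle; fold C in Hle.
  pose proof (Hch x) as H1.
  assert (H0 : 0 < cosh (s x) ^ 2 / C ^ 2) by (apply Rdiv_lt_0_compat; apply pow_lt; lra).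
  assert (H2 : cosh (s x) ^ 2 / C ^ 2 <= 1).
  { apply (Rmult_le_reg_r (C ^ 2)); [apply pow_lt; lra|]; field_simplify; lra. }
  lra.
- intros x Hx; rewrite E2; unfold reaction; rewrite HI.
  pose proof (Hch x) as H1; unfold v2, v, stationary_lambda; fold K C.
  assert (HP : 0 < K + 4 * b * chi * S * C ^ 2).
  { assert (0 < 4 * b * chi * S * C ^ 2); [|lra].
    do 3 (apply Rmult_lt_0_compat; [|first [apply pow_lt; lra|lra]]); lra. }
  replace (1 - (1 - cosh (s x) ^ 2 / C ^ 2)) with (cosh (s x) ^ 2 / C ^ 2) by ring.
  replace (1 + chi * (4 * b * S * C ^ 2 / K)) with ((K + 4 * b * chi * S * C ^ 2) / K) by (field; lra).
  set (P := K + 4 * b * chi * S * C ^ 2) in *; field; lra.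
- intros x [->| ->]; unfold v; [rewrite smb, cosh_even|rewrite sb]; fold C; field; lra.
Qed.

(** Intermediate values between [S = 0], where the parameter is 0, and [S = 1/2], where it exceeds
    the threshold. With [k = 2 b chi], the threshold times [8 b^2] is [k (1 + k)], and the latter
    claim becomes a comparison of polynomials in [k] with [1 <= cosh^2 (1/2) <= 2]. *)
Lemma stationary_lambda_surjective (b chi lam : R) : 0 < b -> 0 < chi ->
  0 < lam < chi * (1 + chi * len_Omega b) / (2 * len_Omega b) ->
  exists S, 0 < S <= 1 / 2 /\ stationary_lambda b chi S = lam.
Proof.
unfold len_Omega; intros hb hchi [hl hlam].
assert (Clam : continuity (fun S => stationary_lambda b chi S - lam)).
{ intros S; apply continuity_pt_filterlim; change (continuous (fun S => stationary_lambda b chi S - lam) S).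
  apply ex_derive_continuousR.
  pose proof (cosh_ge_1 S); unfold stationary_lambda, kepler; auto_derive.
  change (2 * b ^ 2 * cosh S ^ 6 <> 0).
  apply Rgt_not_eq, Rmult_lt_0_compat; [nra|apply pow_lt; lra]. }
destruct (IVT_cor (fun S => stationary_lambda b chi S - lam) 0 (1 / 2)) as [S [HS1 HS2]]; [exact Clam|lra| |].
- assert (H0 : stationary_lambda b chi 0 - lam <= 0).
  { unfold stationary_lambda, kepler; rewrite sinh_0, cosh_0.
    replace ((0 + 0 * 1 + 4 * b * chi * 0 * 1 ^ 2) ^ 2 / (2 * b ^ 2 * 1 ^ 6)) with 0 by (field; lra); lra. }
  assert (H1 : 0 <= stationary_lambda b chi (1 / 2) - lam).
  { set (c := cosh (1 / 2)).
    assert (Hc : 1 <= c) by apply cosh_ge_1; assert (Hc2 : c ^ 2 <= 2) by apply cosh_half.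
    pose proof (sinh_ge (1 / 2) ltac:(lra)) as Hs.
    assert (HK : 1 <= kepler (1 / 2)) by (unfold kepler; fold c; nra).
    set (k := 2 * b * chi); assert (Hk : 0 < k) by (unfold k; nra).
    assert (Hq : k * (1 + k) * c ^ 6 <= 4 * (kepler (1 / 2) + k * c ^ 2) ^ 2).
    { set (q := c ^ 2) in *; assert (Hq1 : 1 <= q) by (unfold q; nra).
      replace (c ^ 6) with (q ^ 3) by (unfold q; ring).
      apply Rle_trans with (4 * (1 + k * q) ^ 2).
      - assert (q ^ 2 <= 4) by nra. assert (q ^ 3 <= 4 * q) by nra.
        assert (q ^ 3 <= 2 * q ^ 2) by nra.
        assert (0 <= k ^ 2) by apply pow2_ge_0.
        assert (k * q ^ 3 <= k * (4 * q)) by (apply Rmult_le_compat_l; lra).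
        assert (k ^ 2 * q ^ 3 <= k ^ 2 * (2 * q ^ 2)) by (apply Rmult_le_compat_l; lra).
        assert (0 <= k ^ 2 * q ^ 2) by (apply Rmult_le_pos; [lra|nra]).
        assert (0 <= k * q) by nra.
        nra.
      - apply Rmult_le_compat_l; [lra|]; apply pow_incr; nra. }
    assert (HA : chi * (1 + chi * (2 * b)) / (2 * (2 * b)) <= stationary_lambda b chi (1 / 2)); [|lra].
    unfold stationary_lambda; fold c.
    replace (kepler (1 / 2) + 4 * b * chi * (1 / 2) * c ^ 2) with (kepler (1 / 2) + k * c ^ 2)
      by (unfold k; field).
    apply (Rmult_le_reg_r (8 * b ^ 2 * c ^ 6)).
    - apply Rmult_lt_0_compat; [nra|apply pow_lt; lra].
    - replace (chi * (1 + chi * (2 * b)) / (2 * (2 * b)) * (8 * b ^ 2 * c ^ 6)) with (k * (1 + k) * c ^ 6)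
        by (unfold k; field; lra).
      replace ((kepler (1 / 2) + k * c ^ 2) ^ 2 / (2 * b ^ 2 * c ^ 6) * (8 * b ^ 2 * c ^ 6)) with
        (4 * (kepler (1 / 2) + k * c ^ 2) ^ 2) by (field; lra).
      exact Hq. }
  nra.
- exists S; split; [|lra].
  split; [|lra]; destruct (Req_dec S 0) as [->|]; [|lra].
  unfold stationary_lambda, kepler in HS2; rewrite sinh_0, cosh_0 in HS2.
  replace ((0 + 0 * 1 + 4 * b * chi * 0 * 1 ^ 2) ^ 2 / (2 * b ^ 2 * 1 ^ 6)) with 0 in HS2 by (field; lra); lra.
Qed.

(** Clearing denominators with [k = 2 b chi] leaves [(k + k^2) W <= (K + 2 k S c^2)^2], where
    [W = K (h c - S) c^2]. The coefficients of [k] and [k^2] are compared separately: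
    [W <= 4 K S c^2] follows from [h c <= 4 S], and [W <= 4 S^2 c^4] from [h <= 2 S]. *)
Lemma stationary_energy (b chi S : R) : 0 < b -> 0 < chi -> 0 < S <= 1 / 2 ->
  2 * kepler S * (sinh S * cosh S - S) / (b * cosh S ^ 4) <=
  2 * stationary_lambda b chi S / (chi * (1 + chi * len_Omega b)).
Proof.
unfold len_Omega; intros hb hchi HS.
set (c := cosh S); set (h := sinh S).
assert (Hc : 1 <= c) by apply cosh_ge_1.
assert (Hc2 : c ^ 2 <= 2).
{ eapply Rle_trans; [apply (cosh_sq_le S (1 / 2)); lra|apply cosh_half]. }
assert (Hh : S <= h <= 2 * S) by (split; [apply sinh_ge|apply sinh_le_double]; lra).
set (K := kepler S); assert (EK : K = S + h * c) by reflexivity.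
set (k := 2 * b * chi); assert (Hk : 0 < k) by (unfold k; nra).
assert (Hhc : h * c <= 4 * S).
{ assert (c <= 2) by nra. nra. }
assert (Hhc0 : S <= h * c) by nra.
assert (HK : 0 < K) by lra.
assert (Key : k * (1 + k) * (K * (h * c - S) * c ^ 2) <= (K + 2 * k * S * c ^ 2) ^ 2).
{ assert (Q1 : K * (h * c - S) * c ^ 2 <= 4 * K * S * c ^ 2).
  { assert (K * (h * c - S) <= K * (4 * S)) by (apply Rmult_le_compat_l; lra). nra. }
  assert (Q2 : K * (h * c - S) * c ^ 2 <= 4 * S ^ 2 * c ^ 4).
  { assert (h ^ 2 <= 4 * S ^ 2) by nra.
    assert (K * (h * c - S) <= 4 * S ^ 2 * c ^ 2).
    { rewrite EK; replace ((S + h * c) * (h * c - S)) with (h ^ 2 * c ^ 2 - S ^ 2) by ring.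
      assert (h ^ 2 * c ^ 2 <= 4 * S ^ 2 * c ^ 2) by (apply Rmult_le_compat_r; [nra|lra]).
      pose proof (pow2_ge_0 S); lra. }
    replace (4 * S ^ 2 * c ^ 4) with (4 * S ^ 2 * c ^ 2 * c ^ 2) by ring.
    apply Rmult_le_compat_r; [nra|lra]. }
  set (W := K * (h * c - S) * c ^ 2) in *.
  assert (k * W <= k * (4 * K * S * c ^ 2)) by (apply Rmult_le_compat_l; lra).
  assert (k ^ 2 * W <= k ^ 2 * (4 * S ^ 2 * c ^ 4)) by (apply Rmult_le_compat_l; [apply pow2_ge_0|lra]).
  assert (0 <= K ^ 2) by apply pow2_ge_0.
  replace ((K + 2 * k * S * c ^ 2) ^ 2) with
    (K ^ 2 + k * (4 * K * S * c ^ 2) + k ^ 2 * (4 * S ^ 2 * c ^ 4)) by ring.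
  lra. }
unfold stationary_lambda; fold c K.
replace (4 * b * chi * S * c ^ 2) with (2 * k * S * c ^ 2) by (unfold k; ring).
replace (2 * ((K + 2 * k * S * c ^ 2) ^ 2 / (2 * b ^ 2 * c ^ 6)) / (chi * (1 + chi * (2 * b))))
  with ((K + 2 * k * S * c ^ 2) ^ 2 / (b ^ 2 * c ^ 6 * chi * (1 + k))).
2:{ unfold k; field; repeat split; try lra; apply Rgt_not_eq; nra. }
assert (Hden : 0 < b ^ 2 * c ^ 6 * chi * (1 + k)).
{ apply Rmult_lt_0_compat; [apply Rmult_lt_0_compat|]; [apply Rmult_lt_0_compat; apply pow_lt|..]; lra. }
apply (Rmult_le_reg_r (b ^ 2 * c ^ 6 * chi * (1 + k))); [exact Hden|].
replace ((K + 2 * k * S * c ^ 2) ^ 2 / (b ^ 2 * c ^ 6 * chi * (1 + k)) * (b ^ 2 * c ^ 6 * chi * (1 + k)))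
  with ((K + 2 * k * S * c ^ 2) ^ 2) by (field; lra).
replace (2 * K * (h * c - S) / (b * c ^ 4) * (b ^ 2 * c ^ 6 * chi * (1 + k)))
  with (k * (1 + k) * (K * (h * c - S) * c ^ 2)) by (unfold k; field; lra).
exact Key.
Qed.

(** [lambda_N_star] also quantifies over [lam = 0], which the family with [S > 0] does not reach. *)
Lemma stationary_zero (b chi : R) : stationary_solution b chi 0 (fun _ => 0).
Proof.
assert (E : forall k x, Derive_n (fun _ => 0) k x = 0).
{ induction k as [|k IH]; intros x; [reflexivity|simpl].
  rewrite (Derive_ext _ (fun _ => 0)) by apply IH; apply Derive_const. }
split; [|split; [|split; [|split]]].
- intros x _ k _; split.
  + destruct k as [|k]; [exact I|].
    apply (ex_derive_ext (fun _ => 0)); [intros; symmetry; apply E|].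
    apply (ex_derive_const (K := R_AbsRing) (V := R_NormedModule)).
  + apply (continuous_ext (fun _ => 0)); [intros; symmetry; apply E|apply continuous_const].
- apply continuous_on_forall; intros x _; apply continuous_const.
- intros; lra.
- intros x _; rewrite E; unfold reaction, Rdiv; ring.
- reflexivity.
Qed.

Theorem theorem3p1 (b chi : R) (hb : 0 < b) (hchi : 0 < chi) :
  (forall lam : R,
     0 < lam < chi * (1 + chi * len_Omega b) / (2 * len_Omega b) ->
     (exists u : R -> R -> R,
        global_solution b chi lam (fun _ => 0) u /\
        (forall x t, Omega_bar b x -> 0 < t -> 0 <= u x t) /\
        (forall u' : R -> R -> R,
           global_solution b chi lam (fun _ => 0) u' ->
           forall x t, Omega_bar b x -> 0 < t -> u' x t = u x t)) /\
     (exists v : R -> R,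
        stationary_solution b chi lam v /\
        ex_RInt (fun x => (Derive v x) ^ 2) (- b) b /\
        RInt (fun x => (Derive v x) ^ 2) (- b) b
          <= 2 * lam / (chi * (1 + chi * len_Omega b)))) /\
  Rbar_le (chi * (1 + chi * len_Omega b) / (2 * len_Omega b)) (lambda_N_star b chi).
Proof.
assert (Hstat : forall lam, 0 < lam < chi * (1 + chi * len_Omega b) / (2 * len_Omega b) ->
  exists v, stationary_solution b chi lam v /\ ex_RInt (fun x => (Derive v x) ^ 2) (- b) b /\
    RInt (fun x => (Derive v x) ^ 2) (- b) b <= 2 * lam / (chi * (1 + chi * len_Omega b))).
{ intros lam hlam.
  destruct (stationary_lambda_surjective b chi lam hb hchi hlam) as (S & HS & <-).
  destruct (stationary_family b chi S hb hchi (proj1 HS)) as (v & Hv & Ev & Iv).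
  exists v; split; [exact Hv|split; [exact Ev|rewrite Iv; now apply stationary_energy]]. }
split.
- intros lam hlam; split; [|now apply Hstat].
  destruct (global_existence b chi lam hb hchi hlam) as (u & Hu & Hu0).
  exists u; split; [exact Hu|split; [exact Hu0|]].
  intros u' Hu' x t Hx Ht; apply (global_uniqueness b chi lam u u'); trivial; lra.
- set (thr := chi * (1 + chi * len_Omega b) / (2 * len_Omega b)) in *.
  assert (Hthr : 0 < thr).
  { unfold thr, len_Omega; apply Rdiv_lt_0_compat; [apply Rmult_lt_0_compat; nra|lra]. }
  (* Each positive value below the threshold belongs to the set defining [lambda_N_star]. The
     threshold itself is only approached, since existence is known under a strict inequality. *)
  assert (Hmem : forall l, 0 < l < thr -> Rbar_le l (lambda_N_star b chi)).
  { intros l Hl; apply (proj1 (Lub_Rbar_correct _)); split; [lra|].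
    intros lam Hlam; destruct (Req_dec lam 0) as [->|Hne].
    - eexists; apply stationary_zero.
    - destruct (Hstat lam ltac:(lra)) as (v & Hv & _); now exists v. }
  destruct (lambda_N_star b chi) as [l| |]; [|exact I|exact (Hmem (thr / 2) ltac:(lra))].
  simpl in *; apply Rnot_lt_le; intros Hlt.
  (* A point strictly between [l] and [thr]; taking [Rmax l 0] keeps it positive. *)
  pose proof (Hmem ((Rmax l 0 + thr) / 2)) as H; unfold Rmax in H; destruct (Rle_dec l 0); lra.
Qed.
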